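(* Let $u_0,f,\ell$ satisfy the assumptions (A0), (A1), (A2) listed in the context, let $\alpha\in(0,1)$ and $\gamma>0$, and let $(\lambda^{(k)},a^{(k)})_{k\ge0}$ be the iterates on $\mathbb{R}^d\times[0,T]$ of the algorithm described in the context. For $k=1,2,\dots$ define $$e_k=\int_0^Te^{-\gamma t}\int_{\mathbb{R}^d}\frac{|(\lambda^{(k)}-\lambda^{(k-1)})(x,t)|^2}{(1+|x|^2)^{2\alpha}}\,dx\,dt.$$ Then there exist $T_0>0$ and $\gamma_0>0$, depending on the data in (A0)--(A2), such that for $T\le T_0$ and $\gamma\ge\gamma_0$ one has $e_k=\mathcal{O}(2^{-k})$ as $k\to\infty$; more precisely, $e_k\le2^{-(k-1)}e_1$ for all $k\in\mathbb{N}$.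
   Context: Data: $u_0:\mathbb{R}^d\to\mathbb{R}$, $f:\mathbb{R}^d\times\mathbb{R}^p\to\mathbb{R}^d$, $\ell:\mathbb{R}^d\times\mathbb{R}^p\to\mathbb{R}$ are of class $C^2$ (so that the derivatives below make sense), and $C_0,C_f,C_\ell,\ell_0>0$ are constants. (A0) $|\nabla u_0(x)|\le C_0(1+|x|)$ and $|D^2u_0(x)|\le C_0$ for all $x$. (A1) $f(x,a)=f_0(x)+\mathbf{c}_f^Ta$ with $f_0:\mathbb{R}^d\to\mathbb{R}^d$ and $\mathbf{c}_f\in\mathbb{R}^{p\times d}$, $|\mathbf{c}_f|\le C_f$; $|f(x,a)|\le C_f(1+|x|+|a|)$; $|D_xf(x,a)|\le C_f$; $D^2_{aa}\ell(x,a)\succeq\ell_0\,\mathbb{I}_p$; $|D_a\ell(x,a)|\ge\ell_0(|a|-1)$; $|\ell(x,a)|\le C_\ell(1+|x|^2+|a|^2)$; $|D_x\ell(x,a)|\le C_\ell(1+|x|+|a|)$, for all $(x,a)$. (A2) $\sum_{i=1}^d|D_x(\partial_{x_i}f(x,a))|\le\frac{C_f}{1+|x|}$; $|\ell(x_1,a_1)-\ell(x_2,a_2)|\le C_\ell\big(1+\max(|x_1|,|x_2|)+\max(|a_1|,|a_2|)\big)\big(|x_1-x_2|+|a_1-a_2|\big)$; $|D^2_{xa}\ell|,|D^2_{ax}\ell|,|D^2_{xx}\ell|\le C_\ell$. Algorithm (value-gradient policy iteration): $\lambda^{(0)}(x,t)=\nabla u_0(x)$. For each $k\ge0$, given $\lambda^{(k)}:\mathbb{R}^d\times[0,T]\to\mathbb{R}^d$,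 the policy is $$a^{(k)}(x,t)=\arg\max_{a\in\mathbb{R}^p}\Big(-\lambda^{(k)}(x,t)\cdot f(x,a)-\ell(x,a)\Big),$$ and $\lambda^{(k+1)}=(\lambda^{(k+1)}_1,\dots,\lambda^{(k+1)}_d)$ solves, for $i=1,\dots,d$, the linear transport equations $$\partial_t\lambda^{(k+1)}_i=\sum_{j=1}^d f_j(x,a^{(k)})\,\partial_{x_j}\lambda^{(k+1)}_i+\sum_{j=1}^d\partial_{x_i}f_j(x,a^{(k)})\,\lambda^{(k)}_j+\partial_{x_i}\ell(x,a^{(k)})\quad\text{in }\mathbb{R}^d\times(0,T),$$ with $\lambda^{(k+1)}(x,0)=\nabla u_0(x)$, where $a^{(k)}=a^{(k)}(x,t)$ and $\partial_{x_i}f_j$, $\partial_{x_i}\ell$ denote partial derivatives in the first argument.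
   Formalization: The claim e_k = O(2^{-k}) is stated under the condition that e_1 is finite (e_1 can be infinite, e.g. d ≥ 2, f = εx, and then the claim fails); e_k ≤ 2^{-(k-1)} e_1 is proved in the extended reals without this condition. *)

(* Defs.v *)
From HB Require Import structures.
From mathcomp Require Import all_boot all_order all_algebra.
From mathcomp Require Import all_classical all_reals all_analysis.

Set Implicit Arguments.
Unset Strict Implicit.
Unset Printing Implicit Defensive.

Import Order.TTheory GRing.Theory Num.Theory.
Import numFieldNormedType.Exports.

Local Open Scope classical_set_scope.
Local Open Scope ring_scope.

(* Vectors of R^n are row vectors 'rV[R]_n. The library norm `|_| on matrices
   is the sup norm, so the Euclidean norm is defined here; on matrices [enorm]
   is the Frobenius norm. *)
Section euclidean.
Context {R : realType}.

Definition enorm m n (A : 'M[R]_(m, n)) : R :=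
  Num.sqrt (\sum_(i < m) \sum_(j < n) A i j ^+ 2).

Definition dotv n (u v : 'rV[R]_n) : R := \sum_(j < n) u 0 j * v 0 j.

(* Order on symmetric matrices: [loewner_le A B] is B - A >= 0. *)
Definition loewner_le n (A B : 'M[R]_n) : Prop :=
  forall xi : 'rV[R]_n, 0 <= dotv (xi *m (B - A)) xi.

End euclidean.

Section calculus.
Context {R : realType}.

(* For a finite-dimensional V, continuity of all the 'D_v g is continuity of
   the differential. *)
Definition C1_on (V W : normedModType R) (A : set V) (g : V -> W) : Prop :=
  forall z, A z ->
    differentiable g z /\ forall v : V, {for z, continuous ('D_v g)}.

Definition C2 (V W : normedModType R) (g : V -> W) : Prop :=
  C1_on setT g /\ forall v : V, C1_on setT ('D_v g).

Definition grad n (g : 'rV[R]_n -> R) (x : 'rV[R]_n) : 'rV[R]_n :=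
  \row_(i < n) 'D_('e_i) g x.

(* The library's ['J G x] acts on row vectors: its (i, j) entry is
   d_{x_i} G_j(x). In particular [hess g x] i j = d_{x_i} d_{x_j} g (x). *)
Definition hess n (g : 'rV[R]_n -> R) (x : 'rV[R]_n) : 'M[R]_n :=
  'J (grad g) x.

End calculus.

(* Lebesgue measure on R^n, carried by the n-tuples (whose sigma-algebra is the
   product one): the product of n copies of Lebesgue measure on R. *)
Section lebesgue_measure_n.
Context {R : realType}.

Definition cons_pair n (z : n.-tuple R * R) : n.+1.-tuple R :=
  [tuple of z.2 :: z.1].

Lemma measurable_cons_pair n : measurable_fun setT (@cons_pair n).
Proof. exact: measurable_cons. Qed.

(* [pushforward (mu \x lebesgue_measure) cons_pair], as a measure. *)
Definition lebesgue_measure_S n (mu : {measure set (n.-tuple R) -> \bar R}) :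
    {measure set (n.+1.-tuple R) -> \bar R} :=
  measure_function_pushforward__canonical__measure_function_Measure
    (mu \x @lebesgue_measure R)%E (@measurable_cons_pair n).

Fixpoint lebesgue_measure_n n : {measure set (n.-tuple R) -> \bar R} :=
  match n with
  | 0 => dirac [tuple]
  | n'.+1 => lebesgue_measure_S (lebesgue_measure_n n')
  end.

Definition rV_of_tuple n (t : n.-tuple R) : 'rV[R]_n := \row_i tnth t i.

End lebesgue_measure_n.

Section policy_iteration.
Context {R : realType} (d p : nat).

Local Notation state := 'rV[R]_d.
Local Notation control := 'rV[R]_p.

Record assumption_A0 (C0 : R) (u0 : state -> R) : Prop := {
  A0_grad : forall x, enorm (grad u0 x) <= C0 * (1 + enorm x);
  A0_hess : forall x, enorm (hess u0 x) <= C0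
}.

(* With row vectors, c^T a is [a *m c]. *)
Record assumption_A1 (Cf Cl l0 : R)
    (f : state -> control -> state) (l : state -> control -> R) : Prop := {
  A1_affine : exists (f0 : state -> state) (c : 'M[R]_(p, d)),
    enorm c <= Cf /\ forall x a, f x a = f0 x + a *m c;
  A1_f_growth : forall x a, enorm (f x a) <= Cf * (1 + enorm x + enorm a);
  A1_Dxf : forall x a, enorm ('J (f^~ a) x) <= Cf;
  A1_convex : forall x a, loewner_le (l0%:M) (hess (l x) a);
  A1_Dal : forall x a, l0 * (enorm a - 1) <= enorm (grad (l x) a);
  A1_l_growth : forall x a, `|l x a| <= Cl * (1 + enorm x ^+ 2 + enorm a ^+ 2);
  A1_Dxl : forall x a,
    enorm (grad (l^~ a) x) <= Cl * (1 + enorm x + enorm a)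
}.

Record assumption_A2 (Cf Cl : R)
    (f : state -> control -> state) (l : state -> control -> R) : Prop := {
  A2_D2f : forall x a,
    \sum_(i < d) enorm ('J ('D_('e_i) (f^~ a)) x) <= Cf / (1 + enorm x);
  A2_l_lip : forall x1 a1 x2 a2,
    `|l x1 a1 - l x2 a2| <=
      Cl * (1 + Num.max (enorm x1) (enorm x2) + Num.max (enorm a1) (enorm a2))
         * (enorm (x1 - x2) + enorm (a1 - a2));
  A2_D2xal : forall x a, enorm ('J (fun y => grad (l y) a) x) <= Cl;
  A2_D2axl : forall x a, enorm ('J (fun b => grad (l^~ b) x) a) <= Cl;
  A2_D2xxl : forall x a, enorm (hess (l^~ a) x) <= Cl
}.

(* [a] is a maximizer; it is unique under [assumption_A1], by strict
   concavity. *)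
Definition is_argmax (H : control -> R) (a : control) : Prop :=
  forall b, H b <= H a.

(* [mu] is a classical solution of the transport equations driven by the
   previous gradient [lam] and the policy [a], with initial value [mu0]. In
   the partial derivatives of f and l the control is frozen at a(x, t). *)
Record transport_solution
    (f : state -> control -> state) (l : state -> control -> R) (T : R)
    (mu0 : state -> state) (lam : state -> R -> state)
    (a : state -> R -> control) (mu : state -> R -> state) : Prop := {
  transport_continuous :
    {within [set z : state * R | 0 <= z.2 <= T],
      continuous (fun z => mu z.1 z.2)};
  transport_C1 :
    C1_on [set z : state * R | 0 < z.2 < T] (fun z => mu z.1 z.2);
  transport_eq : forall x t, 0 < t < T -> forall i : 'I_d,
    derive1 (fun s => mu x s 0 i) t =
      \sum_(j < d) f x (a x t) 0 j * 'D_('e_j) (fun y => mu y t 0 i) x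
    + \sum_(j < d) 'D_('e_i) (fun y => f y (a x t) 0 j) x * lam x t 0 j
    + 'D_('e_i) (l^~ (a x t)) x;
  transport_init : forall x, mu x 0 = mu0 x
}.

Record policy_iterates
    (u0 : state -> R) (f : state -> control -> state)
    (l : state -> control -> R) (T : R)
    (lam : nat -> state -> R -> state) (a : nat -> state -> R -> control)
    : Prop := {
  iterates_init : forall x t, 0 <= t <= T -> lam 0%N x t = grad u0 x;
  iterates_policy : forall k x t, 0 <= t <= T ->
    is_argmax (fun b => - dotv (lam k x t) (f x b) - l x b) (a k x t);
  iterates_value : forall k,
    transport_solution f l T (grad u0) (lam k) (a k) (lam k.+1)
}.

Local Open Scope ereal_scope.

Definition err (alpha gamma T : R) (lam : nat -> state -> R -> state)
    (k : nat) : \bar R :=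
  \int[@lebesgue_measure R]_(t in `[0%R, T])
    ((expR (- gamma * t))%:E *
     \int[lebesgue_measure_n d]_z
       (let x := rV_of_tuple z in
        (enorm (lam k x t - lam k.-1 x t) ^+ 2
           / ((1 + enorm x ^+ 2) `^ (2 * alpha)))%R%:E)).

End policy_iteration.

(* Main.v *)
(* Along the characteristic direction (-f(x, a), 1) each iterate has a derivative
   that depends only on the previous iterate. A maximum principle, localized by
   (1 + |x|^2) e^{Ct} because the drift has linear growth, is applied to
   |lambda(x, t)|^2 - N(t) (1 + |x|^2) and, after doubling the variables, to
   |lambda(x, t) - lambda(y, t)|^2 - K(t) |x - y|^2: for T small this propagates
   linear growth and Lipschitz bounds that are uniform in k. Strong convexity
   makes the policy a Lipschitz function of (x, lambda), so the drift is Lipschitz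
   in x and the difference delta of two consecutive iterates satisfies
   |D delta| <= H |delta'| along characteristics, delta' being the preceding
   difference. Hence E(t) = int |delta|^2 w, for a compactly supported weight w
   that grows at a bounded rate along characteristics, satisfies
   E' <= k E + H^2 E_{delta'}, where the space derivatives are removed by
   translation invariance of Lebesgue measure. Integrating against
   e^{-gamma t} with gamma >= k + 2 H^2 + 1 gives the factor 1/2 for truncated
   weights, and monotone convergence removes the truncation. *)

Require Import Defs.
From mathcomp Require Import all_boot all_order all_algebra.
From mathcomp Require Import all_classical all_reals all_analysis.
From mathcomp Require Import measurable_realfun.
From mathcomp Require Import ring lra.
Set Implicit Arguments.
Unset Strict Implicit.
Unset Printing Implicit Defensive.
Import Order.TTheory GRing.Theory Num.Theory.
Import numFieldNormedType.Exports.
Local Open Scope classical_set_scope.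
Local Open Scope ring_scope.


(** * Euclidean norms *)

(** No characteristic curve is constructed. The iterates are only C^1 inside the strip and
    continuous on its closure, with no growth condition at infinity; so each estimate uses the
    derivative in the direction [(- f x a, 1)] at single points, localized to a set that this
    direction can leave only forwards in time. Two products threaten uniformity in k. The source
    contains D_x f times lambda, and lambda grows linearly: its Lipschitz bound survives because
    (A2) makes the second derivatives of f decay like 1/(1 + |x|) and because, f being affine in the
    control, D_x f is independent of the control. The equation of an increment contains the drift
    difference times the space derivative of the older iterate, whence the need for one Lipschitz
    bound valid for all iterates. The constants come in the order M = 2 C0, then P and H from M,
    then [T0] and [gamma0]; none depends on k or on the functions. In general the weight does not
    make a linearly growing increment square integrable, so e_1 may be infinite and the contraction
    is an inequality between extended reals. *)

Section euclidean_norm.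
Context {R : realType}.

Lemma enorm_ge0 m n (A : 'M[R]_(m, n)) : 0 <= enorm A.
Proof. exact: sqrtr_ge0. Qed.

Lemma sqr_enorm m n (A : 'M[R]_(m, n)) :
  enorm A ^+ 2 = \sum_(i < m) \sum_(j < n) A i j ^+ 2.
Proof.
rewrite sqr_sqrtr//; apply: sumr_ge0 => i _; apply: sumr_ge0 => j _.
exact: sqr_ge0.
Qed.

Lemma sqr_enorm_row n (u : 'rV[R]_n) : enorm u ^+ 2 = \sum_(j < n) u 0 j ^+ 2.
Proof. by rewrite sqr_enorm big_ord1. Qed.

Lemma dotvE n (u : 'rV[R]_n) : dotv u u = enorm u ^+ 2.
Proof. by rewrite sqr_enorm_row. Qed.

Lemma dotvC n (u v : 'rV[R]_n) : dotv u v = dotv v u.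
Proof. by apply: eq_bigr => j _; rewrite mulrC. Qed.

Lemma dotvDl n (u v w : 'rV[R]_n) : dotv (u + v) w = dotv u w + dotv v w.
Proof. by rewrite -big_split; apply: eq_bigr => j _; rewrite mxE mulrDl. Qed.

Lemma dotvZl n c (u v : 'rV[R]_n) : dotv (c *: u) v = c * dotv u v.
Proof. by rewrite mulr_sumr; apply: eq_bigr => j _; rewrite mxE mulrA. Qed.

Lemma dotvNl n (u v : 'rV[R]_n) : dotv (- u) v = - dotv u v.
Proof. by rewrite -scaleN1r dotvZl mulN1r. Qed.

Lemma dotvBl n (u v w : 'rV[R]_n) : dotv (u - v) w = dotv u w - dotv v w.
Proof. by rewrite dotvDl dotvNl. Qed.

Lemma dotvDr n (u v w : 'rV[R]_n) : dotv w (u + v) = dotv w u + dotv w v.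
Proof. by rewrite dotvC dotvDl !(dotvC w). Qed.

Lemma dotvZr n c (u v : 'rV[R]_n) : dotv v (c *: u) = c * dotv v u.
Proof. by rewrite dotvC dotvZl dotvC. Qed.

Lemma dotvNr n (u v : 'rV[R]_n) : dotv v (- u) = - dotv v u.
Proof. by rewrite dotvC dotvNl dotvC. Qed.

Lemma dotvBr n (u v w : 'rV[R]_n) : dotv w (u - v) = dotv w u - dotv w v.
Proof. by rewrite dotvDr dotvNr. Qed.

Lemma dotv0l n (u : 'rV[R]_n) : dotv 0 u = 0.
Proof. by rewrite -(scale0r 0) dotvZl mul0r. Qed.

Lemma dotv_delta n (u : 'rV[R]_n) j : dotv u 'e_j = u 0 j.
Proof.
rewrite /dotv (bigD1 j)//= mxE !eqxx mulr1 big1 ?addr0// => k kj.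
by rewrite mxE eqxx (negbTE kj) mulr0.
Qed.

Lemma ler_sqr_enorm m n (A : 'M[R]_(m, n)) c :
  0 <= c -> (enorm A <= c) = (enorm A ^+ 2 <= c ^+ 2).
Proof. by move=> c0; rewrite ler_sqr// nnegrE// enorm_ge0. Qed.

(** Cauchy-Schwarz from [0 <= |s u + t v|^2] at [(s, t) = (- |v|, |u|)]. When a norm vanishes this
    choice is void; a multiplier that makes the cross term [- (|v|^2 + 1)], or [- (|u|^2 + 1)], then
    excludes [0 < dotv u v]. *)
Lemma dotv_le n (u v : 'rV[R]_n) : dotv u v <= enorm u * enorm v.
Proof.
have h (s t : R) : 0 <= s ^+ 2 * enorm u ^+ 2 + 2 * s * t * dotv u v
    + t ^+ 2 * enorm v ^+ 2.
  rewrite -!dotvE; have := sqr_ge0 (enorm (s *: u + t *: v)).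
  rewrite -dotvE dotvDl !dotvDr !dotvZl !dotvZr (dotvC v u); lra.
have u0 := enorm_ge0 u; have v0 := enorm_ge0 v.
have [uE|un] := eqVneq (enorm u) 0.
  rewrite uE mul0r leNgt; apply/negP => d0.
  have := h (- (enorm v ^+ 2 + 1) / (2 * dotv u v)) 1; rewrite uE expr0n/=.
  have -> : 2 * (- (enorm v ^+ 2 + 1) / (2 * dotv u v)) * 1 * dotv u v
      = - (enorm v ^+ 2 + 1) by field; rewrite gt_eqF.
  lra.
have {un}u0' : 0 < enorm u by rewrite lt_def un.
have := h (- enorm v) (enorm u).
have -> : (- enorm v) ^+ 2 * enorm u ^+ 2 + 2 * - enorm v * enorm u * dotv u v +
  enorm u ^+ 2 * enorm v ^+ 2
   = 2 * enorm u * (enorm v * (enorm u * enorm v - dotv u v)) by ring.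
rewrite pmulr_rge0 ?mulr_gt0//.
have [vE _|vn] := eqVneq (enorm v) 0; last first.
  by rewrite pmulr_rge0 ?lt_def ?vn// subr_ge0.
rewrite vE mulr0 leNgt; apply/negP => d0.
have := h 1 (- (enorm u ^+ 2 + 1) / (2 * dotv u v)); rewrite vE expr0n/=.
have -> : 2 * 1 * (- (enorm u ^+ 2 + 1) / (2 * dotv u v)) * dotv u v
    = - (enorm u ^+ 2 + 1) by field; rewrite gt_eqF.
lra.
Qed.

(** Identifies the Frobenius norm with a Euclidean row norm, so that the triangle inequality for
    matrices reduces to Cauchy-Schwarz for rows. *)
Lemma enorm_mxvec m n (A : 'M[R]_(m, n)) : enorm (mxvec A) = enorm A.
Proof.
congr Num.sqrt; rewrite big_ord1 pair_bigA/=.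
rewrite (reindex _ (curry_mxvec_bij _ _))/=.
by apply: eq_bigr => -[i j] _/=; rewrite mxvecE.
Qed.

Lemma enorm0 m n : enorm (0 : 'M[R]_(m, n)) = 0.
Proof.
rewrite /enorm big1 ?sqrtr0// => i _; rewrite big1// => j _.
by rewrite mxE expr0n.
Qed.

Lemma enormZ m n c (A : 'M[R]_(m, n)) : enorm (c *: A) = `|c| * enorm A.
Proof.
apply: (@pexpIrn _ 2); rewrite ?nnegrE ?enorm_ge0 ?mulr_ge0 ?enorm_ge0//.
rewrite exprMn !sqr_enorm mulr_sumr; apply: eq_bigr => i _.
rewrite mulr_sumr; apply: eq_bigr => j _.
by rewrite mxE exprMn real_normK// num_real.
Qed.

Lemma enormN m n (A : 'M[R]_(m, n)) : enorm (- A) = enorm A.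
Proof. by rewrite -scaleN1r enormZ normrN1 mul1r. Qed.

Lemma enorm_sym m n (A B : 'M[R]_(m, n)) : enorm (A - B) = enorm (B - A).
Proof. by rewrite -enormN opprB. Qed.

Lemma ler_enormD m n (A B : 'M[R]_(m, n)) :
  enorm (A + B) <= enorm A + enorm B.
Proof.
rewrite -!(enorm_mxvec (_ + _)) -(enorm_mxvec A) -(enorm_mxvec B) linearD/=.
set u := mxvec A; set v := mxvec B.
rewrite ler_sqr_enorm ?addr_ge0 ?enorm_ge0//.
rewrite -dotvE dotvDl !dotvDr (dotvC v u) !dotvE.
have := dotv_le u v; lra.
Qed.

Lemma ler_enormB m n (A B : 'M[R]_(m, n)) :
  enorm (A - B) <= enorm A + enorm B.
Proof. by rewrite (le_trans (ler_enormD _ _))// enormN. Qed.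

Lemma ler_enorm_distD m n (C A B : 'M[R]_(m, n)) :
  enorm (A - B) <= enorm (A - C) + enorm (C - B).
Proof. by rewrite -{1}(subrK C A) -addrA ler_enormD. Qed.

Lemma ler_enorm_sum m n I (r : seq I) (F : I -> 'M[R]_(m, n)) :
  enorm (\sum_(i <- r) F i) <= \sum_(i <- r) enorm (F i).
Proof.
elim/big_rec2: _ => [|i y1 y2 _ ih]; first by rewrite enorm0.
by rewrite (le_trans (ler_enormD _ _))// lerD2l.
Qed.

Lemma normr_dotv n (u v : 'rV[R]_n) : `|dotv u v| <= enorm u * enorm v.
Proof.
by rewrite ler_norml dotv_le andbT lerNl -dotvNl (le_trans (dotv_le _ _))// enormN.
Qed.

Lemma enorm_tr m n (A : 'M[R]_(m, n)) : enorm A^T = enorm A.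
Proof.
congr Num.sqrt; rewrite exchange_big/=.
by apply: eq_bigr => i _; apply: eq_bigr => j _; rewrite mxE.
Qed.

Lemma ler_enorm_mulmx n p (u : 'rV[R]_n) (A : 'M[R]_(n, p)) :
  enorm (u *m A) <= enorm u * enorm A.
Proof.
rewrite ler_sqr_enorm ?mulr_ge0 ?enorm_ge0// exprMn.
rewrite sqr_enorm_row -(enorm_tr A) (sqr_enorm A^T) mulr_sumr.
apply: ler_sum => j _.
have -> : (u *m A) 0 j = dotv u (row j A^T).
  by rewrite mxE; apply: eq_bigr => k _; rewrite !mxE.
have -> : \sum_(k < n) A^T j k ^+ 2 = enorm (row j A^T) ^+ 2.
  by rewrite sqr_enorm_row; apply: eq_bigr => k _; rewrite [in RHS]mxE.
rewrite -exprMn -real_normK ?num_real// ler_sqr ?nnegrE ?mulr_ge0 ?enorm_ge0//.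
exact: normr_dotv.
Qed.

Lemma normr_coord m n (A : 'M[R]_(m, n)) i j : `|A i j| <= enorm A.
Proof.
rewrite -ler_sqr ?nnegrE ?enorm_ge0// sqr_enorm real_normK ?num_real//.
rewrite (bigD1 i)//= (bigD1 j)//= -addrA lerDl addr_ge0//.
  by apply: sumr_ge0 => ? _; exact: sqr_ge0.
by apply: sumr_ge0 => ? _; apply: sumr_ge0 => ? _; exact: sqr_ge0.
Qed.

(** The matrix is the sum of the matrices that keep a single row. (A2) controls the Jacobian of [f]
    row by row, which is where this serves. *)
Lemma ler_enorm_rows m n (A : 'M[R]_(m, n)) :
  enorm A <= \sum_(i < m) enorm (row i A).
Proof.
have -> : enorm A = enorm (\sum_(i < m) delta_mx i 0 *m row i A : 'M[R]_(m, n)).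
  congr enorm; apply/matrixP => i j; rewrite summxE (bigD1 i)//= big1.
    by rewrite addr0 mxE big_ord1 !mxE !eqxx mul1r.
  move=> k ki; rewrite mxE big_ord1 !mxE eqxx andbT.
  by rewrite eq_sym (negbTE ki) mul0r.
rewrite (le_trans (ler_enorm_sum _ _))//; apply: ler_sum => i _.
rewrite ler_sqr_enorm ?enorm_ge0// sqr_enorm (bigD1 i)//= [X in _ + X]big1.
  rewrite addr0 sqr_enorm_row; apply: ler_sum => j _.
  by rewrite mxE big_ord1 !mxE !eqxx mul1r.
move=> k ki; rewrite big1// => j _.
by rewrite mxE big_ord1 mxE (negbTE ki) mul0r expr0n.
Qed.

Lemma enorm_delta n (j : 'I_n) : enorm ('e_j : 'rV[R]_n) = 1.
Proof.
by apply: (@pexpIrn _ 2); rewrite ?nnegrE ?enorm_ge0// -dotvE dotv_delta mxE !eqxx expr1n.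
Qed.

Lemma normr_le_enorm n (u : 'rV[R]_n) : `|u| <= enorm u.
Proof.
rewrite [leLHS]/Num.Def.normr/= mx_normrE (bigmax_le _ (enorm_ge0 _))//.
by move=> i _; exact: normr_coord.
Qed.

Lemma continuous_enorm n : continuous (@enorm R 1 n).
Proof.
move=> u; rewrite /enorm; apply: continuous_comp; last exact: sqrt_continuous.
apply: continuous_big; first exact: add_continuous.
move=> i _; apply: continuous_big; first exact: add_continuous.
move=> j _ x; under eq_fun do rewrite expr2.
by apply: continuousM; exact: coord_continuous.
Qed.

Lemma continuous_sqr_enorm n : continuous (fun u : 'rV[R]_n => enorm u ^+ 2).
Proof.
move=> u; under eq_fun do rewrite expr2.
by apply: continuousM; exact: continuous_enorm.
Qed.

Lemma compact_enorm_le n r : compact [set u : 'rV[R]_n | enorm u <= r].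
Proof.
apply: bounded_closed_compact.
  exists r; split; first exact: num_real.
  by move=> s rs u /= ur; rewrite (le_trans (normr_le_enorm _))// (le_trans ur)// ltW.
have -> : [set u : 'rV[R]_n | enorm u <= r] = @enorm R 1 n @^-1` [set x | x <= r].
  by [].
by apply: closed_comp => [u _|]; [exact: continuous_enorm|exact: closed_le].
Qed.

End euclidean_norm.


(** * Directional derivatives *)

Section directional_derivatives.
Context {R : realType}.
Implicit Types V W Z : normedModType R.

(** Bridge to one real variable: the mean value theorem and one-sided difference quotients apply to
    the restriction of a function to a line. *)
Lemma is_derive_curve V W (F : V -> W) z w dF (s : R) :
  is_derive (s *: w + z) w F dF ->
  is_derive s (1 : R) (fun h : R => F (h *: w + z)) dF.
Proof.
have E : (fun h : R => h^-1 *: (F (h *: w + (s *: w + z)) - F (s *: w + z)))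
    = (fun h : R => h^-1 *: (((fun h : R => F (h *: w + z)) \o shift s) (h *: 1)
       - F (s *: w + z))).
  by apply/funext => h/=; rewrite [h *: 1]mulr1 scalerDl addrA.
by move=> [H1 H2]; split; [move: H1|move: H2]; rewrite /derivable /derive/= E.
Qed.

Lemma is_derive_curve0 V W (F : V -> W) z w dF :
  is_derive (0 : R) (1 : R) (fun h : R => F (h *: w + z)) dF ->
  is_derive z w F dF.
Proof.
have E : (fun h : R => h^-1 *: (F (h *: w + z) - F z))
    = (fun h : R => h^-1 *: (((fun h : R => F (h *: w + z)) \o shift 0) (h *: 1)
       - F (0 *: w + z))).
  by apply/funext => h/=; rewrite [h *: 1]mulr1 addr0 scale0r add0r.
by move=> [H1 H2]; split; [move: H1|move: H2]; rewrite /derivable /derive/= E.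
Qed.

(** A chain rule that asks nothing of [F] beyond the one direction [w']: the inner map only has to
    send the line through [z] along [w] to the line through [p z] along [w']. It carries derivatives
    between space, space-time and doubled variables. *)
Lemma is_derive_comp_affine V W Z (F : V -> W) (p : Z -> V) z w w' dF :
  (forall h : R, p (h *: w + z) = h *: w' + p z) ->
  is_derive (p z) w' F dF -> is_derive z w (F \o p) dF.
Proof.
move=> pE FD; apply: is_derive_curve0.
rewrite (_ : (fun h => _) = (fun h : R => F (h *: w' + p z))).
  by apply: is_derive_curve; rewrite scale0r add0r.
by apply/funext => h/=; rewrite pE.
Qed.

Lemma is_derive_coord V n (F : V -> 'rV[R]_n) z v dF j :
  is_derive z v F dF -> is_derive z v (fun x => F x 0 j) (dF 0 j).
Proof.
move=> [H1 H2]; split; first exact: (proj1 (derivable_mxP _ _ _) H1).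
by rewrite -H2 derive_mx// mxE.
Qed.

Lemma is_derive_row V n (F : V -> 'rV[R]_n) z v (dF : 'rV_n) :
  (forall j, is_derive z v (fun x => F x 0 j) (dF 0 j)) -> is_derive z v F dF.
Proof.
move=> H; have H1 : derivable F z v.
  by apply/derivable_mxP => i j; rewrite ord1; apply: ex_derive.
split=> //; rewrite derive_mx//; apply/rowP => j; rewrite mxE.
by apply: derive_val.
Qed.

Lemma is_derive_dotv V n (F G : V -> 'rV[R]_n) z v dF dG :
  is_derive z v F dF -> is_derive z v G dG ->
  is_derive z v (fun x => dotv (F x) (G x)) (dotv (F z) dG + dotv (G z) dF).
Proof.
move=> HF HG; rewrite /dotv.
have -> : (fun x => \sum_(j < n) F x 0 j * G x 0 j) =
    \sum_(j < n) ((fun x => F x 0 j) * (fun x => G x 0 j)).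
  by apply/funext => x; rewrite fct_sumE.
rewrite -big_split/=; apply: is_derive_sum => j.
by apply: is_deriveM; exact: is_derive_coord.
Qed.

Lemma is_derive_dotvl V n (F : V -> 'rV[R]_n) u z v dF :
  is_derive z v F dF -> is_derive z v (fun x => dotv (F x) u) (dotv dF u).
Proof.
move=> HF; apply: (@is_derive_eq _ _ _ _ _ _ _ (dotv (F z) 0 + dotv u dF)).
  by apply: (is_derive_dotv HF); exact: is_derive_cst.
by rewrite dotvC dotv0l add0r dotvC.
Qed.

Lemma is_derive_sqr_enorm V n (F : V -> 'rV[R]_n) z v dF :
  is_derive z v F dF ->
  is_derive z v (fun x => enorm (F x) ^+ 2) (2 * dotv (F z) dF).
Proof.
move=> HF; under eq_fun do rewrite -dotvE.
by apply: is_derive_eq; [exact: is_derive_dotv|ring].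
Qed.

Lemma is_derive_continuous1 W (F : R -> W) (s : R) dF :
  is_derive s 1 F dF -> {for s, continuous F}.
Proof.
by move=> [H _]; apply: differentiable_continuous; exact/derivable1_diffP.
Qed.

(* The mean value theorem applied to [s |-> (F (y + s (x - y)) - F y) . (F x - F y)]. *)
Lemma enorm_segment_le V n (F : V -> 'rV[R]_n) x y (DF : V -> 'rV[R]_n) c :
  (forall s : R, 0 <= s <= 1 -> let z := s *: (x - y) + y in
    is_derive z (x - y) F (DF z) /\ enorm (DF z) <= c) ->
  enorm (F x - F y) <= c.
Proof.
move=> H.
pose e := F x - F y.
pose q s := dotv (F (s *: (x - y) + y)) e.
have qD (s : R) : 0 <= s <= 1 -> is_derive (s : R) (1 : R) q (dotv (DF (s *: (x - y) + y)) e).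
  move=> s01; have [H1 _] := H _ s01.
  by apply: is_derive_dotvl; exact: (is_derive_curve H1).
have [s s01] : exists2 s : R, s \in `]0, 1[%R & q 1 - q 0 = dotv (DF (s *: (x - y) + y)) e * (1 - 0).
  apply: MVT => //.
    by move=> s; rewrite in_itv/= => /andP[s0 s1]; apply: qD; rewrite !ltW.
  apply: continuous_in_subspaceT => s; rewrite inE/= in_itv/= => s01.
  exact: (is_derive_continuous1 (qD _ s01)).
rewrite /q scale1r subrK scale0r add0r -dotvBl dotvE subr0 mulr1 => E.
have {}s01 : 0 <= s <= 1 by move: s01; rewrite in_itv/= => /andP[? ?]; rewrite !ltW.
have [_ Hc] := H _ s01.
have [e0|e0] := eqVneq (enorm e) 0.
  by rewrite -/e e0 (le_trans (enorm_ge0 _) Hc).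
have {}e0 : 0 < enorm e by rewrite lt_def e0 enorm_ge0.
rewrite -(ler_pM2r e0) -expr2 E (le_trans (dotv_le _ _))//.
by rewrite ler_wpM2r// enorm_ge0.
Qed.

(** The left quotients have numerator [<= 0] and denominator [< 0]. Comparing with earlier points
    only also suits a maximum reached at the last time considered. *)
Lemma is_derive_left_ge0 (f : R -> R) (a df : R) : is_derive a (1 : R) f df ->
  (\forall h \near (0:R)^'-, f (h + a) <= f a) -> 0 <= df.
Proof.
move=> [H1 <-] Hle.
have H : (fun h : R => h^-1 *: (f (h *: 1 + a) - f a)) @ 0^'- --> 'D_1 f a.
  exact: cvg_dnbhs_at_left.
rewrite leNgt; apply/negP => D0.
have Hlt : \forall h \near (0 : R)^'-, h^-1 *: (f (h *: 1 + a) - f a) < 0.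
  exact: (cvgr_lt _ H _ D0).
have [h [/= Hh [fh h0]]] := filter_ex (filterI Hlt (filterI Hle (nbhs_left_lt 0))).
move: Hh; rewrite [h *: 1]mulr1 ltNge => /negP; apply.
by apply: mulr_le0; rewrite ?invr_le0 ?subr_le0// ltW.
Qed.

(** The previous lemma applied to [h |-> - F (h v + z) . dF + c |dF| h], whose derivative at 0 is
    [- |dF|^2 + c |dF|]. *)
Lemma enorm_derive_le V n (F : V -> 'rV[R]_n) z v dF c :
  is_derive z v F dF ->
  (forall h : R, h < 0 -> enorm (F (h *: v + z) - F z) <= c * `|h|) ->
  enorm dF <= c.
Proof.
move=> HF H.
have c0 : 0 <= c.
  by have := H (-1) (ltrN10 _); rewrite normrN1 mulr1; apply: le_trans; exact: enorm_ge0.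
have [e0|e0] := eqVneq (enorm dF) 0; first by rewrite e0.
have {}e0 : 0 < enorm dF by rewrite lt_def e0 enorm_ge0.
have dq : is_derive (0 : R) (1 : R)
    (fun h : R => dotv (F (h *: v + z)) (- dF)) (- enorm dF ^+ 2).
  rewrite -dotvE -dotvNr; apply: is_derive_dotvl; apply: is_derive_curve.
  by rewrite scale0r add0r.
have dc : is_derive (0 : R) (1 : R)
    ((fun h : R => dotv (F (h *: v + z)) (- dF)) + (c * enorm dF) *: id)
    (- enorm dF ^+ 2 + (c * enorm dF) *: 1).
  exact: is_deriveD.
suff : 0 <= - enorm dF ^+ 2 + (c * enorm dF) *: (1 : R).
  by rewrite [_ *: _]mulr1 addrC subr_ge0 expr2 ler_pM2r.
apply: (is_derive_left_ge0 dc); near=> h.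
have h0 : h < 0 by near: h; exact: nbhs_left_lt.
rewrite !fctE addr0 scale0r add0r scaler0 addr0.
rewrite -lerBrDl -dotvBl [_ *: _]mulrC.
rewrite -opprB dotvNl dotvNr opprK.
have /ler_normlP[+ _] := normr_dotv (F (h *: v + z) - F z) dF.
have := ler_wpM2r (ltW e0) (H _ h0); rewrite ltr0_norm//; lra.
Unshelve. all: by end_near. Qed.

Lemma is_derive_comp1 V (f : R -> R) (g : V -> R) z v (a b : R) :
  is_derive (g z) (1 : R) f a -> is_derive z v g b ->
  is_derive z v (f \o g) (a * b).
Proof.
move=> fa gb; apply: is_derive_curve0.
rewrite (_ : (fun h => _) = f \o (fun h : R => g (h *: v + z)))//.
apply: is_derive1_comp; first by rewrite scale0r add0r.
by apply: is_derive_curve; rewrite scale0r add0r.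
Qed.

Lemma is_derive_time V (z : V * R) w : is_derive z (w, 1 : R) snd (1 : R).
Proof.
apply: (@is_derive_comp_affine R R (V * R)%type id snd z (w, 1) 1 1) => //.
Qed.

Lemma is_derive_space V W (q : V -> W) (z : V * R) w (s : R) dq :
  is_derive z.1 w q dq -> is_derive z (w, s) (fun z => q z.1) dq.
Proof.
move=> H; apply: (@is_derive_comp_affine V W (V * R)%type q fst z (w, s) w dq) => //.
Qed.

End directional_derivatives.


(** * Continuity on the closed strip and clamping of time *)

Lemma continuous_comp_within (S U W : topologicalType) (A : set U) (F : U -> W)
    (h : S -> U) :
  {within A, continuous F} -> continuous h -> (forall x, A (h x)) ->
  continuous (F \o h).
Proof.
move=> /subspace_continuousP HF hc hA x P /= HP.
have := hc x _ (HF _ (hA x) P HP).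
by rewrite /nbhs/=; apply: filterS => y; apply; exact: hA.
Qed.

Lemma continuous_within_comp (S U W : topologicalType) (A : set S) (F : S -> U)
    (h : U -> W) :
  {within A, continuous F} -> continuous h -> {within A, continuous (h \o F)}.
Proof.
move=> HF hc x; apply: (@continuous_comp (subspace A) U W F h x); first exact: HF.
exact: hc.
Qed.

(* Composing with [clamp T] extends a function on the closed strip [0 <= t <= T]
   to all times and keeps it continuous. *)
Definition clamp {R : realType} (T t : R) : R := Num.min (Num.max t 0) T.

Section clamp.
Context {R : realType} (T : R).
Hypothesis T_ge0 : 0 <= T.

Lemma clamp_itv t : 0 <= clamp T t <= T.
Proof. by rewrite le_min T_ge0 andbT le_max lexx orbT ge_min lexx orbT. Qed.

Lemma clamp_id t : 0 <= t <= T -> clamp T t = t.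
Proof. by move=> /andP[t0 tT]; rewrite /clamp (max_idPl t0) (min_idPl tT). Qed.

Lemma continuous_clamp : continuous (clamp T).
Proof.
move=> t; apply: (@continuous_min _ R (fun t => Num.max t 0) (cst T)).
  by apply: (@continuous_max _ R id (cst 0)) => //; exact: cvg_cst.
exact: cvg_cst.
Qed.

Lemma continuous_within_clamp (Z : normedModType R) (W : topologicalType) (F : Z * R -> W) :
  {within [set z | 0 <= z.2 <= T], continuous F} ->
  continuous (fun z => F (z.1, clamp T z.2)).
Proof.
move=> HF; apply: (continuous_comp_within HF).
  move=> z; have h1 : y.1 @[y --> z] --> z.1 by exact: cvg_fst.
  have h2 : clamp T y.2 @[y --> z] --> clamp T z.2.
    by apply: continuous_comp; [exact: cvg_snd|exact: continuous_clamp].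
  exact: (cvg_pair h1 h2).
by move=> z /=; exact: clamp_itv.
Qed.

End clamp.

(** * Maximum principle for transport inequalities *)

Section maximum_principle.
Context {R : realType} (Z : normedModType R).
Variables (q : Z -> R) (G : Z * R -> R) (T C c : R).
Hypothesis q_cont : continuous q.
Hypothesis q_proper : forall r, compact [set z | q z <= r].
Hypothesis q_ge0 : forall z, 0 <= q z.
Hypothesis C_ge0 : 0 <= C.
Hypothesis G_cont : {within [set z : Z * R | 0 <= z.2 <= T], continuous G}.
Hypothesis G_init : forall z, G (z, 0) <= 0.
Hypothesis G_transport : forall z t, 0 < t < T -> 0 < G (z, t) ->
  exists w dq dG, [/\ is_derive z w q dq, - (C * q z) <= dq,
    is_derive (z, t) (w, 1 : R) G dG & dG <= c * G (z, t)].

(* At a positive maximum of [e^{-(c+1)t} G (r - e^{Ct} q)] on the compact set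
   where the last factor is nonnegative, the derivative along the
   characteristic direction would be both >= 0 and < 0. *)
Let max_principle_lt z t : 0 <= t < T -> G (z, t) <= 0.
Proof.
move=> /andP[t0 tT]; rewrite leNgt; apply/negP => G0.
pose psi (x : Z * R) := q x.1 * expR (C * x.2).
(* The added 1 makes the localizing factor equal to 1 at [(z, t)], so the maximum of [Th] is
   positive. *)
pose r := psi (z, t) + 1.
pose E (x : Z * R) := expR (- (c + 1) * x.2).
pose Th x := E x * (G x * (r - psi x)).
have psi_cont : continuous psi.
  move=> x; apply: cvgM.
    by apply: continuous_comp; [exact: cvg_fst|exact: q_cont].
  apply: continuous_comp; last exact: continuous_expR.
  by apply: cvgM; [exact: cvg_cst|exact: cvg_snd].
have E_cont : continuous E.
  move=> x; apply: continuous_comp; last exact: continuous_expR.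
  by apply: cvgM; [exact: cvg_cst|exact: cvg_snd].
pose K := [set x : Z * R | psi x <= r /\ 0 <= x.2 <= t].
have cK : compact K.
  apply: (@subclosed_compact _ _ ([set z | q z <= r] `*` `[0, t])).
  - have -> : K = psi @^-1` [set x | x <= r] `&` snd @^-1` `[0, t].
      by rewrite eqEsubset; split => x /=; rewrite in_itv/=.
    apply: closedI; apply: closed_comp.
    + by move=> x _; exact: psi_cont.
    + exact: closed_le.
    + by move=> x _; exact: cvg_snd.
    + exact: itv_closed.
  - by apply: compact_setX; [exact: q_proper|exact: segment_compact].
  - move=> x [h1 /andP[h2 h3]]; split => /=; last by rewrite in_itv/= h2.
    rewrite (le_trans _ h1)// /psi ler_peMr// -expR0 ler_expR mulr_ge0//.
have Kzt : K (z, t) by split; [rewrite lerDl|rewrite /= t0 lexx].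
have Th_cont : {within K, continuous Th}.
  move=> x; apply: cvgM; first exact: (continuous_subspaceT E_cont).
  apply: cvgM.
    apply: (continuous_subspaceW _ G_cont) => y [_ /andP[h1 h2]] /=.
    by rewrite h1 (le_trans h2)// ltW.
  apply: cvgB; first exact: cvg_cst.
  exact: (continuous_subspaceT psi_cont).
have [[x s]] := compact_EVT_max (ex_intro _ _ Kzt) cK Th_cont.
rewrite inE => -[/= psix /andP[s0 st]] xmax.
have Th0 : 0 < Th (x, s).
  apply: (lt_le_trans _ (xmax (z, t) _)); last by rewrite inE.
  by rewrite !mulr_gt0// ?expR_gt0// /r addrAC subrr add0r.
have Px0 : 0 < r - psi (x, s).
  rewrite lt_def subr_ge0 psix andbT; apply/eqP => P0.
  by move: Th0; rewrite /Th P0 !mulr0 ltxx.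
have Gx0 : 0 < G (x, s).
  by move: Th0; rewrite /Th pmulr_rgt0 ?expR_gt0// pmulr_lgt0.
have {}s0 : 0 < s.
  rewrite lt_def s0 andbT; apply/eqP => s0'.
  by move: Gx0; rewrite s0' ltNge G_init.
have [|w [dq [dG [Hq dqle HG dGle]]]] := @G_transport x s _ Gx0.
  by rewrite s0 (le_lt_trans st).
have Hlin k : is_derive (x, s) (w, 1 : R) (fun y : Z * R => k * y.2) k.
  have Hk : is_derive (x, s) (w, 1 : R) (k *: (snd : Z * R -> R)) (k *: (1 : R)).
    by apply: is_deriveZ; exact: is_derive_time.
  exact: (is_derive_eq Hk (mulr1 k)).
have HE : is_derive (x, s) (w, 1 : R) E (E (x, s) * - (c + 1)).
  by apply: (@is_derive_comp1 _ _ expR) => //; exact: is_derive_expR.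
have He : is_derive (x, s) (w, 1 : R) (fun y : Z * R => expR (C * y.2))
    (expR (C * s) * C).
  by apply: (@is_derive_comp1 _ _ expR) => //; exact: is_derive_expR.
have Hpsi : is_derive (x, s) (w, 1 : R) psi (expR (C * s) * (dq + C * q x)).
  have Hq' := @is_derive_space _ _ _ q (x, s) w 1 dq Hq.
  apply: (is_derive_eq (is_deriveM Hq' He)).
  by rewrite /= ![_ *: _]mulrC/=; ring.
have HTh : is_derive (x, s) (w, 1 : R) Th
   (E (x, s) * (- (c + 1) * G (x, s) * (r - psi (x, s)) + dG * (r - psi (x, s)) 
     - G (x, s) * (expR (C * s) * (dq + C * q x)))).
  have HP := is_deriveB (is_derive_cst r (x, s) (w, 1 : R)) Hpsi.
  apply: (is_derive_eq (is_deriveM HE (is_deriveM HG HP))).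
  rewrite !fctE ![_ *: _]mulrC/=; ring.
have : 0 <= (E (x, s) * (- (c + 1) * G (x, s) * (r - psi (x, s)) + dG * (r - psi (x, s)) 
     - G (x, s) * (expR (C * s) * (dq + C * q x)))).
  have HTh0 : is_derive (0 : R) (1 : R) (fun h : R => Th (h *: (w, 1 : R) + (x, s)))
      (E (x, s) * (- (c + 1) * G (x, s) * (r - psi (x, s)) + dG * (r - psi (x, s)) 
     - G (x, s) * (expR (C * s) * (dq + C * q x)))).
    by apply: is_derive_curve; rewrite scale0r add0r.
  have Hpsi0 : {for 0, continuous (fun h : R => psi (h *: (w, 1 : R) + (x, s)))}.
    apply: is_derive_continuous1; apply: is_derive_curve.
    by rewrite scale0r add0r; exact: Hpsi.
  (* [psi < r] holds strictly at the maximum point, so slightly earlier points of the line lie in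
     [K] and may be compared with it; later ones might leave [K], whence a left derivative. *)
  have psi_lt : \forall h \near (0 : R)^'-, psi (h *: (w, 1 : R) + (x, s)) < r.
    apply: (cvgr_lt _ (cvg_at_left_filter Hpsi0)).
    by rewrite scale0r add0r -subr_gt0.
  apply: (is_derive_left_ge0 HTh0); near=> h.
  have h0 : h < 0 by near: h; exact: nbhs_left_lt.
  have hs : - s < h by near: h; apply: nbhs_left_gt; rewrite oppr_lt0.
  rewrite addr0 scale0r add0r; apply: xmax; rewrite inE; split.
    by apply: ltW; near: h; exact: psi_lt.
  by rewrite /= [h *: _]mulr1; lra.
rewrite pmulr_rge0 ?expR_gt0//.
(* With [dG <= c * G] the first two terms add up to at most [- G (r - psi) < 0]; this strictness is
   what the 1 in the exponent [- (c + 1)] of [E] buys. The third term has the right sign since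
   [- (C * q) <= dq]. *)
have : 0 <= G (x, s) * (expR (C * s) * (dq + C * q x)).
  by rewrite !mulr_ge0 ?expR_ge0 ?(ltW Gx0)//; lra.
have := ler_wpM2r (ltW Px0) dGle.
have : 0 < G (x, s) * (r - psi (x, s)) by rewrite mulr_gt0.
lra.
Unshelve. all: by end_near. Qed.

(** The transport inequality is available only for times below [T], so the final time is reached by
    continuity: a positive value at [T] would persist slightly earlier. The direction [w] in
    [G_transport] may vary with the point without any regularity, as it is used at one maximum point
    only. *)
Lemma transport_max_principle z t : 0 < T -> 0 <= t <= T -> G (z, t) <= 0.
Proof.
move=> T0 /andP[t0]; rewrite le_eqVlt => /predU1P[->{t t0}|tT]; last first.
  by apply: max_principle_lt; rewrite t0.
rewrite leNgt; apply/negP => G0.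
pose g s := G (z, clamp T s).
have gc : {for T, continuous g}.
  apply: (@continuous_comp _ _ _ (fun s : R => (z, s)) (fun x => G (x.1, clamp T x.2))).
    have h1 : z @[s --> T] --> z by exact: cvg_cst.
    exact: (cvg_pair h1 (@cvg_id _ (nbhs T))).
  exact: (continuous_within_clamp (ltW T0) G_cont).
have Hg : \forall s \near T^'-, 0 < g s.
  apply: (cvgr_gt _ (cvg_at_left_filter gc)).
  by rewrite /g clamp_id// (ltW T0) lexx.
have : \forall s \near T^'-, False.
  near=> s.
  have sT : s < T by near: s; exact: nbhs_left_lt.
  have s0 : 0 < s by near: s; exact: nbhs_left_gt.
  have : 0 < g s by near: s; exact: Hg.
  rewrite /g clamp_id ?(ltW s0) ?(ltW sT)// ltNge => /negP; apply.
  by apply: max_principle_lt; rewrite (ltW s0).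
by move=> /filter_ex[].
Unshelve. all: by end_near. Qed.

End maximum_principle.


(** * Partial derivatives, gradients and Jacobians *)

Section row_calculus.
Context {R : realType}.

Lemma derive_affine (V W : normedModType R) (g1 g2 : V -> W) w :
  (forall y, g1 y = g2 y + w) -> forall x v, 'D_v g1 x = 'D_v g2 x.
Proof.
move=> gE x v; rewrite /derive (_ : (fun h => _) =
  (fun h => h^-1 *: ((g2 \o shift x) (h *: v) - g2 x)))//.
apply/funext => h /=; by rewrite !gE opprD addrACA subrr addr0.
Qed.

Lemma derive_partial1 (V W U : normedModType R) (F : V * W -> U) v x a :
  'D_v (fun y => F (y, a)) x = 'D_((v, 0) : V * W) F (x, a).
Proof.
rewrite /derive (_ : (fun h => _) =
  (fun h => h^-1 *: ((F \o shift (x, a)) (h *: (v, 0)) - F (x, a))))//.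
apply/funext => h /=; by congr (_ *: (F _ - _)); congr pair; rewrite /= scaler0 add0r.
Qed.

Lemma derive_partial2 (V W U : normedModType R) (F : V * W -> U) v x a :
  'D_v (fun b => F (x, b)) a = 'D_((0, v) : V * W) F (x, a).
Proof.
rewrite /derive (_ : (fun h => _) =
  (fun h => h^-1 *: ((F \o shift (x, a)) (h *: (0, v)) - F (x, a))))//.
apply/funext => h /=; by congr (_ *: (F _ - _)); congr pair; rewrite /= scaler0 add0r.
Qed.

Lemma differentiable_partial1 (V W U : normedModType R) (F : V * W -> U) x a :
  differentiable F (x, a) -> differentiable (fun y => F (y, a)) x.
Proof.
by move=> H; apply: (@differentiable_comp _ _ _ _ (fun y => (y, a)) F).
Qed.

Lemma differentiable_partial2 (V W U : normedModType R) (F : V * W -> U) x a :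
  differentiable F (x, a) -> differentiable (fun b => F (x, b)) a.
Proof.
by move=> H; apply: (@differentiable_comp _ _ _ _ (fun b => (x, b)) F).
Qed.

Lemma differentiable_row (V : normedModType R) n (F : 'I_n -> V -> R) z :
  (forall j, differentiable (F j) z) ->
  differentiable (fun x => \row_j F j x) z.
Proof.
move=> H.
have -> : (fun x => \row_j F j x) = \sum_j (fun x => F j x *: ('e_j : 'rV[R]_n)).
  by apply/funext => x; rewrite fct_sumE [LHS]row_sum_delta;
    apply: eq_bigr => j _; rewrite mxE.
by apply: differentiable_sum => j; apply: differentiableZl.
Qed.

Lemma differentiable_rowP (V : normedModType R) n (F : V -> 'rV[R]_n) z j :
  differentiable F z -> differentiable (fun x => F x 0 j) z.
Proof.
move=> H; apply: (@differentiable_comp _ _ _ _ F (fun u : 'rV[R]_n => u 0 j)) => //.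
exact: differentiable_coord.
Qed.

Lemma derive_coord (V : normedModType R) n (F : V -> 'rV[R]_n) z v j :
  derivable F z v -> 'D_v (fun x => F x 0 j) z = 'D_v F z 0 j.
Proof. by move=> /derivableP /is_derive_coord H; apply: derive_val. Qed.

Lemma deriveEgrad n (g : 'rV[R]_n -> R) x v :
  differentiable g x -> 'D_v g x = dotv v (grad g x).
Proof.
move=> H; rewrite deriveE// {1}[v]row_sum_delta linear_sum/=.
by apply: eq_bigr => j _; rewrite linearZ/= mxE deriveE.
Qed.

Lemma row_jacobian m n (F : 'rV[R]_m -> 'rV[R]_n) x i :
  differentiable F x -> row i ('J F x) = 'D_('e_i) F x.
Proof. by move=> H; rewrite deriveEjacobian// rowE. Qed.

Lemma enorm_jacobian_le m n (F : 'rV[R]_m -> 'rV[R]_n) x y c :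
  (forall s : R, 0 <= s <= 1 -> let z := s *: (x - y) + y in
    differentiable F z /\ enorm ('J F z) <= c) ->
  enorm (F x - F y) <= c * enorm (x - y).
Proof.
move=> H; apply: (@enorm_segment_le _ _ _ _ x y (fun z => (x - y) *m 'J F z)).
move=> s s01 z; have [Hd Hc] := H s s01; split.
  rewrite -deriveEjacobian//; apply: derivableP; exact: diff_derivable.
rewrite (le_trans (ler_enorm_mulmx _ _))// mulrC ler_wpM2r// ?enorm_ge0//.
Qed.

Lemma derive_transport n (F : 'rV[R]_n * R -> R) z (b : 'rV[R]_n) :
  differentiable F z ->
  'D_((- b, 1) : 'rV[R]_n * R) F z = 'D_((0, 1) : 'rV[R]_n * R) F z -
    \sum_(j < n) b 0 j * 'D_(('e_j, 0) : 'rV[R]_n * R) F z.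
Proof.
move=> dF; rewrite !deriveE//.
have -> : (- b, 1) = (0, 1) - (b, 0) :> 'rV[R]_n * R.
  by congr pair; rewrite /= ?sub0r ?subr0.
rewrite linearB/=; congr (_ - _).
have -> : (b, 0) = \sum_(j < n) b 0 j *: (('e_j, 0) : 'rV[R]_n * R).
  rewrite [LHS]surjective_pairing [RHS]surjective_pairing; congr pair => /=.
    rewrite [LHS]row_sum_delta; elim/big_rec2: _ => [|j y1 y2 _ IH] //=.
    by rewrite -IH.
  by elim/big_rec: _ => // j y _ IH; rewrite /= scaler0 add0r.
rewrite linear_sum/=; apply: eq_bigr => j _.
by rewrite linearZ/= deriveE.
Qed.

Lemma C2_differentiable (V W : normedModType R) (F : V -> W) z :
  C2 F -> differentiable F z.
Proof. by case=> /(_ z I)[]. Qed.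

Lemma C2_differentiable_derive (V W : normedModType R) (F : V -> W) v z :
  C2 F -> differentiable ('D_v F) z.
Proof. by case=> _ /(_ v z I)[]. Qed.

End row_calculus.

(** * Properties of the policy *)

Section policy.
Context {R : realType} (d p : nat).
Local Notation state := 'rV[R]_d.
Local Notation control := 'rV[R]_p.
Variables (Cf Cl l0 : R) (f : state -> control -> state) (l : state -> control -> R).
Hypothesis f_C2 : C2 (fun z : state * control => f z.1 z.2).
Hypothesis l_C2 : C2 (fun z : state * control => l z.1 z.2).
Hypothesis HA1 : assumption_A1 Cf Cl l0 f l.
Hypothesis HA2 : assumption_A2 Cf Cl f l.

Let F (z : state * control) := f z.1 z.2.
Let L (z : state * control) := l z.1 z.2.

Lemma differentiable_f x a : differentiable (f^~ a) x.
Proof.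
by apply: (@differentiable_partial1 _ _ _ _ F); exact: C2_differentiable.
Qed.

Lemma differentiable_la x a : differentiable (l x) a.
Proof.
by apply: (@differentiable_partial2 _ _ _ _ L); exact: C2_differentiable.
Qed.

Lemma differentiable_df x a v : differentiable ('D_v (f^~ a)) x.
Proof.
have -> : 'D_v (f^~ a) = fun y => 'D_((v, 0) : state * control) F (y, a).
  by apply/funext => y; rewrite -derive_partial1.
apply: (@differentiable_partial1 _ _ _ _ ('D_((v, 0) : state * control) F)).
exact: C2_differentiable_derive.
Qed.

Let gradxE : (fun z : state * control => grad (l^~ z.2) z.1) =
  fun z => \row_i 'D_(('e_i, 0) : state * control) L z.
Proof.
by apply/funext => -[x a]; apply/rowP => i; rewrite !mxE -derive_partial1.
Qed.

Let gradaE : (fun z : state * control => grad (l z.1) z.2) =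
  fun z => \row_i 'D_((0, 'e_i) : state * control) L z.
Proof.
by apply/funext => -[x a]; apply/rowP => i; rewrite !mxE -derive_partial2.
Qed.

Lemma differentiable_gradx z :
  differentiable (fun z : state * control => grad (l^~ z.2) z.1) z.
Proof.
rewrite gradxE; apply: differentiable_row => i.
exact: C2_differentiable_derive.
Qed.

Lemma differentiable_grada z :
  differentiable (fun z : state * control => grad (l z.1) z.2) z.
Proof.
rewrite gradaE; apply: differentiable_row => i.
exact: C2_differentiable_derive.
Qed.

Lemma f_lipschitz x1 a1 x2 a2 :
  enorm (f x1 a1 - f x2 a2) <= Cf * (enorm (x1 - x2) + enorm (a1 - a2)).
Proof.
rewrite (le_trans (ler_enorm_distD (f x2 a1) _ _))// mulrDr lerD//.
  apply: (@enorm_jacobian_le _ _ _ (f^~ a1)) => s _ z; split.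
    exact: differentiable_f.
  exact: A1_Dxf HA1 _ _.
have [f0 [c [cC fE]]] := A1_affine HA1.
rewrite !fE opprD addrACA subrr add0r -mulmxBl.
by rewrite (le_trans (ler_enorm_mulmx _ _))// mulrC ler_wpM2r// enorm_ge0.
Qed.

(** By (A1) a change of control adds to [f] a vector independent of x. Otherwise [source_lipschitz]
    would contain [lam1], which grows linearly, times a difference of controls. *)
Lemma jacobian_f_control x1 a1 a2 :
  'J (f^~ a1) x1 = 'J (f^~ a2) x1.
Proof.
have [f0 [c [cC fE]]] := A1_affine HA1.
apply/row_matrixP => i.
have E a : row i ('J (f^~ a) x1) = 'D_('e_i) (f^~ a) x1.
  exact: (row_jacobian i (differentiable_f x1 a)).
apply: (etrans (E a1)); apply/esym; apply: (etrans (E a2)); apply/esym.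
apply: (@derive_affine _ _ _ _ (f^~ a2) ((a1 - a2) *m c)) => y.
by rewrite !fE mulmxBl -addrA [a2 *m c + _]addrC subrK.
Qed.

Lemma gradx_lipschitz x1 a1 x2 a2 :
  enorm (grad (l^~ a1) x1 - grad (l^~ a2) x2) <=
    Cl * (enorm (x1 - x2) + enorm (a1 - a2)).
Proof.
rewrite (le_trans (ler_enorm_distD (grad (l^~ a1) x2) _ _))// mulrDr lerD//.
  apply: enorm_jacobian_le => s _ z; split; last exact: A2_D2xxl HA2 _ _.
  exact: (differentiable_partial1 (differentiable_gradx (z, a1))).
apply: (@enorm_jacobian_le _ _ _ (fun b => grad (l^~ b) x2)) => s _ z; split.
  exact: (differentiable_partial2 (differentiable_gradx (x2, z))).
exact: A2_D2axl HA2 _ _.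
Qed.

Lemma grada_lipschitz x1 x2 a :
  enorm (grad (l x1) a - grad (l x2) a) <= Cl * enorm (x1 - x2).
Proof.
apply: (@enorm_jacobian_le _ _ _ (fun y => grad (l y) a)) => s _ z; split.
  exact: (differentiable_partial1 (differentiable_grada (z, a))).
exact: A2_D2xal HA2 _ _.
Qed.

(** Mean value theorem for [s |-> v . grad (l x) (a2 + s v)], whose derivative is the Hessian form
    bounded below in (A1). *)
Lemma grada_monotone x a1 a2 :
  l0 * enorm (a1 - a2) ^+ 2
    <= dotv (a1 - a2) (grad (l x) a1 - grad (l x) a2).
Proof.
set v := a1 - a2.
pose q (s : R) := dotv (grad (l x) (s *: v + a2)) v.
have qD (s : R) : is_derive (s : R) (1 : R) q (dotv (v *m hess (l x) (s *: v + a2)) v).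
  apply: is_derive_dotvl; apply: (is_derive_curve (F := grad (l x))).
  have H : differentiable (grad (l x)) (s *: v + a2).
    exact: (differentiable_partial2 (differentiable_grada (x, s *: v + a2))).
  by rewrite /hess -deriveEjacobian//; apply: derivableP; exact: diff_derivable.
have [s s01] : exists2 s : R, s \in `]0, 1[%R &
    q 1 - q 0 = dotv (v *m hess (l x) (s *: v + a2)) v * (1 - 0).
  apply: MVT => //.
  apply: continuous_in_subspaceT => s _.
  exact: (is_derive_continuous1 (qD s)).
rewrite /q scale1r subrK scale0r add0r subr0 mulr1 -dotvBl dotvC => ->.
have := A1_convex HA1 x (s *: v + a2) v.
rewrite mulmxBr dotvBl mul_mx_scalar dotvZl dotvE subr_ge0//.
Qed.

Section argmax.
Variables (x lam : state) (a : control).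
Hypothesis Ha : is_argmax (fun b => - dotv lam (f x b) - l x b) a.

(** First-order condition at the maximizer: the one-sided inequality is tested with [v] and [- v].
    As [f] is affine in the control, its derivative along [v] is [v *m c]. *)
Lemma argmax_critical c f0 : (forall x a, f x a = f0 x + a *m c) ->
  forall v, dotv v (grad (l x) a) = - dotv lam (v *m c).
Proof.
move=> fE.
have H v : 0 <= - dotv lam (v *m c) - dotv v (grad (l x) a).
  have HD : is_derive a v (fun b => - dotv lam (f x b) - l x b)
      (- dotv lam (v *m c) - dotv v (grad (l x) a)).
    apply: is_deriveB; last first.
      rewrite -deriveEgrad; last exact: differentiable_la.
      by apply: derivableP; apply: diff_derivable; exact: differentiable_la.
    apply: is_deriveN; under eq_fun do rewrite dotvC; rewrite dotvC.
    apply: is_derive_dotvl.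
    apply: (@is_derive_comp_affine _ _ _ _ id (f x) a v (v *m c)) => h.
    by rewrite !fE mulmxDl -scalemxAl addrCA.
  have HD0 : is_derive (0 : R) (1 : R) (fun h : R => (- dotv lam (f x (h *: v + a)) - l x (h *: v + a)))
      (- dotv lam (v *m c) - dotv v (grad (l x) a)).
    by apply: (is_derive_curve (F := fun b => - dotv lam (f x b) - l x b)); rewrite scale0r add0r.
  apply: (is_derive_left_ge0 HD0); near=> h.
  by rewrite addr0 scale0r add0r; exact: Ha.
move=> v; have := H v; have := H (- v); rewrite mulNmx dotvNr dotvNl; lra.
Unshelve. all: by end_near. Qed.

(** The first-order condition tested with [v] equal to the gradient of [l] itself gives
    [|grad| <= Cf |lam|]; coercivity of the gradient in (A1) converts this into a bound on the
    control. *)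
Lemma argmax_bound : l0 * enorm a <= l0 + Cf * enorm lam.
Proof.
have [f0 [c [cC fE]]] := A1_affine HA1.
have := A1_Dal HA1 x a; set g := grad _ _ => h1.
have h2 := argmax_critical fE g; rewrite -/g dotvE in h2.
suff : enorm g <= Cf * enorm lam by lra.
have [->|g0] := eqVneq (enorm g) 0.
  by rewrite mulr_ge0 ?enorm_ge0// (le_trans (enorm_ge0 c)).
have {}g0 : 0 < enorm g by rewrite lt_def g0 enorm_ge0.
rewrite -(ler_pM2r g0) -expr2 h2 -dotvNr -mulNmx.
rewrite (le_trans (dotv_le _ _))// [leRHS]mulrAC mulrC ler_wpM2r ?enorm_ge0//.
by rewrite (le_trans (ler_enorm_mulmx _ _))// enormN mulrC ler_wpM2r// enorm_ge0.
Qed.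

End argmax.

(** The two first-order conditions are subtracted and tested with [a1 - a2]. Strong monotonicity at
    [x1] bounds the result below; passing from [x1] to [x2] at the fixed control [a2] costs the
    mixed second derivative bound [Cl]. *)
Lemma argmax_lipschitz x1 lam1 a1 x2 lam2 a2 :
  is_argmax (fun b => - dotv lam1 (f x1 b) - l x1 b) a1 ->
  is_argmax (fun b => - dotv lam2 (f x2 b) - l x2 b) a2 ->
  l0 * enorm (a1 - a2) <= Cf * enorm (lam1 - lam2) + Cl * enorm (x1 - x2).
Proof.
move=> H1 H2.
have [f0 [c [cC fE]]] := A1_affine HA1.
set v := a1 - a2.
have E1 := argmax_critical H1 fE v; have E2 := argmax_critical H2 fE v.
have M := grada_monotone x1 a1 a2; rewrite -/v in M.
have G := grada_lipschitz x2 x1 a2; rewrite (enorm_sym x2) in G.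
have [v0|v0] := eqVneq (enorm v) 0.
  have Cf0 : 0 <= Cf by rewrite (le_trans (enorm_ge0 c)).
  have := enorm_ge0 (lam1 - lam2).
  have := le_trans (enorm_ge0 _) G.
  by rewrite v0 mulr0 => ? ?; rewrite addr_ge0// mulr_ge0.
have {}v0 : 0 < enorm v by rewrite lt_def v0 enorm_ge0.
rewrite -(ler_pM2r v0).
have -> : l0 * enorm v * enorm v = l0 * enorm v ^+ 2 by ring.
apply: (le_trans M).
have -> : dotv v (grad (l x1) a1 - grad (l x1) a2)
  = dotv (lam1 - lam2) (- v *m c) + dotv v (grad (l x2) a2 - grad (l x1) a2).
  by rewrite mulNmx !dotvBr E1 E2 dotvNr dotvBl; ring.
rewrite mulrDl lerD//.
  rewrite (le_trans (dotv_le _ _))// [leRHS]mulrAC mulrC ler_wpM2r ?enorm_ge0//.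
  by rewrite (le_trans (ler_enorm_mulmx _ _))// enormN mulrC ler_wpM2r// enorm_ge0.
by rewrite (le_trans (dotv_le _ _))// mulrC ler_wpM2r// enorm_ge0.
Qed.

End policy.


(** * A priori bounds *)

Section transport_bounds.
Context {R : realType} (d : nat).
Local Notation state := 'rV[R]_d.
Variables (mu b g : state -> R -> state) (T B : R).
Hypothesis T_gt0 : 0 < T.
Hypothesis B_ge0 : 0 <= B.
Hypothesis mu_cont :
  {within [set z : state * R | 0 <= z.2 <= T], continuous (fun z => mu z.1 z.2)}.
Hypothesis mu_transport : forall x t, 0 < t < T ->
  is_derive (x, t) (- b x t, 1 : R) (fun z : state * R => mu z.1 z.2) (g x t).
Hypothesis b_growth : forall x t, 0 < t < T -> enorm (b x t) <= B * (1 + enorm x).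

(** In the direction [- b] the function [1 + |x|^2] decreases at relative rate at most [4 * B],
    which is the exponent of the localization in the maximum principle. *)
Lemma sqr_enorm_drift x t : 0 < t < T ->
  2 * dotv x (b x t) <= 4 * B * (1 + enorm x ^+ 2).
Proof.
move=> tT; have h1 := dotv_le x (b x t).
have h2 := ler_wpM2l (enorm_ge0 x) (b_growth x tT).
have h3 : B * (enorm x * (1 + enorm x)) <= B * (2 * (1 + enorm x ^+ 2)).
  by rewrite ler_wpM2l//; have := sqr_ge0 (enorm x - 1); have := enorm_ge0 x; nra.
nra.
Qed.

(** Maximum principle for [|mu|^2 - (N + A t) (1 + |x|^2)]. The condition on [A] collects what the
    slope has to absorb: [2 S^2] from [2 mu . g <= |mu|^2 + |g|^2], [4 B] from the drift acting on
    [1 + |x|^2], and 1 from allowing [dG <= G]. *)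
Lemma transport_growth (N A S : R) : 0 <= N -> 0 <= A -> 0 <= S ->
  (forall x t, 0 < t < T -> enorm (g x t) <= S * (1 + enorm x)) ->
  (forall x, enorm (mu x 0) ^+ 2 <= N * (1 + enorm x ^+ 2)) ->
  (N + A * T) * (1 + 4 * B) + 2 * S ^+ 2 <= A ->
  forall x t, 0 <= t <= T -> enorm (mu x t) ^+ 2 <= (N + A * t) * (1 + enorm x ^+ 2).
Proof.
move=> N0 A0 S0 gS mu0 HA x t tT; rewrite -subr_le0.
pose q (x : state) := 1 + enorm x ^+ 2.
pose G (z : state * R) := enorm (mu z.1 z.2) ^+ 2 - (N + A * z.2) * q z.1.
have q_cont : continuous q.
  move=> y; have c1 : {for y, continuous (fun _ : state => 1 : R)} by exact: cst_continuous.
  exact: (continuousD c1 (@continuous_sqr_enorm _ _ y)).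
have HNA s : 0 <= s <= T -> 0 <= N + A * s <= N + A * T.
  by move=> /andP[s0 sT]; rewrite addr_ge0 ?mulr_ge0// lerD2l ler_wpM2l.
apply: (@transport_max_principle _ _ q G T (4 * B) 1) => //.
- move=> r; apply: (@subclosed_compact _ _ [set u : state | enorm u <= r]).
  - apply: (@closed_comp _ _ q [set s | s <= r]); last exact: closed_le.
    by move=> y _; exact: q_cont.
  - exact: compact_enorm_le.
  by move=> z /=; rewrite /q; have := sqr_ge0 (enorm z - 1); have := enorm_ge0 z; lra.
- by move=> z; rewrite addr_ge0// sqr_ge0.
- by rewrite mulr_ge0.
- move=> z; apply: cvgB.
    exact: (continuous_within_comp mu_cont (@continuous_sqr_enorm _ _)).
  apply: (@continuous_subspaceT _ _ _ (fun z : state * R => (N + A * z.2) * q z.1)).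
  move=> {}z; apply: cvgM.
    apply: cvgD; first exact: cvg_cst.
    by apply: cvgM; [exact: cvg_cst|exact: cvg_snd].
  by apply: continuous_comp; [exact: cvg_fst|exact: q_cont].
- by move=> z; rewrite /G/= mulr0 addr0 subr_le0.
- move=> z s sT _.
  have Hid : is_derive z (- b z s) (fun x : state => x) (- b z s).
    exact: is_derive_id.
  have Hq : is_derive z (- b z s) q (- (2 * dotv z (b z s))).
    have := is_deriveD (is_derive_cst (1 : R) z (- b z s)) (is_derive_sqr_enorm Hid).
    by move/is_derive_eq; apply; rewrite dotvNr mulrN add0r.
  have Hs : is_derive (z, s) (- b z s, 1 : R) (fun y : state * R => N + A * y.2) A.
    have H1 := is_deriveZ A (is_derive_time (z, s) (- b z s)).
    have := is_deriveD (is_derive_cst N (z, s) (- b z s, 1 : R)) H1.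
    by move/is_derive_eq; apply; rewrite add0r [_ *: _]mulr1.
  have HG : is_derive (z, s) (- b z s, 1 : R) G
    (2 * dotv (mu z s) (g z s) - (A * q z + (N + A * s) * (- (2 * dotv z (b z s))))).
    have Hq' := @is_derive_space _ _ _ q (z, s) (- b z s) 1 _ Hq.
    have := is_deriveB (is_derive_sqr_enorm (mu_transport z sT)) (is_deriveM Hs Hq').
    by move/is_derive_eq; apply; rewrite /= ![_ *: _]mulrC; ring.
  exists (- b z s), (- (2 * dotv z (b z s))),
     (2 * dotv (mu z s) (g z s) - (A * q z + (N + A * s) * (- (2 * dotv z (b z s))))).
  split=> //.
    by rewrite lerN2 sqr_enorm_drift.
  rewrite /G/= mul1r.
  have h1 := dotv_le (mu z s) (g z s).
  have h2 : enorm (g z s) ^+ 2 <= S ^+ 2 * (2 * q z).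
    apply: (@le_trans _ _ ((S * (1 + enorm z)) ^+ 2)).
      by rewrite ler_sqr ?nnegrE ?enorm_ge0 ?mulr_ge0 ?addr_ge0 ?enorm_ge0//; exact: gS.
    rewrite exprMn ler_wpM2l ?sqr_ge0// /q.
    by have := sqr_ge0 (enorm z - 1); lra.
  have h3 := sqr_enorm_drift z sT; rewrite -/(q z) in h3.
  have [s0 sT'] := andP sT.
  have /andP[n1 n2] : 0 <= N + A * s <= N + A * T by rewrite HNA// !ltW.
  have h4 := ler_wpM2l n1 h3.
  have q0 : 0 <= q z by rewrite addr_ge0// sqr_ge0.
  have h5 := ler_wpM2r q0 HA.
  have h6 : (N + A * s) * ((1 + 4 * B) * q z) <= (N + A * T) * ((1 + 4 * B) * q z).
    by rewrite ler_wpM2r// !mulr_ge0// addr_ge0// mulr_ge0.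
  have h7 := sqr_ge0 (enorm (mu z s) - enorm (g z s)).
  lra.
Qed.

(** Since [mu] is only C^1, its space derivatives satisfy no equation that could be estimated.
    Instead both points move, each with its own drift, and [|x - y|^2] changes at relative rate at
    most [2 L], which explains the condition on [A]. *)
Lemma transport_lipschitz (K A S L : R) : 0 <= K -> 0 <= A ->
  (forall x y t, 0 < t < T -> enorm (b x t - b y t) <= L * enorm (x - y)) ->
  (forall x y t, 0 < t < T -> enorm (g x t - g y t) <= S * enorm (x - y)) ->
  (forall x y, enorm (mu x 0 - mu y 0) ^+ 2 <= K * enorm (x - y) ^+ 2) ->
  0 <= L -> 0 <= S -> (K + A * T) * (1 + 2 * L) + S ^+ 2 <= A ->
  forall x y t, 0 <= t <= T ->
    enorm (mu x t - mu y t) ^+ 2 <= (K + A * t) * enorm (x - y) ^+ 2.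
Proof.
move=> K0 A0 bL gS mu0 L0 S0 HA x y t tT; rewrite -subr_le0.
pose q (z : state * state) := (1 + enorm z.1 ^+ 2) + enorm z.2 ^+ 2.
pose G (z : state * state * R) := enorm (mu z.1.1 z.2 - mu z.1.2 z.2) ^+ 2
  - (K + A * z.2) * enorm (z.1.1 - z.1.2) ^+ 2.
have n1c : continuous (fun z : state * state => enorm z.1 ^+ 2).
  move=> z; apply: (@continuous_comp _ _ _ fst (fun u : state => enorm u ^+ 2)).
    exact: cvg_fst.
  exact: continuous_sqr_enorm.
have n2c : continuous (fun z : state * state => enorm z.2 ^+ 2).
  move=> z; apply: (@continuous_comp _ _ _ snd (fun u : state => enorm u ^+ 2)).
    exact: cvg_snd.
  exact: continuous_sqr_enorm.
have q_cont : continuous q.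
  move=> z; have c1 : {for z, continuous (fun _ : state * state => 1 : R)}.
    exact: cst_continuous.
  exact: (continuousD (continuousD c1 (n1c z)) (n2c z)).
have HKA s : 0 <= s <= T -> 0 <= K + A * s <= K + A * T.
  by move=> /andP[s0 sT]; rewrite addr_ge0 ?mulr_ge0// lerD2l ler_wpM2l.
have h_cont i : continuous (fun z : state * state * R =>
    (if i then z.1.1 else z.1.2, z.2)).
  move=> z; have h1 : (if i then w.1.1 else w.1.2) @[w --> z] -->
      (if i then z.1.1 else z.1.2).
    have h0 : w.1 @[w --> z] --> z.1 by exact: cvg_fst.
    case: i; first exact: (@continuous_comp _ _ _ fst fst z h0 cvg_fst).
    exact: (@continuous_comp _ _ _ fst snd z h0 cvg_snd).
  have h2 : w.2 @[w --> z] --> z.2 by exact: cvg_snd.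
  exact: (cvg_pair h1 h2).
have mu_cont' i : {within [set z : state * state * R | 0 <= z.2 <= T],
    continuous (fun z => mu (if i then z.1.1 else z.1.2) z.2)}.
  apply/subspace_continuousP => z zT.
  have := mu_cont => /subspace_continuousP/(_ (if i then z.1.1 else z.1.2, z.2) zT).
  move=> H P /= HP; have := h_cont i z _ (H P HP).
  by rewrite /nbhs/=; apply: filterS => w; apply.
have mu_diff_cont : {within [set z : state * state * R | 0 <= z.2 <= T],
    continuous (fun z => mu z.1.1 z.2 - mu z.1.2 z.2)}.
  by move=> z; apply: cvgB; [exact: (mu_cont' true)|exact: (mu_cont' false)].
(* The two drift bounds add up to [4 B (2 + |x|^2 + |y|^2)], at most [8 B q]. *)
apply: (@transport_max_principle _ _ q G T (8 * B) 1 _ _ _ _ _ _ _ (x, y)) => //.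
- move=> r; apply: (@subclosed_compact _ _
    ([set u : state | enorm u <= r] `*` [set u : state | enorm u <= r])).
  - apply: (@closed_comp _ _ q [set s | s <= r]); last exact: closed_le.
    by move=> z _; exact: q_cont.
  - by apply: compact_setX; exact: compact_enorm_le.
  move=> z /=; rewrite /q; have := sqr_ge0 (enorm z.1 - 1); have := enorm_ge0 z.1.
  have := sqr_ge0 (enorm z.2 - 1); have := enorm_ge0 z.2.
  have := sqr_ge0 (enorm z.2); have := sqr_ge0 (enorm z.1).
  by move=> *; split => /=; lra.
- by move=> z; rewrite !addr_ge0// sqr_ge0.
- by rewrite mulr_ge0.
- move=> z; apply: cvgB.
    exact: (continuous_within_comp mu_diff_cont (@continuous_sqr_enorm _ _)).
  apply: (@continuous_subspaceT _ _ _ (fun z : state * state * R =>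
    (K + A * z.2) * enorm (z.1.1 - z.1.2) ^+ 2)) => {}z.
  apply: cvgM.
    apply: cvgD; first exact: cvg_cst.
    by apply: cvgM; [exact: cvg_cst|exact: cvg_snd].
  apply: (@continuous_comp _ _ _ (fun z : state * state * R => z.1.1 - z.1.2)
    (fun u => enorm u ^+ 2)); last exact: continuous_sqr_enorm.
  have h0 : w.1 @[w --> z] --> z.1 by exact: cvg_fst.
  apply: cvgB; first exact: (@continuous_comp _ _ _ fst fst z h0 cvg_fst).
  exact: (@continuous_comp _ _ _ fst snd z h0 cvg_snd).
- by move=> z; rewrite /G/= mulr0 addr0 subr_le0.
- move=> [z z'] s sT _.
  pose w := (- b z s, - b z' s).
  have Hid1 : is_derive (z, z') w (fun y : state * state => y.1) (- b z s).
    by apply: (@is_derive_comp_affine _ _ _ _ id fst (z, z') w (- b z s)).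
  have Hid2 : is_derive (z, z') w (fun y : state * state => y.2) (- b z' s).
    by apply: (@is_derive_comp_affine _ _ _ _ id snd (z, z') w (- b z' s)).
  have Hq : is_derive (z, z') w q (- (2 * dotv z (b z s)) - 2 * dotv z' (b z' s)).
    have := is_deriveD (is_deriveD (is_derive_cst (1 : R) (z, z') w)
      (is_derive_sqr_enorm Hid1)) (is_derive_sqr_enorm Hid2).
    by move/is_derive_eq; apply; rewrite /= !dotvNr !mulrN add0r.
  have Hs : is_derive (z, z', s) (w, 1 : R) (fun y : state * state * R => K + A * y.2) A.
    have H1 := is_deriveZ A (is_derive_time (z, z', s) w).
    have := is_deriveD (is_derive_cst K (z, z', s) (w, 1 : R)) H1.
    by move/is_derive_eq; apply; rewrite add0r [_ *: _]mulr1.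
  have Hmu1 : is_derive (z, z', s) (w, 1 : R) (fun y => mu y.1.1 y.2) (g z s).
    by apply: (@is_derive_comp_affine _ _ _ _ (fun z => mu z.1 z.2)
      (fun y : state * state * R => (y.1.1, y.2)) _ _ (- b z s, 1 : R));
     [|exact: mu_transport].
  have Hmu2 : is_derive (z, z', s) (w, 1 : R) (fun y => mu y.1.2 y.2) (g z' s).
    by apply: (@is_derive_comp_affine _ _ _ _ (fun z => mu z.1 z.2)
      (fun y : state * state * R => (y.1.2, y.2)) _ _ (- b z' s, 1 : R));
     [|exact: mu_transport].
  have Hxy : is_derive (z, z', s) (w, 1 : R)
      (fun y : state * state * R => enorm (y.1.1 - y.1.2) ^+ 2)
      (2 * dotv (z - z') (- (b z s - b z' s))).
    have H := is_derive_sqr_enorm (is_deriveB Hid1 Hid2).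
    have -> : - (b z s - b z' s) = - b z s - - b z' s by rewrite opprB opprK addrC.
    exact: (@is_derive_space _ _ _ (fun y : state * state => enorm (y.1 - y.2) ^+ 2) (z, z', s)).
  set dxy := dotv (z - z') (b z s - b z' s).
  have HG : is_derive (z, z', s) (w, 1 : R) G
    (2 * dotv (mu z s - mu z' s) (g z s - g z' s)
      - (A * enorm (z - z') ^+ 2 - 2 * (K + A * s) * dxy)).
    have := is_deriveB (is_derive_sqr_enorm (is_deriveB Hmu1 Hmu2)) (is_deriveM Hs Hxy).
    move/is_derive_eq; apply; rewrite /= ![_ *: _]mulrC dotvNr -/dxy !fctE/=; ring.
  exists w, (- (2 * dotv z (b z s)) - 2 * dotv z' (b z' s)),
    (2 * dotv (mu z s - mu z' s) (g z s - g z' s)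
      - (A * enorm (z - z') ^+ 2 - 2 * (K + A * s) * dxy)).
  split=> //.
    rewrite /q/=.
    have := mulr_ge0 B_ge0 (sqr_ge0 (enorm z)).
    have := mulr_ge0 B_ge0 (sqr_ge0 (enorm z')).
    have := sqr_enorm_drift z sT; have := sqr_enorm_drift z' sT; lra.
  rewrite /G/= mul1r.
  have h1 := dotv_le (mu z s - mu z' s) (g z s - g z' s).
  have h2 : enorm (g z s - g z' s) ^+ 2 <= S ^+ 2 * enorm (z - z') ^+ 2.
    by rewrite -exprMn ler_sqr ?nnegrE ?enorm_ge0 ?mulr_ge0 ?enorm_ge0//; exact: gS.
  have h3 : dxy <= L * enorm (z - z') ^+ 2.
    rewrite (le_trans (dotv_le _ _))// expr2 mulrA mulrC ler_wpM2r ?enorm_ge0//.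
    exact: bL.
  have [s0 sT'] := andP sT.
  have /andP[n1 n2] : 0 <= K + A * s <= K + A * T by rewrite HKA// !ltW.
  have h4 := ler_wpM2l n1 h3.
  have q0 := sqr_ge0 (enorm (z - z')).
  have h5 := ler_wpM2r q0 HA.
  have h6 : (K + A * s) * ((1 + 2 * L) * enorm (z - z') ^+ 2) <=
      (K + A * T) * ((1 + 2 * L) * enorm (z - z') ^+ 2).
    by apply: ler_wpM2r => //; apply: mulr_ge0 => //; lra.
  have h7 := sqr_ge0 (enorm (mu z s - mu z' s) - enorm (g z s - g z' s)).
  lra.
Qed.

End transport_bounds.


(** * The source term and the directional form of the equations *)

Section source_term.
Context {R : realType} (d p : nat).
Local Notation state := 'rV[R]_d.
Local Notation control := 'rV[R]_p.
Variables (Cf Cl l0 : R) (f : state -> control -> state) (l : state -> control -> R).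
Hypothesis Cf_gt0 : 0 < Cf.
Hypothesis f_C2 : C2 (fun z : state * control => f z.1 z.2).
Hypothesis l_C2 : C2 (fun z : state * control => l z.1 z.2).
Hypothesis HA1 : assumption_A1 Cf Cl l0 f l.
Hypothesis HA2 : assumption_A2 Cf Cl f l.

(* The zeroth-order part of the transport equations, as a row vector: [mu]
   solves them iff its derivative along [(- f x (a x t), 1)] is [source]. *)
Definition source (x : state) (a : control) (lam : state) : state :=
  lam *m ('J (f^~ a) x)^T + grad (l^~ a) x.

Lemma enorm_mul_jacobian (lam x : state) a :
  enorm (lam *m ('J (f^~ a) x)^T) <= Cf * enorm lam.
Proof.
rewrite (le_trans (ler_enorm_mulmx _ _))// mulrC ler_wpM2r ?enorm_ge0//.
by rewrite enorm_tr; exact: A1_Dxf HA1 _ _.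
Qed.

Lemma source_growth x a lam :
  enorm (source x a lam) <= Cf * enorm lam + Cl * (1 + enorm x + enorm a).
Proof.
rewrite (le_trans (ler_enormD _ _))// lerD ?enorm_mul_jacobian//.
exact: A1_Dxl HA1 _ _.
Qed.

(* If [|x - y|] is large compared to [1 + |x|] then the bound on the Jacobian
   itself suffices; otherwise the whole segment stays at distance comparable to
   [|x|] from the origin, where second derivatives are of size [1 / (1 + |x|)]. *)
Lemma jacobian_f_lipschitz (x y : state) a :
  (1 + enorm x) * enorm ('J (f^~ a) x - 'J (f^~ a) y)
    <= (2 * d%:R + 4) * Cf * enorm (x - y).
Proof.
have x1 : 0 < 1 + enorm x by rewrite ltr_wpDr ?enorm_ge0.
have xy0 := enorm_ge0 (x - y).
have dn : 0 <= d%:R * (Cf * enorm (x - y)).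
  by rewrite mulr_ge0// mulr_ge0// ltW.
(* The far case produces the 4 in the constant; the near one produces [2 d], with a term
   [2 Cf / (1 + |x|)] for each of the [d] rows. *)
have [far|near] := ltP ((1 + enorm x) / 2) (enorm (x - y)).
  have J2 : enorm ('J (f^~ a) x - 'J (f^~ a) y) <= Cf + Cf.
    by rewrite (le_trans (ler_enormB _ _))// lerD//; exact: A1_Dxf HA1 _ _.
  have h1 := ler_wpM2l (ltW x1) J2.
  have h2 : Cf * ((1 + enorm x) / 2) <= Cf * enorm (x - y).
    by rewrite ler_wpM2l// ltW.
  nra.
have H i : enorm (row i ('J (f^~ a) x - 'J (f^~ a) y)) <=
    (Cf / ((1 + enorm x) / 2)) * enorm (x - y).
  have E z : row i ('J (f^~ a) z) = 'D_('e_i) (f^~ a) z.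
    exact: (row_jacobian i (differentiable_f f_C2 z a)).
  have -> : row i ('J (f^~ a) x - 'J (f^~ a) y) =
      'D_('e_i) (f^~ a) x - 'D_('e_i) (f^~ a) y.
    by rewrite linearB/=; congr (_ - _); exact: E.
  apply: (@enorm_jacobian_le _ _ _ ('D_('e_i) (f^~ a))) => s /andP[s0 s1] z; split.
    exact: (differentiable_df f_C2).
  have zx : (1 + enorm x) / 2 <= 1 + enorm z.
    have : enorm x <= enorm (x - z) + enorm z.
      by rewrite -{1}(subrK z x) ler_enormD.
    have -> : x - z = (1 - s) *: (x - y).
      by rewrite /z scalerBl scale1r opprD addrA -addrA [- (_ *: _) - y]addrC addrA.
    rewrite enormZ ger0_norm ?subr_ge0//.
    have : (1 - s) * enorm (x - y) <= 1 * enorm (x - y).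
      by rewrite ler_wpM2r// gerBl.
    lra.
  have zp : 0 < (1 + enorm x) / 2 by rewrite divr_gt0.
  apply: (@le_trans _ _ (Cf / (1 + enorm z))); last first.
    by rewrite (ler_wpM2l (ltW Cf_gt0))// lef_pV2 ?posrE// (lt_le_trans zp).
  apply: le_trans (A2_D2f HA2 z a).
  rewrite (bigD1 i)//= lerDl; apply: sumr_ge0 => j _; exact: enorm_ge0.
have := le_trans (ler_enorm_rows _) (ler_sum _ (fun i _ => H i)).
rewrite sumr_const card_ord => /(ler_wpM2l (ltW x1)) /le_trans; apply.
rewrite -(mulr_natl (_ * enorm (x - y))).
have -> : (1 + enorm x) * (d%:R * (Cf / ((1 + enorm x) / 2) * enorm (x - y))) =
   2 * d%:R * Cf * enorm (x - y) by field; rewrite gt_eqF.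
have := mulr_ge0 (ltW Cf_gt0) xy0; nra.
Qed.

(** The dangerous term is [lam1] times the variation of the Jacobian in x: the factor [1 + |x1|] in
    the bound on [lam1] is exactly the one absorbed by [jacobian_f_lipschitz]. *)
Lemma source_lipschitz M x1 a1 lam1 x2 a2 lam2 :
  0 <= M -> enorm lam1 <= M * (1 + enorm x1) ->
  enorm (source x1 a1 lam1 - source x2 a2 lam2) <=
    Cf * enorm (lam1 - lam2) + M * ((2 * d%:R + 4) * Cf * enorm (x1 - x2))
    + Cl * (enorm (x1 - x2) + enorm (a1 - a2)).
Proof.
move=> M0 lamM.
have -> : source x1 a1 lam1 - source x2 a2 lam2 =
    (lam1 - lam2) *m ('J (f^~ a1) x2)^T +
    lam1 *m ('J (f^~ a1) x1 - 'J (f^~ a1) x2)^T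
    + (grad (l^~ a1) x1 - grad (l^~ a2) x2).
  rewrite /source opprD addrACA; congr (_ + _).
  have -> : 'J (f^~ a2) x2 = 'J (f^~ a1) x2.
    exact: (jacobian_f_control f_C2 HA1).
  move: ('J (f^~ a1) x1) ('J (f^~ a1) x2) => J1 J2.
  rewrite linearB/= mulmxBr mulmxBl.
  by rewrite [RHS]addrC -!addrA; congr (_ + _); rewrite addrA addNr add0r.
rewrite (le_trans (ler_enormD _ _))// lerD//; last exact: gradx_lipschitz HA2 _ _ _ _.
rewrite (le_trans (ler_enormD _ _))// lerD ?enorm_mul_jacobian//.
rewrite (le_trans (ler_enorm_mulmx _ _))// enorm_tr.
apply: (le_trans (ler_wpM2r (enorm_ge0 _) lamM)).
by rewrite -[leLHS]mulrA; apply: ler_wpM2l => //; exact: jacobian_f_lipschitz.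
Qed.

Lemma source_lipschitz_control x a1 lam1 a2 lam2 :
  enorm (source x a1 lam1 - source x a2 lam2) <=
    Cf * enorm (lam1 - lam2) + Cl * enorm (a1 - a2).
Proof.
have -> : source x a1 lam1 - source x a2 lam2 =
    (lam1 - lam2) *m ('J (f^~ a1) x)^T + (grad (l^~ a1) x - grad (l^~ a2) x).
  rewrite /source opprD addrACA; congr (_ + _).
  have -> : 'J (f^~ a2) x = 'J (f^~ a1) x by exact: (jacobian_f_control f_C2 HA1).
  by rewrite mulmxBl.
rewrite (le_trans (ler_enormD _ _))// lerD ?enorm_mul_jacobian//.
have := gradx_lipschitz l_C2 HA2 x a1 x a2.
by rewrite subrr enorm0 add0r.
Qed.

(** Joint differentiability makes the derivative linear in the direction, so the time derivative and
    the drift sum merge into one derivative. Later estimates use the equations only in this form. *)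
Lemma transport_is_derive T mu0 lam a mu x t :
  transport_solution f l T mu0 lam a mu -> 0 < t < T ->
  is_derive (x, t) (- f x (a x t), 1 : R) (fun z : state * R => mu z.1 z.2)
    (source x (a x t) (lam x t)).
Proof.
move=> Hmu tT; pose M (z : state * R) := mu z.1 z.2.
have [dM _] := transport_C1 Hmu (tT : [set z : state * R | 0 < z.2 < T] (x, t)).
apply: is_derive_row => i.
pose Mi (z : state * R) := M z 0 i.
have dMi : differentiable Mi (x, t) by exact: differentiable_rowP.
apply: (@is_derive_eq _ _ _ _ _ _ _ ('D_((- f x (a x t), 1) : state * R) Mi (x, t))).
  by apply: derivableP; exact: diff_derivable.
have := transport_eq Hmu x tT i; rewrite derive1E => E.
have Et : 'D_1 (fun s => mu x s 0 i) t = 'D_((0, 1) : state * R) Mi (x, t).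
  exact: (derive_partial2 Mi 1 x t).
have Ex (j : 'I_d) : 'D_('e_j) (fun y => mu y t 0 i) x = 'D_(('e_j, 0) : state * R) Mi (x, t).
  exact: (derive_partial1 Mi 'e_j x t).
have Elin : 'D_((- f x (a x t), 1) : state * R) Mi (x, t) =
    'D_((0, 1) : state * R) Mi (x, t) -
    \sum_(j < d) f x (a x t) 0 j * 'D_(('e_j, 0) : state * R) Mi (x, t).
  exact: derive_transport.
rewrite Elin -Et E; under eq_bigr do rewrite Ex.
rewrite -[X in X - _]addrA addrAC subrr add0r /source [RHS]mxE.
congr (_ + _); last by rewrite mxE.
rewrite [RHS]mxE.
apply: eq_bigr => j _; rewrite mulrC; congr (_ * _); rewrite [RHS]mxE.
have -> : 'J (f^~ (a x t)) x i j = row i ('J (f^~ (a x t)) x) 0 j by rewrite [RHS]mxE.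
have -> : row i ('J (f^~ (a x t)) x) = 'D_('e_i) (f^~ (a x t)) x.
  exact: (row_jacobian i (differentiable_f f_C2 x (a x t))).
by rewrite -derive_coord//; apply: diff_derivable; exact: (differentiable_f f_C2).
Qed.

End source_term.


(** * Bounds on the policy and on the iterates, uniform in k *)

Section a_priori_bounds.
Context {R : realType} (d p : nat).
Local Notation state := 'rV[R]_d.
Local Notation control := 'rV[R]_p.
Variables (Cf Cl l0 : R).
Hypothesis Cf_gt0 : 0 < Cf.
Hypothesis Cl_gt0 : 0 < Cl.
Hypothesis l0_gt0 : 0 < l0.

Definition regular_data (f : state -> control -> state) (l : state -> control -> R) :=
  [/\ C2 (fun z : state * control => f z.1 z.2),
      C2 (fun z : state * control => l z.1 z.2),
      assumption_A1 Cf Cl l0 f l & assumption_A2 Cf Cl f l].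

(** [P] is fixed before [f] and [l], hence depends on [M], the structural constants and the
    dimension only. The conclusions are the inputs of [transport_growth] and [transport_lipschitz]
    for the next iterate. *)
Lemma policy_bounds M : 0 <= M -> exists2 P : R, 0 <= P &
  forall f l, regular_data f l -> forall x1 lam1 a1 x2 lam2 a2,
    is_argmax (fun b => - dotv lam1 (f x1 b) - l x1 b) a1 ->
    is_argmax (fun b => - dotv lam2 (f x2 b) - l x2 b) a2 ->
    enorm lam1 <= M * (1 + enorm x1) ->
    enorm (lam1 - lam2) <= M * enorm (x1 - x2) ->
  [/\ enorm (f x1 a1) <= P * (1 + enorm x1),
      enorm (f x1 a1 - f x2 a2) <= P * enorm (x1 - x2),
      enorm (source f l x1 a1 lam1) <= P * (1 + enorm x1) &
      enorm (source f l x1 a1 lam1 - source f l x2 a2 lam2)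
        <= P * enorm (x1 - x2)].
Proof.
(* [A] and [L] are the linear growth and Lipschitz constants in x of the policy, from [argmax_bound]
   and [argmax_lipschitz]; [P1] to [P4] below match the four conclusions, and their sum serves all
   of them. *)
move=> M0; pose A := 1 + Cf * M / l0; pose L := (Cf * M + Cl) / l0.
have Cf0 := ltW Cf_gt0; have Cl0 := ltW Cl_gt0.
have l0V : 0 <= l0^-1 by rewrite invr_ge0 ltW.
have A0 : 0 <= A by do ?[assumption|apply: addr_ge0|apply: mulr_ge0].
have L0 : 0 <= L by do ?[assumption|apply: addr_ge0|apply: mulr_ge0].
pose P1 := Cf * (1 + A); pose P2 := Cf * (1 + L).
pose P3 := Cf * M + Cl * (1 + A).
pose P4 := Cf * M + M * ((2 * d%:R + 4) * Cf) + Cl * (1 + L).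
have P10 : 0 <= P1 by rewrite mulr_ge0// addr_ge0.
have P20 : 0 <= P2 by rewrite mulr_ge0// addr_ge0.
have P30 : 0 <= P3 by do ?[assumption|apply: addr_ge0|apply: mulr_ge0].
have P40 : 0 <= P4 by do ?[assumption|apply: addr_ge0|apply: mulr_ge0].
exists (P1 + P2 + P3 + P4); first by do ?[assumption|apply: addr_ge0].
move=> f l [fC2 lC2 HA1 HA2] x1 lam1 a1 x2 lam2 a2 H1 H2 lamM lamL.
have x0 : 0 <= 1 + enorm x1 by rewrite addr_ge0// enorm_ge0.
have xy0 := enorm_ge0 (x1 - x2).
have aA : enorm a1 <= A * (1 + enorm x1).
  have h := argmax_bound lC2 HA1 H1.
  rewrite -(ler_pM2l l0_gt0) (le_trans h)//.
  have -> : l0 * (A * (1 + enorm x1)) = l0 * (1 + enorm x1) + Cf * (M * (1 + enorm x1)).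
    by rewrite /A; field; rewrite gt_eqF.
  rewrite lerD ?ler_wpM2l// ler_peMr ?(ltW l0_gt0)//.
  by rewrite lerDl enorm_ge0.
have aL : enorm (a1 - a2) <= L * enorm (x1 - x2).
  have h := argmax_lipschitz lC2 HA1 HA2 H1 H2.
  rewrite -(ler_pM2l l0_gt0) (le_trans h)//.
  have -> : l0 * (L * enorm (x1 - x2)) =
      Cf * (M * enorm (x1 - x2)) + Cl * enorm (x1 - x2).
    by rewrite /L; field; rewrite gt_eqF.
  by rewrite lerD2r ler_wpM2l.
have up Q y : 0 <= y -> Q \in [:: P1; P2; P3; P4] ->
    Q * y <= (P1 + P2 + P3 + P4) * y.
  move=> y0; rewrite !inE => HQ; rewrite ler_wpM2r//.
  by case/or4P: HQ => /eqP ->; lra.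
have x1' := enorm_ge0 x1.
split.
- apply: le_trans (up P1 _ x0 _); last by rewrite !inE eqxx.
  rewrite (le_trans (A1_f_growth HA1 _ _))// /P1 -mulrA ler_wpM2l//; lra.
- apply: le_trans (up P2 _ xy0 _); last by rewrite !inE eqxx ?orbT.
  rewrite (le_trans (f_lipschitz fC2 HA1 _ _ _ _))// /P2 -mulrA ler_wpM2l//; lra.
- apply: le_trans (up P3 _ x0 _); last by rewrite !inE eqxx ?orbT.
  rewrite (le_trans (source_growth HA1 _ _ _))// /P3 mulrDl lerD//.
    by rewrite -mulrA ler_wpM2l.
  by rewrite -mulrA ler_wpM2l//; lra.
- apply: le_trans (up P4 _ xy0 _); last by rewrite !inE eqxx ?orbT.
  rewrite (le_trans (source_lipschitz Cf_gt0 fC2 lC2 HA1 HA2 _ _ _ _ M0 lamM))//.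
  have -> : P4 * enorm (x1 - x2) = Cf * (M * enorm (x1 - x2))
      + M * ((2 * d%:R + 4) * Cf * enorm (x1 - x2))
      + Cl * (enorm (x1 - x2) + L * enorm (x1 - x2)) by rewrite /P4; ring.
  by rewrite !lerD// ler_wpM2l// lerD2l.
Qed.

(** Prepared for the difference of two consecutive iterates at one point: the drift difference gets
    the factor [M] because it multiplies the space derivative of the older iterate, of size at most
    [M]. *)
Lemma policy_control_bound M : 0 <= M -> exists2 H : R, 0 <= H &
  forall f l, regular_data f l -> forall x lam1 a1 lam2 a2,
    is_argmax (fun b => - dotv lam1 (f x b) - l x b) a1 ->
    is_argmax (fun b => - dotv lam2 (f x b) - l x b) a2 ->
  M * enorm (f x a1 - f x a2) + enorm (source f l x a1 lam1 - source f l x a2 lam2)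
    <= H * enorm (lam1 - lam2).
Proof.
move=> M0; have Cf0 := ltW Cf_gt0; have Cl0 := ltW Cl_gt0; have l00 := ltW l0_gt0.
exists (M * (Cf * (Cf / l0)) + (Cf + Cl * (Cf / l0))).
  by do ?[assumption|apply: addr_ge0|apply: mulr_ge0]; rewrite invr_ge0.
move=> f l [fC2 lC2 HA1 HA2] x lam1 a1 lam2 a2 H1 H2.
have aL : enorm (a1 - a2) <= Cf / l0 * enorm (lam1 - lam2).
  have h := argmax_lipschitz lC2 HA1 HA2 H1 H2.
  rewrite subrr enorm0 mulr0 addr0 in h.
  rewrite -(ler_pM2l l0_gt0) (le_trans h)//.
  by rewrite mulrA mulrCA divff ?mulr1// gt_eqF.
have h1 := f_lipschitz fC2 HA1 x a1 x a2.
rewrite subrr enorm0 add0r in h1.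
have h2 := source_lipschitz_control fC2 lC2 HA1 HA2 x a1 lam1 a2 lam2.
rewrite mulrDl -!mulrA lerD//.
  by rewrite ler_wpM2l// (le_trans h1)// ler_wpM2l// mulrA.
by rewrite (le_trans h2)// mulrDl lerD2l -!mulrA ler_wpM2l// mulrA.
Qed.

Definition linear_lipschitz_bound (M T : R) (lam : state -> R -> state) :=
  forall t, 0 <= t <= T -> forall x, enorm (lam x t) <= M * (1 + enorm x) /\
    forall y, enorm (lam x t - lam y t) <= M * enorm (x - y).

(** Induction on k with the fixed bound [2 * C0], which gives every step the same [P]. The squared
    bounds start from [2 C0^2] for growth, as [(1 + |x|)^2 <= 2 (1 + |x|^2)], and from [C0^2] for
    the Lipschitz constant; they stay below [(2 C0)^2] up to [T0]. *)
Lemma iterates_bound C0 : 0 < C0 -> exists2 T0 : R, 0 < T0 &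
  forall u0 f l, C2 u0 -> assumption_A0 C0 u0 -> regular_data f l ->
  forall T lam a, 0 < T <= T0 -> policy_iterates u0 f l T lam a ->
  forall k, linear_lipschitz_bound (2 * C0) T (lam k).
Proof.
move=> C00; have C0' := ltW C00.
have [//|P P0 HP] := @policy_bounds (2 * C0); first by rewrite mulr_ge0.
(* [A] is the slope of the squared bounds. While [A T <= 2 C0^2], which defines [T0], both bounds
   stay below [4 C0^2], so this [A] satisfies the slope conditions of both propagation lemmas. *)
pose A := 4 * C0 ^+ 2 * (1 + 4 * P) + 3 * P ^+ 2.
have A0 : 0 < A.
  by rewrite ltr_wpDr ?mulr_ge0 ?sqr_ge0// !mulr_gt0 ?exprn_gt0// ltr_wpDr ?mulr_ge0.
exists (2 * C0 ^+ 2 / A); first by rewrite divr_gt0// mulr_gt0// exprn_gt0.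
move=> u0 f l u0C2 HA0 Hfl T lam a /andP[T0 TT0] Hit.
have AT : A * T <= 2 * C0 ^+ 2 by rewrite mulrC -ler_pdivlMr.
have u0L x y : enorm (grad u0 x - grad u0 y) <= C0 * enorm (x - y).
  apply: enorm_jacobian_le => s _ z; split; last exact: A0_hess HA0 _.
  apply: differentiable_row => i; exact: C2_differentiable_derive.
elim=> [|k IH].
  move=> t tT x; rewrite !(iterates_init Hit)//; split.
    rewrite (le_trans (A0_grad HA0 _))// ler_wpM2r ?addr_ge0 ?enorm_ge0//; lra.
  move=> y; rewrite (iterates_init Hit)// (le_trans (u0L _ _))//.
  rewrite ler_wpM2r ?enorm_ge0//; lra.
have Hmu := iterates_value Hit k.
have Ha := iterates_policy Hit k.
have [fC2 lC2 HA1 HA2] := Hfl.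
have HB x y t : 0 < t < T ->
  [/\ enorm (f x (a k x t)) <= P * (1 + enorm x),
      enorm (f x (a k x t) - f y (a k y t)) <= P * enorm (x - y),
      enorm (source f l x (a k x t) (lam k x t)) <= P * (1 + enorm x) &
      enorm (source f l x (a k x t) (lam k x t) - source f l y (a k y t) (lam k y t))
        <= P * enorm (x - y)].
  move=> /andP[t0 tT]; have tT' : 0 <= t <= T by rewrite !ltW.
  have [h1 h2] := IH t tT' x.
  apply: HP => //; exact: Ha.
have HD x t : 0 < t < T -> is_derive (x, t) (- f x (a k x t), 1 : R)
    (fun z : state * R => lam k.+1 z.1 z.2) (source f l x (a k x t) (lam k x t)).
  by move=> tT; apply: (transport_is_derive fC2 _ Hmu).
have Hc := transport_continuous Hmu.
have bB x t : 0 < t < T -> enorm (f x (a k x t)) <= P * (1 + enorm x).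
  by move=> tT; have [] := HB x x t tT.
have sB x t : 0 < t < T -> enorm (source f l x (a k x t) (lam k x t)) <= P * (1 + enorm x).
  by move=> tT; have [] := HB x x t tT.
have bL x y t : 0 < t < T ->
    enorm (f x (a k x t) - f y (a k y t)) <= P * enorm (x - y).
  by move=> tT; have [] := HB x y t tT.
have sL x y t : 0 < t < T ->
  enorm (source f l x (a k x t) (lam k x t) - source f l y (a k y t) (lam k y t))
        <= P * enorm (x - y).
  by move=> tT; have [] := HB x y t tT.
have C02 : 0 <= C0 ^+ 2 by rewrite sqr_ge0.
have P2 := sqr_ge0 P.
have C0P : 0 <= C0 ^+ 2 * P by rewrite mulr_ge0.
have ATP : A * T * P <= 2 * C0 ^+ 2 * P by rewrite ler_wpM2r.
have G1 := @transport_growth _ _ (lam k.+1) (fun x t => f x (a k x t)) _ T P T0 P0 Hc HD bB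
  (2 * C0 ^+ 2) A P.
have G2 := @transport_lipschitz _ _ (lam k.+1) (fun x t => f x (a k x t)) _ T P T0 P0 Hc HD bB
  (C0 ^+ 2) A P P.
move=> t tT x; have [t0 tT'] := andP tT.
have At : A * t <= A * T by rewrite ler_wpM2l// ltW.
split.
  have x0 := enorm_ge0 x.
  rewrite ler_sqr_enorm ?mulr_ge0 ?addr_ge0//.
  apply: (le_trans (G1 _ (ltW A0) P0 sB _ _ x t tT)).
  - by rewrite mulr_ge0.
  - move=> y; rewrite (transport_init Hmu).
    apply: (@le_trans _ _ ((C0 * (1 + enorm y)) ^+ 2)).
      rewrite -ler_sqr_enorm ?(A0_grad HA0)//.
      by rewrite mulr_ge0// addr_ge0// enorm_ge0.
    rewrite exprMn [2 * _]mulrC -[leRHS]mulrA ler_wpM2l//.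
    have := sqr_ge0 (enorm y - 1); lra.
  - rewrite /A; rewrite -/A; move: ATP AT; rewrite /A; nra.
  - rewrite !exprMn; apply: ler_pM.
    + by rewrite addr_ge0 ?mulr_ge0// ltW.
    + by rewrite addr_ge0// sqr_ge0.
    + lra.
    + by nra.
move=> y; rewrite ler_sqr_enorm ?mulr_ge0 ?enorm_ge0//.
apply: (le_trans (G2 _ (ltW A0) bL sL _ P0 P0 _ x y t tT)) => //.
- move=> z z'; rewrite !(transport_init Hmu) -exprMn -ler_sqr_enorm ?u0L//.
  by rewrite mulr_ge0// enorm_ge0.
- move: ATP AT; rewrite /A; nra.
- rewrite exprMn ler_wpM2r ?sqr_ge0// exprMn; lra.
Qed.

End a_priori_bounds.


(** * Lebesgue measure on R^n *)

Section measure_on_tuples.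
Context {R : realType}.
Local Notation leb := (@lebesgue_measure R).

(** The topology lives on rows, the product sigma-algebra on tuples. An open set is the countable
    union of the boxes with rational centre and radius that it contains, and a box is measurable
    coordinate by coordinate. *)
Lemma open_rV_of_tuple n (U : set 'rV[R]_n) :
  open U -> measurable (@rV_of_tuple R n @^-1` U).
Proof.
move=> oU.
pose D := ('rV[rat]_n * rat)%type.
pose B (c : D) := [set t : n.-tuple R |
  forall i, tnth t i \in `]ratr (c.1 0 i) - ratr c.2, ratr (c.1 0 i) + ratr c.2[].
pose F (c : D) := if `[< B c `<=` @rV_of_tuple R n @^-1` U >] then B c else set0.
have -> : @rV_of_tuple R n @^-1` U = \bigcup_(c in setT) F c.
  rewrite eqEsubset; split => [t Ut|t [c _]]; last first.
    by rewrite /F; case: asboolP => // H Bt; exact: H.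
  have [e /= e0 He] : exists2 e : R, 0 < e & ball (rV_of_tuple t) e `<=` U.
    by apply/nbhs_ballP; move: oU => /(_ _ Ut); rewrite nbhs_nearE.
  (* The centre is chosen within [r] of [t], so the box of radius [r] stays within [2 r < e] of
     [t]. *)
  have [|r] := @rat_in_itvoo R 0 (e / 2); first by rewrite divr_gt0.
  rewrite in_itv/= => /andP[r0 re].
  have /choice[c Hc] : forall i : 'I_n, exists c : rat,
      ratr c \in `](tnth t i - ratr r), (tnth t i + ratr r)[.
    by move=> i; apply: rat_in_itvoo; lra.
  have Bt : B (\row_i c i, r) t.
    move=> i; have := Hc i; rewrite !in_itv/= mxE; lra.
  exists (\row_i c i, r) => //; rewrite /F asboolT// => s Bs; apply: He.
  rewrite -ball_normE/=.
  rewrite [ltLHS]/Num.Def.normr/= mx_normrE (bigmax_lt _ e0)//= => -[i j] _.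
  rewrite !mxE /=.
  have := Bs j; have := Bt j; rewrite !in_itv/= mxE ltr_norml; lra.
apply: countable_bigcupT_measurable; first exact: countableP.
move=> c; rewrite /F; case: ifP => // _.
have -> : B c = \bigcap_(i in setT) ((@tnth _ R ^~ i) @^-1`
   `]ratr (c.1 0 i) - ratr c.2, ratr (c.1 0 i) + ratr c.2[).
  by rewrite eqEsubset; split => t /= H i; [move=> _; exact: H|exact: (H i I)].
apply: fin_bigcap_measurable => // i _.
rewrite -[X in measurable X]setTI; apply: measurable_tnth => //.
Qed.

Lemma measurable_rV_of_tuple n (g : 'rV[R]_n -> R) :
  continuous g -> measurable_fun setT (g \o @rV_of_tuple R n).
Proof.
move=> /continuousP cg _; apply: (measurability _ (RGenOpens.measurableE R)) => //.
move=> _ [_ [a [b ->]] <-]; rewrite setTI comp_preimage.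
by apply: open_rV_of_tuple; apply: cg; exact: interval_open.
Qed.

(** Uniqueness of Lebesgue measure: the translated measure agrees with it on half-open intervals. *)
Lemma lebesgue_measure_translation (c : R) (A : set R) : measurable A ->
  leb ((fun x => x + c) @^-1` A) = leb A.
Proof.
move=> mA.
have mf : @measurable_fun _ _ (measurableTypeR R) (measurableTypeR R) setT
    (fun x : R => x + c).
  by apply: measurable_funD => //; exact: measurable_id.
pose nu := measure_function_pushforward__canonical__measure_function_Measure leb mf.
suff H : forall X, ocitv X -> leb X = nu X.
  have E := @lebesgue_measure_unique R nu H A mA.
  exact: (esym E).
move=> X [[a b]] /= _ <-.
rewrite /nu/= /pushforward/=.
have -> : (fun x => x + c) @^-1` `]a, b] = `](a - c), (b - c)]%classic.
  apply/seteqP; split => x /=; rewrite !in_itv/=; lra.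
rewrite !lebesgue_measure_itv/= !lte_fin ltrD2r.
by case: ifP => // _; rewrite -!EFinB; congr EFin; lra.
Qed.

Definition shift_tuple n (v : 'rV[R]_n) (t : n.-tuple R) : n.-tuple R :=
  [tuple tnth t i + v 0 i | i < n].

Lemma measurable_shift_tuple n (v : 'rV[R]_n) : measurable_fun setT (shift_tuple v).
Proof.
apply/measurable_fun_tnthP => i.
rewrite (_ : _ \o _ = fun t => tnth t i + v 0 i).
  by apply: measurable_funD => //; exact: measurable_tnth.
by apply/funext => t; rewrite /= tnth_mktuple.
Qed.

(** Induction on the dimension. The product measure integrates the lengths of sections: the added
    coordinate is translated inside each section by the one-dimensional case, the remaining ones in
    the outer integral by the induction hypothesis. *)
Lemma lebesgue_measure_n_translation n (v : 'rV[R]_n) (A : set (n.-tuple R)) :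
  measurable A ->
  lebesgue_measure_n n (shift_tuple v @^-1` A) = lebesgue_measure_n n A.
Proof.
elim: n v A => [|n IH] v A mA.
  by rewrite (_ : shift_tuple v @^-1` A = A)//; apply/seteqP; split => t /=;
     rewrite (tuple0 (shift_tuple v t)) (tuple0 t).
rewrite /= /pushforward /= /product_measure1 /=.
pose w := \row_(i < n) v 0 (lift ord0 i).
pose h (z : n.-tuple R) := leb (xsection (@cons_pair R n @^-1` A) z).
have mA' : measurable (@cons_pair R n @^-1` A).
  by rewrite -[X in measurable X]setTI; exact: measurable_cons_pair.
have mh : measurable_fun [set: n.-tuple R] h by exact: measurable_fun_xsection.
transitivity (\int[lebesgue_measure_n n]_z h (shift_tuple w z))%E.
  apply: eq_integral => z _.
  have mX : measurable (xsection (@cons_pair R n @^-1` A) (shift_tuple w z)).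
    exact: measurable_xsection.
  rewrite /h -[RHS](lebesgue_measure_translation (v 0 ord0) mX).
  have E x : cons_pair (shift_tuple w z, x + v 0 ord0) = shift_tuple v (cons_pair (z, x)).
    apply: eq_from_tnth => i; rewrite tnth_mktuple.
    case: (unliftP ord0 i) => [j|] ->; last by rewrite !tnth0.
    by rewrite !tnthS tnth_mktuple mxE.
  by congr (leb _); apply/seteqP; split => x; rewrite /xsection/= !inE/= E.
have mw := measurable_shift_tuple w.
pose nu := measure_function_pushforward__canonical__measure_function_Measure
  (lebesgue_measure_n n) mw.
transitivity (integral nu setT h).
  apply/esym; apply: (ge0_integral_pushforward mw _ measurableT mh).
  by move=> y _; exact: measure_ge0.
apply: eq_measure_integral => B mB _.
exact: IH.
Qed.

End measure_on_tuples.


(** * Integrals of compactly supported continuous functions *)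

Section compact_support_integral.
Context {R : realType} (n : nat).
Local Notation V := 'rV[R]_n.
Local Notation mu := (@lebesgue_measure_n R n).

Definition Cc (r : R) (g : V -> R) : Prop :=
  continuous g /\ forall x, r < enorm x -> g x = 0.

(** A real number, hence a default value when the integral is not finite; linearity and comparison
    are therefore stated for functions in [Cc]. *)
Definition Int (g : V -> R) : R := (\int[mu]_z g (rV_of_tuple z))%R.

Definition box m (r : R) : set (m.-tuple R) := [set t | forall i, tnth t i \in `[- r, r]].

Lemma measurable_box m r : measurable (@box m r).
Proof.
have -> : @box m r = \bigcap_(i in setT) ((@tnth _ R ^~ i) @^-1` `[- r, r]).
  by rewrite eqEsubset; split => t /= H i; [move=> _; exact: H|exact: (H i I)].
apply: fin_bigcap_measurable => // i _.
by rewrite -[X in measurable X]setTI; apply: measurable_tnth.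
Qed.

Lemma box_fin m r : (lebesgue_measure_n m (@box m r) < +oo)%E.
Proof.
elim: m => [|m IH]; first by rewrite /= diracE; case: (_ \in _); rewrite ltry.
rewrite /= /pushforward.
have -> : @cons_pair R m @^-1` box r = box r `*` `[- r, r].
  apply/seteqP; split => -[z x] /= H.
    by split => [i|]; [have := H (lift ord0 i); rewrite tnthS|have := H ord0; rewrite tnth0].
  move=> i; case: (unliftP ord0 i) => [j|] ->; [rewrite tnthS|rewrite tnth0].
    exact: H.1.
  exact: H.2.
rewrite product_measure1E//; last exact: measurable_box.
rewrite lte_mul_pinfty// ?ge0_fin_numE//.
have : (@lebesgue_measure R `[(- r)%R, r]%classic < +oo)%E.
  by rewrite lebesgue_measure_itv/=; case: ifP => _; rewrite ltry.
exact.
Qed.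

Lemma Cc_continuous r g : Cc r g -> continuous g. Proof. by case. Qed.

Lemma continuous_bounded_on (U : topologicalType) (A : set U) (g : U -> R) :
  compact A -> {within A, continuous g} ->
  exists2 K, 0 <= K & forall x, A x -> `|g x| <= K.
Proof.
move=> cA cg.
have [A0|A0] := pselect (A !=set0); last first.
  by exists 0 => // x Ax; exfalso; apply: A0; exists x.
have [c cr Hc] := compact_EVT_max A0 cA (continuous_within_comp cg (@norm_continuous _ _)).
by exists `|g c| => // x Ax; apply: Hc; rewrite inE.
Qed.

Lemma Cc_bounded r g : Cc r g -> exists2 K, 0 <= K & forall x, `|g x| <= K.
Proof.
move=> [cg sg].
have [K K0 HK] := continuous_bounded_on (@compact_enorm_le R n r) (continuous_subspaceT cg).
exists K => // x; have [xr|xr] := leP (enorm x) r; first exact: HK.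
by rewrite sg// normr0.
Qed.

Lemma outside_box r z : ~ box r z -> r < enorm (@rV_of_tuple R n z).
Proof.
move=> Hz; rewrite ltNge; apply/negP => zr; apply: Hz => i.
rewrite in_itv/= -ler_norml (le_trans _ zr)//.
by have := normr_coord (rV_of_tuple z) 0 i; rewrite mxE.
Qed.

Lemma integrable_box r (K : R) : mu.-integrable setT (EFin \o (cst K \_ (box r))).
Proof.
rewrite (_ : EFin \o _ = (EFin \o cst K) \_ (box r)); last first.
  by apply/funext => z /=; rewrite !patchE; case: ifP.
apply: (proj1 (integrable_mkcond (EFin \o cst K) (measurable_box r))).
apply: measurable_bounded_integrable => //.
- exact: measurable_box.
- exact: box_fin.
- exists `|K|; split; first exact: num_real.
  by move=> y Ky z _ /=; exact: ltW.
Qed.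

Lemma Cc_integrable r g : Cc r g -> mu.-integrable setT (EFin \o (g \o @rV_of_tuple R n)).
Proof.
move=> Hg; have [K K0 gK] := Cc_bounded Hg.
apply: (le_integrable _ _ _ (integrable_box r K)) => //.
  by apply/measurable_EFinP; apply: measurable_rV_of_tuple; exact: Cc_continuous Hg.
move=> z _; rewrite lee_fin/= patchE; case: ifPn => [_|].
  by rewrite (le_trans (gK _))// ler_norm.
by move/negP; rewrite inE => /outside_box /Hg.2 ->; rewrite !normr0.
Qed.

Lemma Int_ge0 g : (forall x, 0 <= g x) -> 0 <= Int g.
Proof. by move=> g0; apply: Rintegral_ge0. Qed.

Lemma le_Int r g h : Cc r g -> Cc r h -> (forall x, g x <= h x) -> Int g <= Int h.
Proof.
by move=> Hg Hh gh; apply: le_Rintegral => //;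
  [exact: Cc_integrable Hg|exact: Cc_integrable Hh].
Qed.

Lemma IntD r g h : Cc r g -> Cc r h -> Int (fun x => g x + h x) = Int g + Int h.
Proof.
by move=> Hg Hh; apply: RintegralD => //;
  [exact: Cc_integrable Hg|exact: Cc_integrable Hh].
Qed.

Lemma IntZ r c g : Cc r g -> Int (fun x => c * g x) = c * Int g.
Proof. by move=> Hg; apply: RintegralZl => //; exact: Cc_integrable Hg. Qed.

Lemma CcD r g h : Cc r g -> Cc r h -> Cc r (fun x => g x + h x).
Proof.
move=> [cg sg] [ch sh]; split => [x|x xr]; last by rewrite sg// sh// addr0.
exact: (continuousD (cg x) (ch x)).
Qed.

Lemma CcZ r c g : Cc r g -> Cc r (fun x => c * g x).
Proof.
move=> [cg sg]; split => [x|x xr]; last by rewrite sg// mulr0.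
have cc : {for x, continuous (fun _ : V => c)} by exact: cst_continuous.
exact: (continuousM cc (cg x)).
Qed.

Lemma CcM r (b g : V -> R) : continuous b -> Cc r g -> Cc r (fun x => b x * g x).
Proof.
move=> cb [cg sg]; split => [x|x xr]; last by rewrite sg// mulr0.
exact: (continuousM (cb x) (cg x)).
Qed.

Lemma Cc0 r : Cc r (fun=> 0).
Proof. by split => // x; exact: cst_continuous. Qed.

Lemma Cc_sum r I (s : seq I) (g : I -> V -> R) :
  (forall i, Cc r (g i)) -> Cc r (fun x => \sum_(i <- s) g i x).
Proof.
move=> Hg; elim: s => [|i s IH].
  by under eq_fun do rewrite big_nil; exact: Cc0.
by under eq_fun do rewrite big_cons; exact: CcD.
Qed.

Lemma Int_sum r I (s : seq I) (g : I -> V -> R) : (forall i, Cc r (g i)) ->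
  Int (fun x => \sum_(i <- s) g i x) = \sum_(i <- s) Int (g i).
Proof.
move=> Hg; elim: s => [|i s IH].
  rewrite big_nil; under eq_fun do rewrite big_nil.
  rewrite -[RHS](mul0r (Int (fun=> 0))) -(IntZ 0 (Cc0 r)).
  by congr Int; apply/funext => x; rewrite mulr0.
rewrite big_cons -IH; under eq_fun do rewrite big_cons.
by apply: IntD; [exact: Hg|exact: Cc_sum].
Qed.

Lemma rV_of_shift_tuple (v : V) z :
  rV_of_tuple (shift_tuple v z) = rV_of_tuple z + v.
Proof. by apply/rowP => i; rewrite !mxE tnth_mktuple. Qed.

Lemma Int_translation r g (v : V) : Cc r g -> Int (fun x => g (x + v)) = Int g.
Proof.
move=> Hg; congr fine.
have ms := measurable_shift_tuple v.
have mg : measurable_fun setT (EFin \o (g \o @rV_of_tuple R n)).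
  by apply/measurable_EFinP; apply: measurable_rV_of_tuple; exact: Cc_continuous Hg.
pose nu := measure_function_pushforward__canonical__measure_function_Measure mu ms.
transitivity (integral nu setT (EFin \o (g \o @rV_of_tuple R n))); last first.
  by apply: eq_measure_integral => A mA _; exact: lebesgue_measure_n_translation.
rewrite [RHS](integral_pushforward ms mg _ measurableT).
  by apply: eq_integral => z _ /=; rewrite rV_of_shift_tuple.
rewrite (_ : _ \o shift_tuple v = EFin \o ((fun x => g (x + v)) \o @rV_of_tuple R n)).
  apply: (@Cc_integrable (r + enorm v)); split => [x|x xr].
    have cv : {for x, continuous (fun y : V => y + v)}.
      have c1 : {for x, continuous (fun=> v : V)} by exact: cst_continuous.
      exact: (continuousD (@cvg_id _ (nbhs x)) c1).
    exact: (@continuous_comp _ _ _ (fun y : V => y + v) g x cv (Hg.1 (x + v))).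
  apply: Hg.2; have := ler_enormB (x + v) v; rewrite addrK; lra.
by apply/funext => z /=; rewrite rV_of_shift_tuple.
Qed.

(** Differentiation under the integral sign, dominated by the constant [K] on a box. That [D]
    vanishes off the ball follows from [phi] vanishing there for all nearby parameters. *)
Lemma is_derive_Int (r u v K : R) (phi D : R -> V -> R) a :
  u < a < v ->
  (forall s, u < s < v -> Cc r (phi s)) ->
  (forall s x, u < s < v -> is_derive (s : R) (1 : R) (phi^~ x) (D s x)) ->
  (forall s x, u < s < v -> `|D s x| <= K) ->
  is_derive a (1 : R) (fun s => Int (phi s)) (Int (D a)).
Proof.
move=> auv HC HD DK.
have K0 : 0 <= K by rewrite (le_trans _ (DK a 0 auv)).
have D0 s x : u < s < v -> r < enorm x -> D s x = 0.
  move=> suv xr; have := HD s x suv => -[_ <-].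
  rewrite -(derive_cst (0 : R) s (1 : R)).
  apply: near_eq_derive.
  have : s \in `]u, v[ by rewrite in_itv.
  move=> /near_in_itvoo; apply: filterS => t; rewrite in_itv/= => tuv.
  by have [_ ->] := HC t tuv.
have dE s x : u < s < v -> partial1of2 phi s x = D s x.
  move=> suv; by rewrite partial1of2E; case: (HD s x suv).
pose f (s : R) (z : n.-tuple R) := phi s (rV_of_tuple z).
pose G (z : n.-tuple R) := (cst K \_ (@box n r)) z.
have H1 : [set` `]u, v[] a by rewrite /= in_itv.
have H2 s : [set` `]u, v[] s -> mu.-integrable setT (EFin \o f s).
  by rewrite /= in_itv/= => /HC; exact: Cc_integrable.
have H3 s y : [set` `]u, v[] s -> [set: n.-tuple R] y -> derivable (f^~ y) s 1.
  by rewrite /= in_itv/= => suv _; have [] := HD s (rV_of_tuple y) suv.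
have H4 y : 0 <= G y by rewrite /G patchE; case: ifP.
have H5 s y : [set` `]u, v[] s -> [set: n.-tuple R] y -> `|partial1of2 f s y| <= G y.
  rewrite /= in_itv/= => suv _.
  rewrite (_ : partial1of2 f s y = D s (rV_of_tuple y)); last exact: dE.
  rewrite /G patchE; case: ifPn => [_|]; first exact: DK.
  by move/negP; rewrite inE => /outside_box yr; rewrite D0// normr0.
split.
  exact: (derivable_under_integral measurableT H1 H2 H3 H4 (integrable_box r K) H5).
rewrite -derive1E.
rewrite (differentiation_under_integral measurableT H1 H2 H3 H4 (integrable_box r K) H5).
apply: eq_Rintegral => z _.
exact: dE.
Qed.

Lemma continuous_Int (r : R) (phi : R * V -> R) : continuous phi ->
  (forall s x, r < enorm x -> phi (s, x) = 0) ->
  continuous (fun s => Int (fun x => phi (s, x))).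
Proof.
move=> cphi sphi s.
have HC t : Cc r (fun x => phi (t, x)).
  split; last exact: sphi.
  move=> x; apply: (@continuous_comp _ _ _ (fun x => (t, x)) phi); last exact: cphi.
  have h1 : {for x, continuous (fun _ : V => t)} by exact: cst_continuous.
  exact: (cvg_pair h1 (@cvg_id _ (nbhs x))).
have [K K0 HK] : exists2 K, 0 <= K & forall t x, s - 1 <= t <= s + 1 -> `|phi (t, x)| <= K.
  have cA : compact (`[s - 1, s + 1] `*` [set x : V | enorm x <= r]).
    by apply: compact_setX; [exact: segment_compact|exact: compact_enorm_le].
  have [K K0 HK] := continuous_bounded_on cA (continuous_subspaceT cphi).
  exists K => // t x ts; have [xr|xr] := leP (enorm x) r.
    by apply: HK; split => //=; rewrite in_itv.
  by rewrite sphi// normr0.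
apply: (@continuity_under_integral _ _ _ mu (fun t z => phi (t, rV_of_tuple z)) _
  measurableT (s - 1) (s + 1) _ _ _ (integrable_box r K)).
- by move=> t _; exact: (Cc_integrable (HC t)).
- apply: aeW => z _ t _.
  apply: (@continuous_comp _ _ _ (fun t => (t, rV_of_tuple z)) phi); last exact: cphi.
  have h1 : {for t, continuous (fun _ : R => @rV_of_tuple R n z)}.
    exact: cst_continuous.
  exact: (cvg_pair (@cvg_id _ (nbhs t)) h1).
- move=> t; rewrite /= in_itv/= => /andP[t1 t2]; apply: aeW => z _.
  rewrite patchE; case: ifPn => [_|]; first by apply: HK; rewrite !ltW.
  by move/negP; rewrite inE => /outside_box yr; rewrite sphi// normr0.
- by rewrite inE/= in_itv/=; lra.
Qed.

End compact_support_integral.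


(** * Energy estimates *)

Section exponential_weight.
Context {R : realType}.
Local Notation leb := (@lebesgue_measure R).

Lemma continuous_integrable_itv (h : R -> R) a b : continuous h ->
  leb.-integrable `[a, b] (EFin \o h).
Proof.
move=> ch; apply: continuous_compact_integrable; first exact: segment_compact.
exact: continuous_subspaceT.
Qed.

(** Integrated form of [(e^{- gamma t} E)' <= e^{- gamma t} ((k - gamma) E + c P)]; the boundary
    term vanishes at 0 and has a favourable sign at [T]. *)
Lemma weighted_gronwall (E P dE : R -> R) (T k c gamma : R) :
  0 < T -> continuous E -> continuous P ->
  (forall t, 0 < t < T -> is_derive (t : R) (1 : R) E (dE t)) ->
  (forall t, 0 < t < T -> dE t <= k * E t + c * P t) ->
  E 0 = 0 -> 0 <= E T ->
  (gamma - k) * (\int[leb]_(t in `[0, T]) (expR (- gamma * t) * E t))%R <=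
  c * (\int[leb]_(t in `[0, T]) (expR (- gamma * t) * P t))%R.
Proof.
move=> T0 cE cP dEE dEle E0 ET.
pose w t := expR (- gamma * t).
have wD t : is_derive (t : R) (1 : R) w (- gamma * w t).
  have H1 : is_derive (t : R) (1 : R) (fun s => - gamma * s) (- gamma).
    have := @is_deriveZ _ _ _ id (- gamma) t 1 _ (is_derive_id t 1).
    by move/is_derive_eq; apply; rewrite [_ *: _]mulr1.
  have := is_derive_comp1 (is_derive_expR (- gamma * t)) H1.
  by move/is_derive_eq; apply; rewrite mulrC.
have cw : continuous w by move=> t; exact: (is_derive_continuous1 (wD t)).
have cwE : continuous (fun t => w t * E t) by move=> t; exact: (continuousM (cw t) (cE t)).
have cwP : continuous (fun t => w t * P t) by move=> t; exact: (continuousM (cw t) (cP t)).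
pose h t := (gamma - k) * (w t * E t) - c * (w t * P t).
have ch : continuous h.
  have cc (x : R) t : {for t, continuous (fun _ : R => x)} by exact: cst_continuous.
  move=> t; exact: (continuousB (continuousM (cc _ _) (cwE t)) (continuousM (cc _ _) (cwP t))).
pose H x := (\int[leb]_(t in `[0, x]) h t)%R.
have HD t : 0 < t < T -> is_derive (t : R) (1 : R) H (h t).
  move=> /andP[t0 tT].
  have [H1 H2] := @continuous_FTC1_closed _ h 0 t T tT
    (continuous_integrable_itv _ _ ch) t0 (ch t).
  by split => //; rewrite -derive1E.
have cH : {within `[0, T], continuous H}.
  exact: (parameterized_integral_continuous (ltW T0) (continuous_integrable_itv _ _ ch)).
(* Monotonicity of [J] replaces the integration of [dE], about which no integrability is assumed. *)
pose J t := w t * E t + H t.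
have JD t : 0 < t < T -> is_derive (t : R) (1 : R) J
    (w t * (dE t - k * E t - c * P t)).
  move=> tT.
  have := is_deriveD (is_deriveM (wD t) (dEE t tT)) (HD t tT).
  by move/is_derive_eq; apply; rewrite /h /= ![_ *: _]mulrC/=; ring.
have cJ : {within `[0, T], continuous J}.
  by move=> t; apply: cvgD; [exact: (continuous_subspaceT cwE)|exact: cH].
have JTle : J T <= J 0.
  apply: (@ler0_derive1_le_cc _ J 0 T) => //; rewrite ?in_itv/= ?lexx ?ltW//.
  - by move=> t; rewrite in_itv/= => /JD[].
  - move=> t; rewrite in_itv/= => tT; rewrite derive1E.
    have [_ ->] := JD t tT; rewrite pmulr_rle0 ?expR_gt0//.
    by have := dEle t tT; lra.
have H0 : H 0 = 0 by rewrite /H set_itv1 Rintegral_set1.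
have HT : H T <= 0.
  move: JTle; rewrite /J H0 E0 mulr0 addr0.
  have : 0 <= w T * E T by rewrite mulr_ge0// expR_ge0.
  lra.
have iE := continuous_integrable_itv 0 T cwE.
have iP := continuous_integrable_itv 0 T cwP.
have cc (x : R) t : {for t, continuous (fun _ : R => x)} by exact: cst_continuous.
have iE' : leb.-integrable `[0, T] (EFin \o (fun t => (gamma - k) * (w t * E t))).
  by apply: continuous_integrable_itv => t; exact: (continuousM (cc _ _) (cwE t)).
have iP' : leb.-integrable `[0, T] (EFin \o (fun t => c * (w t * P t))).
  by apply: continuous_integrable_itv => t; exact: (continuousM (cc _ _) (cwP t)).
rewrite -subr_le0; apply: le_trans HT.
by rewrite /H /h RintegralB// !RintegralZl.
Qed.

End exponential_weight.

(** * Energy inequality for transport by a Lipschitz drift *)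

Section transport_energy.
Context {R : realType} (n : nat).
Local Notation V := 'rV[R]_n.

Lemma is_derive_outside (r : R) (g : V -> R) x v dg :
  (forall y, r < enorm y -> g y = 0) -> r < enorm x -> is_derive x v g dg -> dg = 0.
Proof.
move=> sg xr [_ <-]; rewrite -(derive_cst (0 : R) x v).
apply: near_eq_derive.
have : \forall y \near x, r < enorm y.
  exact: (cvgr_gt _ (@continuous_enorm R n x)).
by apply: filterS => y /sg ->.
Qed.

(* Replaces an integration by parts: as [b] is only Lipschitz, the difference
   quotients of [g] are moved onto [b] by translation invariance. *)
Lemma Int_transport (r L : R) (b g dg : V -> R) (v : V) :
  Cc r g -> (forall x, 0 <= g x) -> continuous b ->
  (forall x (h : R), `|b (x + h *: v) - b x| <= L * `|h|) ->
  continuous dg -> (forall x, is_derive x v g (dg x)) ->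
  Int (fun x => b x * dg x) <= L * Int g.
Proof.
move=> Hg g0 cb bL cdg gD.
have Hdg : Cc r dg.
  split=> // x xr; exact: (is_derive_outside Hg.2 xr (gD x)).
pose phi (s : R) (x : V) := b x * g (s *: v + x).
pose D (s : R) (x : V) := b x * dg (s *: v + x).
pose F s := Int (phi s).
have csv (s : R) : continuous (fun x : V => s *: v + x).
  move=> x; have c1 : {for x, continuous (fun _ : V => s *: v)} by exact: cst_continuous.
  exact: (continuousD c1 (@cvg_id _ (nbhs x))).
(* One radius for the supports of all shifts with [|s| < 1]. *)
pose r' := r + enorm v.
have Cshift s (k : V -> R) : -1 < s < 1 -> Cc r k -> Cc r' (fun x => k (s *: v + x)).
  move=> s1 [ck sk]; split => [x|x xr].
    exact: (@continuous_comp _ _ _ (fun x : V => s *: v + x) k x (csv s x) (ck _)).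
  apply: sk; have h1 := ler_enormB (s *: v + x) (s *: v).
  rewrite addrC addKr enormZ in h1.
  have h2 : `|s| * enorm v <= 1 * enorm v.
    by rewrite ler_wpM2r ?enorm_ge0// ler_norml; lra.
  rewrite /r' in xr; lra.
have [Kb Kb0 HKb] := continuous_bounded_on (@compact_enorm_le R n r') (continuous_subspaceT cb).
have [Kd Kd0 HKd] := Cc_bounded Hdg.
have FD : is_derive (0 : R) (1 : R) F (Int (D 0)).
  apply: (@is_derive_Int _ _ r' (-1) 1 (Kb * Kd)).
  - by rewrite ltrN10 ltr01.
  - by move=> s s1; apply: CcM => //; exact: Cshift.
  - move=> s x s1.
    have H1 : is_derive (s : R) (1 : R) (fun s => g (s *: v + x)) (dg (s *: v + x)).
      exact: is_derive_curve.
    have := is_deriveZ (b x) H1.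
    by apply.
  - move=> s x s1; rewrite /D normrM; have [xr|xr] := leP (enorm x) r'.
      by rewrite ler_pM// ?HKd//; exact: HKb.
    by rewrite (Cshift s dg s1 Hdg).2// normr0 mulr0 mulr_ge0.
have cbh (h : R) : continuous (fun x : V => b (x + (- h) *: v)).
  move=> x; have c1 : {for x, continuous (fun y : V => y + (- h) *: v)}.
    have c2 : {for x, continuous (fun=> (- h) *: v : V)} by exact: cst_continuous.
    exact: (continuousD (@cvg_id _ (nbhs x)) c2).
  exact: (@continuous_comp _ _ _ (fun y : V => y + (- h) *: v) b x c1 (cb _)).
have FE (h : R) : -1 < h < 1 -> F h = Int (fun x : V => b (x + (- h) *: v) * g x).
  move=> h1; rewrite -(@Int_translation _ _ r (fun x : V => b (x + (- h) *: v) * g x) (h *: v)).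
    congr Int; apply/funext => x; rewrite /phi [h *: v + x]addrC.
    by rewrite scaleNr addrK.
  exact: CcM.
have : 0 <= L * Int g - Int (D 0).
  have := is_deriveB (is_deriveZ (L * Int g) (is_derive_id (0 : R) (1 : R))) FD.
  move=> /is_derive_left_ge0; rewrite [_ *: _]mulr1; apply.
  near=> h.
  have h0 : h < 0 by near: h; exact: nbhs_left_lt.
  have h1 : -1 < h by near: h; apply: nbhs_left_gt; rewrite ltrN10.
  have hI : -1 < h < 1 by rewrite h1 (lt_trans h0).
  (* Since [g >= 0], this is [b x <= b (x - h v) + L |h|] integrated against [g]; hence
     [L (Int g) h - F h], at times [h < 0], does not exceed its value at 0. *)
  have key : F 0 <= F h + L * (- h) * Int g.
    rewrite FE ?ltrN10 ?ltr01// FE// -(IntZ _ Hg) -(@IntD _ _ r).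
    - apply: (@le_Int _ _ r).
      + exact: CcM.
      + by apply: CcD; [exact: CcM|exact: CcZ].
      move=> x; rewrite -mulrDl ler_wpM2r// oppr0 scale0r addr0.
      have := bL x (- h); rewrite (_ : `|- h| = - h); last by rewrite normrN ltr0_norm.
      by move=> /ler_normlP[+ _]; lra.
    - exact: CcM.
    - exact: CcZ.
  suff : (L * Int g) * h - F h <= (L * Int g) * 0 - F 0 by rewrite !fctE addr0.
  lra.
rewrite subr_ge0 /D; congr (Int _ <= _); apply/funext => x.
by rewrite scale0r add0r.
Unshelve. all: by end_near. Qed.

(** Clamping makes the energy continuous on the whole line, as [weighted_gronwall] asks, without
    changing it on [[0, T]]. *)
Definition clamped_Int (T : R) (phi : V * R -> R) (t : R) : R :=
  Int (fun x => phi (x, clamp T t)).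

Section energy.
Variables (T r L c1 c2 : R) (phi psi : V * R -> R) (b : V -> R -> V).
Hypothesis T_gt0 : 0 < T.
Let strip := [set z : V * R | 0 <= z.2 <= T].
Hypothesis phi_cont : {within strip, continuous phi}.
Hypothesis psi_cont : {within strip, continuous psi}.
Hypothesis phi_C1 : C1_on [set z : V * R | 0 < z.2 < T] phi.
Hypothesis phi_supp : forall x t, 0 <= t <= T -> r < enorm x -> phi (x, t) = 0.
Hypothesis psi_supp : forall x t, 0 <= t <= T -> r < enorm x -> psi (x, t) = 0.
Hypothesis phi_ge0 : forall x t, 0 <= t <= T -> 0 <= phi (x, t).
Hypothesis phi_init : forall x, phi (x, 0) = 0.
Hypothesis b_lip : forall x y t, 0 < t < T -> enorm (b x t - b y t) <= L * enorm (x - y).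
Hypothesis phi_transport : forall x t, 0 < t < T ->
  'D_((- b x t, 1) : V * R) phi (x, t) <= c1 * phi (x, t) + c2 * psi (x, t).

Lemma continuous_clamped_Int (g : V * R -> R) : {within strip, continuous g} ->
  (forall x t, 0 <= t <= T -> r < enorm x -> g (x, t) = 0) ->
  continuous (clamped_Int T g).
Proof.
move=> cg sg.
apply: (@continuous_Int _ _ r (fun z : R * V => g (z.2, clamp T z.1))).
  move=> z; have h1 : {for z, continuous (fun z : R * V => (z.2, z.1))}.
    have h2 : {for z, continuous (fun z : R * V => z.2)} by exact: cvg_snd.
    have h3 : {for z, continuous (fun z : R * V => z.1)} by exact: cvg_fst.
    exact: (cvg_pair h2 h3).
  apply: (@continuous_comp _ _ _ (fun z : R * V => (z.2, z.1))
    (fun z : V * R => g (z.1, clamp T z.2)) z h1).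
  exact: (continuous_within_clamp (ltW T_gt0) cg).
by move=> s x xr; apply: sg => //; exact: (clamp_itv (ltW T_gt0)).
Qed.

Let cx (x : V) (t : R) : {for x, continuous (fun y : V => (y, t))}.
Proof.
have h1 : {for x, continuous (fun _ : V => t)} by exact: cst_continuous.
exact: (cvg_pair (@cvg_id _ (nbhs x)) h1).
Qed.

Let Cc_slice g t : {within strip, continuous g} ->
  (forall x t, 0 <= t <= T -> r < enorm x -> g (x, t) = 0) ->
  0 <= t <= T -> Cc r (fun x => g (x, t)).
Proof.
move=> cg sg tT; split => [|x]; last exact: sg.
apply: (@continuous_comp_within _ _ _ strip g (fun y : V => (y, t)) cg) => //.
by move=> x; exact: cx.
Qed.

Let Cc_derive v t : 0 < t < T -> Cc r (fun x => 'D_((v, 0) : V * R) phi (x, t)).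
Proof.
move=> tT; have tT' : 0 <= t <= T by case/andP: tT => *; rewrite !ltW.
split => [x|x xr].
  have [_ /(_ (v, 0)) H] := phi_C1 (tT : [set z : V * R | 0 < z.2 < T] (x, t)).
  exact: (@continuous_comp _ _ _ (fun y : V => (y, t)) _ x (@cx x t) H).
have [H _] := phi_C1 (tT : [set z : V * R | 0 < z.2 < T] (x, t)).
rewrite -derive_partial1.
apply: (@is_derive_outside r (fun y => phi (y, t)) x v _ _ xr); first by move=> y; exact: phi_supp.
by apply: derivableP; apply: diff_derivable; exact: (differentiable_partial1 H).
Qed.

Let dt (t : R) x := 'D_((0, 1) : V * R) phi (x, t).

Let dt_support t x : 0 < t < T -> r < enorm x -> dt t x = 0.
Proof.
move=> tT xr; rewrite /dt -derive_partial2 -(derive_cst (0 : R) t (1 : R)).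
apply: near_eq_derive.
have : t \in `]0, T[ by rewrite in_itv.
move=> /near_in_itvoo; apply: filterS => s; rewrite in_itv/= => /andP[s0 sT].
by apply: phi_supp => //; rewrite !ltW.
Qed.

Let Cc_dt t : 0 < t < T -> Cc r (dt t).
Proof.
move=> tT; split => [x|x]; last exact: dt_support.
have [_ /(_ (0, 1)) H] := phi_C1 (tT : [set z : V * R | 0 < z.2 < T] (x, t)).
exact: (@continuous_comp _ _ _ (fun y : V => (y, t)) _ x (@cx x t) H).
Qed.

Let clamped_derive t : 0 < t < T ->
  is_derive (t : R) (1 : R) (clamped_Int T phi) (Int (dt t)).
Proof.
move=> /andP[t0 tT].
have H : is_derive (t : R) (1 : R) (fun s => Int (fun x => phi (x, s))) (Int (dt t)).
  (* The time derivative of [phi] may blow up at 0 and at [T]; a compact subinterval around [t]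
     provides the dominating constant. *)
  have sub s : t / 2 <= s <= (t + T) / 2 -> 0 < s < T by lra.
  have cA : compact ([set x : V | enorm x <= r] `*` `[t / 2, (t + T) / 2]).
    by apply: compact_setX; [exact: compact_enorm_le|exact: segment_compact].
  have cD : {within [set x : V | enorm x <= r] `*` `[t / 2, (t + T) / 2],
      continuous ('D_((0, 1) : V * R) phi)}.
    apply: continuous_in_subspaceT => z; rewrite inE => -[_ /=]; rewrite in_itv/=.
    by move=> /sub zT; have [_ /(_ (0, 1))] := phi_C1 (zT : [set z : V * R | 0 < z.2 < T] z).
  have [K K0 HK] := continuous_bounded_on cA cD.
  apply: (@is_derive_Int _ _ r (t / 2) ((t + T) / 2) K (fun s x => phi (x, s)) dt).
  - by lra.
  - move=> s /andP[s1 s2]; apply: Cc_slice => //.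
    have /andP[? ?] : 0 < s < T by apply: sub; rewrite !ltW.
    by rewrite !ltW.
  - move=> s x /andP[s1 s2].
    have sT : 0 < s < T by apply: sub; rewrite !ltW.
    have [Hd _] := phi_C1 (sT : [set z : V * R | 0 < z.2 < T] (x, s)).
    rewrite /dt -derive_partial2; apply: derivableP; apply: diff_derivable.
    exact: (differentiable_partial2 Hd).
  - move=> s x /andP[s1 s2].
    have sT : 0 < s < T by apply: sub; rewrite !ltW.
    have [xr|xr] := leP (enorm x) r; last by rewrite dt_support// normr0.
    by apply: (HK (x, s)); split => //=; rewrite in_itv/= !ltW.
apply: near_eq_is_derive H.
have : t \in `]0, T[ by rewrite in_itv/= t0.
move=> /near_in_itvoo; apply: filterS => s; rewrite in_itv/= => /andP[s0 sT].
by rewrite /clamped_Int clamp_id// !ltW.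
Qed.

(** The time derivative is the derivative along [(- b, 1)] plus the sum of [b_j d_j phi]. Each of
    the [n] coordinates of [b] is [L]-Lipschitz and costs [L] by [Int_transport]; together they
    stand in for a bound on the divergence of [b]. *)
Let dt_le t : 0 < t < T -> Int (dt t) <=
  (c1 + n%:R * L) * clamped_Int T phi t + c2 * clamped_Int T psi t.
Proof.
move=> tT; have tT' : 0 <= t <= T by case/andP: tT => *; rewrite !ltW.
rewrite /clamped_Int !clamp_id//.
have Cphi := Cc_slice phi_cont phi_supp tT'.
have Cpsi := Cc_slice psi_cont psi_supp tT'.
have bjL j x y : `|b x t 0 j - b y t 0 j| <= L * enorm (x - y).
  have := normr_coord (b x t - b y t) 0 j; rewrite !mxE => /le_trans; apply.
  exact: b_lip.
have cb j : continuous (fun x : V => b x t 0 j).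
  suff H (x : V) : b y t 0 j @[y --> x] --> b x t 0 j by [].
  apply/(@cvgrPdist_lt _ _ _ (nbhs x) (nbhs_filter x)) => e e0.
  have L1 : 0 < `|L| + 1 by rewrite ltr_wpDl.
  have ce : {for x, continuous (fun y : V => enorm (x - y))}.
    have cB : {for x, continuous (fun y : V => x - y)}.
      have cC : {for x, continuous (fun=> x : V)} by exact: cst_continuous.
      exact: (continuousB cC (@cvg_id _ (nbhs x))).
    exact: (@continuous_comp _ _ _ (fun y : V => x - y) (@enorm R 1 n) x cB
      (@continuous_enorm R n _)).
  have hx : \forall y \near x, enorm (x - y) < e / (`|L| + 1).
    apply: (cvgr_lt _ ce); rewrite subrr enorm0; exact: divr_gt0.
  apply: (@filterS _ _ (nbhs_filter x) _ _ _ hx) => y; rewrite ltr_pdivlMr// => hy.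
  apply: (le_lt_trans (bjL j x y)); apply: le_lt_trans hy.
  rewrite mulrC ler_wpM2l ?enorm_ge0//; have := ler_norm L; lra.
pose sm x := \sum_(j < n) b x t 0 j * 'D_(('e_j, 0) : V * R) phi (x, t).
have Csm : Cc r sm by apply: Cc_sum => j; apply: CcM => //; exact: Cc_derive.
have smE : Int sm <= n%:R * L * Int (fun x => phi (x, t)).
  rewrite /sm (@Int_sum _ _ r); last by move=> j; apply: CcM => //; exact: Cc_derive.
  apply: (@le_trans _ _ (\sum_(j < n) L * Int (fun x => phi (x, t)))); last first.
    by rewrite sumr_const card_ord -mulrA mulr_natl.
  apply: ler_sum => j _.
  apply: (@Int_transport r L (fun x => b x t 0 j) (fun x => phi (x, t))
    (fun x => 'D_(('e_j, 0) : V * R) phi (x, t)) 'e_j) => //.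
  - by move=> x; exact: phi_ge0.
  - move=> x h; rewrite (le_trans (bjL j _ _))//.
    by rewrite addrC addKr enormZ enorm_delta mulr1.
  - by have [] := Cc_derive 'e_j tT.
  - move=> x; have [Hd _] := phi_C1 (tT : [set z : V * R | 0 < z.2 < T] (x, t)).
    rewrite -derive_partial1; apply: derivableP; apply: diff_derivable.
    exact: (differentiable_partial1 Hd).
apply: (@le_trans _ _ (Int (fun x => (c1 * phi (x, t) + c2 * psi (x, t)) + sm x))).
  apply: (@le_Int _ _ r).
  - exact: Cc_dt.
  - by apply: CcD => //; apply: CcD; exact: CcZ.
  move=> x; have [Hd _] := phi_C1 (tT : [set z : V * R | 0 < z.2 < T] (x, t)).
  apply: le_trans (lerD (phi_transport x tT) (lexx _)).
  by rewrite derive_transport// subrK.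
rewrite (@IntD _ _ r)//; last by apply: CcD; exact: CcZ.
rewrite (@IntD _ _ r) ?(IntZ _ Cphi) ?(IntZ _ Cpsi)//; last 2 first.
- exact: CcZ.
- exact: CcZ.
lra.
Qed.

Lemma transport_energy gamma :
  (gamma - (c1 + n%:R * L)) *
    (\int[@lebesgue_measure R]_(t in `[0, T]) (expR (- gamma * t) * clamped_Int T phi t))%R
  <= c2 * (\int[@lebesgue_measure R]_(t in `[0, T])
             (expR (- gamma * t) * clamped_Int T psi t))%R.
Proof.
apply: (@weighted_gronwall _ (clamped_Int T phi) (clamped_Int T psi)
  (fun t => Int (dt t))) => //.
- exact: continuous_clamped_Int.
- exact: continuous_clamped_Int.
- rewrite /clamped_Int clamp_id ?lexx ?ltW//.
  under eq_fun do rewrite phi_init.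
  by have := @IntZ _ n r 0 _ (Cc0 n r); under eq_fun do rewrite mul0r; rewrite mul0r.
- by apply: Int_ge0 => x; apply: phi_ge0; exact: (clamp_itv (ltW T_gt0)).
Qed.

End energy.

End transport_energy.


(** * Continuously differentiable functions and the truncated weight *)

Section C1_closure.
Context {R : realType} (V : normedModType R) (A : set V).
Hypothesis oA : open A.

(** [C1_on] asks for continuity of ['D_v g] as a function on the whole space, so the derivative
    formulas are needed on a neighbourhood, which exists because [A] is open. *)
Lemma continuous_near_eq (U W : topologicalType) (F G : U -> W) x :
  (\forall y \near x, F y = G y) -> {for x, continuous G} -> {for x, continuous F}.
Proof.
move=> FG cG; have E : F x = G x by exact: (nbhs_singleton FG).
suff H : F y @[y --> x] --> G x by move: H; rewrite -E.
by apply: cvg_trans cG; apply: near_eq_cvg; apply: filterS FG => y ->.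
Qed.

Let nearA z : A z -> \forall y \near z, A y.
Proof. by move=> Az; move: oA; rewrite openE => /(_ _ Az). Qed.

Lemma C1_on_comp1 (h h' : R -> R) (g : V -> R) : C1_on A g ->
  (forall z, A z -> is_derive (g z) (1 : R) h (h' (g z))) ->
  (forall z, A z -> {for g z, continuous h'}) -> C1_on A (h \o g).
Proof.
move=> Hg hD ch' z Az; have [dg cdg] := Hg z Az; split.
  apply: differentiable_comp => //; apply/derivable1_diffP.
  by have [] := hD z Az.
move=> v; apply: (@continuous_near_eq _ _ _ (fun y => h' (g y) * 'D_v g y)).
  apply: filterS (nearA Az) => y Ay; have [dgy _] := Hg y Ay.
  by have [_ ->] := is_derive_comp1 (hD y Ay) (derivableP (diff_derivable (v := v) dgy)).
apply: continuousM; last exact: cdg.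
by apply: continuous_comp; [exact: differentiable_continuous|exact: ch'].
Qed.

Lemma C1_onM (f g : V -> R) : C1_on A f -> C1_on A g ->
  C1_on A (fun x => f x * g x).
Proof.
move=> Hf Hg z Az; have [df cdf] := Hf z Az; have [dg cdg] := Hg z Az; split.
  exact: differentiableM.
move=> v; apply: (@continuous_near_eq _ _ _ (fun y => f y * 'D_v g y + g y * 'D_v f y)).
  apply: filterS (nearA Az) => y Ay; have [dfy _] := Hf y Ay; have [dgy _] := Hg y Ay.
  exact: (deriveM (diff_derivable (v := v) dfy) (diff_derivable (v := v) dgy)).
have cf := differentiable_continuous df; have cg := differentiable_continuous dg.
exact: (continuousD (continuousM cf (cdg v)) (continuousM cg (cdf v))).
Qed.

Lemma C1_onD (W : normedModType R) (f g : V -> W) : C1_on A f -> C1_on A g ->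
  C1_on A (fun x => f x + g x).
Proof.
move=> Hf Hg z Az; have [df cdf] := Hf z Az; have [dg cdg] := Hg z Az; split.
  exact: differentiableD.
move=> v; apply: (@continuous_near_eq _ _ _ (fun y => 'D_v f y + 'D_v g y)).
  apply: filterS (nearA Az) => y Ay; have [dfy _] := Hf y Ay; have [dgy _] := Hg y Ay.
  exact: (deriveD (diff_derivable (v := v) dfy) (diff_derivable (v := v) dgy)).
exact: (continuousD (cdf v) (cdg v)).
Qed.

Lemma C1_onB (W : normedModType R) (f g : V -> W) : C1_on A f -> C1_on A g ->
  C1_on A (fun x => f x - g x).
Proof.
move=> Hf Hg z Az; have [df cdf] := Hf z Az; have [dg cdg] := Hg z Az; split.
  exact: differentiableB.
move=> v; apply: (@continuous_near_eq _ _ _ (fun y => 'D_v f y - 'D_v g y)).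
  apply: filterS (nearA Az) => y Ay; have [dfy _] := Hf y Ay; have [dgy _] := Hg y Ay.
  exact: (deriveB (diff_derivable (v := v) dfy) (diff_derivable (v := v) dgy)).
exact: (continuousB (cdf v) (cdg v)).
Qed.

Lemma C1_on_cst (W : normedModType R) (c : W) : C1_on A (fun=> c).
Proof.
move=> z Az; split; first exact: differentiable_cst.
move=> v; have -> : 'D_v (fun _ : V => c) = fun=> 0.
  by apply/funext => y; exact: derive_cst.
exact: cst_continuous.
Qed.

Lemma C1_on_coord n (F : V -> 'rV[R]_n) j : C1_on A F -> C1_on A (fun x => F x 0 j).
Proof.
move=> HF z Az; have [dF cdF] := HF z Az; split; first exact: differentiable_rowP.
move=> v; apply: (@continuous_near_eq _ _ _ (fun y => 'D_v F y 0 j)).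
  apply: filterS (nearA Az) => y Ay; have [dFy _] := HF y Ay.
  exact: (derive_coord j (diff_derivable (v := v) dFy)).
exact: (@continuous_comp _ _ _ ('D_v F) (fun u : 'rV[R]_n => u 0 j) z (cdF v)
  (@coord_continuous _ _ _ _ _ _)).
Qed.

Lemma C1_on_sqr_enorm n (F : V -> 'rV[R]_n) : C1_on A F ->
  C1_on A (fun x => enorm (F x) ^+ 2).
Proof.
move=> HF; have -> : (fun x => enorm (F x) ^+ 2) =
    fun x => \sum_(j < n) F x 0 j * F x 0 j.
  by apply/funext => x; rewrite sqr_enorm_row.
elim: (index_enum _) => [|j s IH].
  by under eq_fun do rewrite big_nil; exact: C1_on_cst.
under eq_fun do rewrite big_cons; apply: C1_onD => //.
by apply: C1_onM; exact: C1_on_coord.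
Qed.

End C1_closure.

Section C1_product.
Context {R : realType} (V : normedModType R) (A : set (V * R)).

Lemma C1_on_fst : C1_on A fst.
Proof.
have H z v : is_derive z v (fst : V * R -> V) v.1.
  by case: v => v s; apply: (@is_derive_space _ _ _ id); exact: is_derive_id.
move=> z Az; have cf : continuous (@fst V R) by move=> ?; exact: cvg_fst.
split; first exact: (@linear_differentiable R (V * R)%type V fst z cf).
move=> v; have -> : 'D_v (fst : V * R -> V) = fun=> v.1.
  by apply/funext => y; have [] := H y v.
exact: cst_continuous.
Qed.

Lemma C1_on_snd : C1_on A snd.
Proof.
have H z v : is_derive z v (snd : V * R -> R) v.2.
  apply: (@is_derive_comp_affine _ R R (V * R)%type id snd z v v.2 v.2) => //.
move=> z Az; have cf : continuous (@snd V R) by move=> ?; exact: cvg_snd.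
split; first exact: (@linear_differentiable R (V * R)%type R snd z cf).
move=> v; have -> : 'D_v (snd : V * R -> R) = fun=> v.2.
  by apply/funext => y; have [] := H y v.
exact: cst_continuous.
Qed.

End C1_product.

Section cutoff.
Context {R : realType}.

(** Squaring makes the positive part C^1, the regularity that the energy inequality requires of the
    cutoff. *)
Definition sqr_pos (s : R) := Num.max 0 s ^+ 2.

Lemma is_derive_quadratic (f : R -> R) (s d : R) :
  (forall h, `|f (h + s) - f s - d * h| <= h ^+ 2) -> is_derive s (1 : R) f d.
Proof.
move=> H.
have Hc : h^-1 *: (f (h *: 1 + s) - f s) @[h --> 0^'] --> d.
  apply/cvgrPdist_lt => e e0; near=> h.
  have h0 : h != 0 by near: h; exact: nbhs_dnbhs_neq.
  have he : `|h| < e.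
    near: h; exact: dnbhs0_lt.
  apply: le_lt_trans he.
  have E : h * (h^-1 * (f (h + s) - f s) - d) = f (h + s) - f s - d * h by field.
  have : `|h * (h^-1 * (f (h + s) - f s) - d)| <= `|h| * `|h|.
    by rewrite E (le_trans (H h))// -expr2 real_normK ?num_real.
  by rewrite normrM ler_pM2l ?normr_gt0// distrC [h *: 1]mulr1.
by split; [apply: cvgP Hc|apply: cvg_lim Hc].
Unshelve. all: by end_near. Qed.

(** In all four sign cases the first-order remainder lies between 0 and [h ^+ 2]. *)
Lemma is_derive_sqr_pos (s : R) : is_derive s (1 : R) sqr_pos (2 * Num.max 0 s).
Proof.
apply: is_derive_quadratic => h; rewrite /sqr_pos.
have [s0|s0] := leP 0 s; have [hs0|hs0] := leP 0 (h + s);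
  rewrite ler_norml; apply/andP; split; nra.
Qed.

Lemma continuous_max0 : continuous (fun s : R => 2 * Num.max 0 s).
Proof.
move=> s; have c1 : {for s, continuous (fun _ : R => 0 : R)} by exact: cst_continuous.
have c2 : {for s, continuous (fun _ : R => 2 : R)} by exact: cst_continuous.
exact: (continuousM c2 (@continuous_max _ R (fun=> 0) id s c1 (@cvg_id _ (nbhs s)))).
Qed.

End cutoff.


Section weight.
Context {R : realType} (d : nat).
Local Notation state := 'rV[R]_d.
Variables (alpha C : R).

(* The weight of the theorem times a C^1 cutoff with support in
   [(1 + |x|^2) e^{C t} <= N], which increases to 1 as [N] grows and decreases
   along the characteristics when [C] dominates the growth of the drift. *)
Definition weight (N : R) (z : state * R) : R :=
  (1 + enorm z.1 ^+ 2) `^ (- (2 * alpha)) *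
  sqr_pos (1 - (1 + enorm z.1 ^+ 2) * expR (C * z.2) / N).

Let q (z : state * R) := 1 + enorm z.1 ^+ 2.

Let q_ge1 z : 1 <= q z. Proof. by rewrite lerDl sqr_ge0. Qed.

Let q_gt0 z : 0 < q z. Proof. exact: lt_le_trans ltr01 (q_ge1 z). Qed.

Let C1_on_q (A : set (state * R)) : open A -> C1_on A q.
Proof.
move=> oA; apply: (C1_onD oA); first exact: C1_on_cst.
by apply: (C1_on_sqr_enorm oA); exact: C1_on_fst.
Qed.

Let e (z : state * R) := expR (C * z.2).

Let C1_on_e (A : set (state * R)) : open A -> C1_on A e.
Proof.
move=> oA.
have h : C1_on A (fun z : state * R => C * z.2).
  by apply: (C1_onM oA); [exact: C1_on_cst|exact: C1_on_snd].
apply: (@C1_on_comp1 _ _ A oA expR expR _ h) => z Az.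
exact: continuous_expR.
Qed.

Let cut N z := 1 - q z * e z / N.

Let C1_on_cut N (A : set (state * R)) : open A -> C1_on A (cut N).
Proof.
move=> oA; apply: (C1_onB oA); first exact: C1_on_cst.
apply: (C1_onM oA); last exact: C1_on_cst.
by apply: (C1_onM oA); [exact: C1_on_q|exact: C1_on_e].
Qed.

Lemma C1_on_weight N (A : set (state * R)) : open A -> C1_on A (weight N).
Proof.
move=> oA; apply: (C1_onM oA).
  apply: (@C1_on_comp1 _ _ A oA (fun s => s `^ (- (2 * alpha)))
    (fun s => - (2 * alpha) * s `^ (- (2 * alpha) - 1)) q).
  - exact: C1_on_q.
  - by move=> z Az; exact: is_derive1_powR.
  - move=> z Az; have c1 : {for q z, continuous (fun _ : R => - (2 * alpha))}.
      exact: cst_continuous.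
    have c2 : {for q z, continuous (fun s => s `^ (- (2 * alpha) - 1))}.
      exact: (is_derive_continuous1 (is_derive1_powR (- (2 * alpha) - 1) (q_gt0 z))).
    exact: (continuousM c1 c2).
apply: (@C1_on_comp1 _ _ A oA sqr_pos (fun s => 2 * Num.max 0 s) (cut N)).
- exact: C1_on_cut.
- by move=> z Az; exact: is_derive_sqr_pos.
- by move=> z Az; exact: continuous_max0.
Qed.

Lemma continuous_weight N : continuous (weight N).
Proof.
move=> z; have [dW _] := C1_on_weight N openT (I : setT z).
exact: differentiable_continuous.
Qed.

Lemma weight_ge0 N z : 0 <= weight N z.
Proof. by rewrite mulr_ge0 ?powR_ge0// sqr_ge0. Qed.

Lemma sqr_pos_le0 (s : R) : s <= 0 -> sqr_pos s = 0.
Proof. by move=> s0; rewrite /sqr_pos max_l// expr0n. Qed.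

Lemma weight_supp N x t : 0 < N -> 0 <= C -> 0 <= t -> N < enorm x ->
  weight N (x, t) = 0.
Proof.
move=> N0 C0 t0 xN; rewrite /weight sqr_pos_le0 ?mulr0//= subr_le0.
rewrite ler_pdivlMr// mul1r.
have h1 : 1 <= expR (C * t) by rewrite -expR0 ler_expR mulr_ge0.
have h2 : N <= 1 + enorm x ^+ 2.
  by have := sqr_ge0 (enorm x - 1); have := enorm_ge0 x; lra.
by apply: (le_trans h2); rewrite ler_peMr// addr_ge0// sqr_ge0.
Qed.

(** With [C = 4 B] the quantity [(1 + |x|^2) e^{C t}] does not decrease along [(- b, 1)], so the
    cutoff does not increase ([T1]). The power grows at relative rate [2 alpha (2 x . b) / (1 +
    |x|^2) <= 8 alpha B], at most [8 B] as [alpha < 1]. *)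
Lemma weight_transport B N x t (b : state) : 0 < alpha < 1 -> 0 <= B -> C = 4 * B ->
  0 < N -> enorm b <= B * (1 + enorm x) ->
  'D_((- b, 1) : state * R) (weight N) (x, t) <= 8 * B * weight N (x, t).
Proof.
move=> /andP[a0 a1] B0 CB N0 bB.
set w := (- b, 1) : state * R.
have xb : `|2 * dotv x b| <= 4 * B * (1 + enorm x ^+ 2).
  rewrite normrM ger0_norm//.
  have h1 := normr_dotv x b.
  have h2 := ler_wpM2l (enorm_ge0 x) bB.
  have h3 : B * (enorm x * (1 + enorm x)) <= B * (2 * (1 + enorm x ^+ 2)).
    by rewrite ler_wpM2l//; have := sqr_ge0 (enorm x - 1); have := enorm_ge0 x; nra.
  lra.
have Hq : is_derive (x, t) w q (- (2 * dotv x b)).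
  have H1 : is_derive x (- b) (fun y : state => enorm y ^+ 2) (- (2 * dotv x b)).
    have := is_derive_sqr_enorm (is_derive_id x (- b)).
    by move/is_derive_eq; apply; rewrite dotvNr mulrN.
  have H2 := @is_derive_space _ _ _ _ (x, t) (- b) 1 _ H1.
  have := is_deriveD (is_derive_cst (1 : R) (x, t) w) H2.
  by move/is_derive_eq; apply; rewrite add0r.
have He : is_derive (x, t) w e (e (x, t) * C).
  apply: (@is_derive_comp1 _ _ expR (fun y : state * R => C * y.2)).
  have Hk := is_deriveZ C (is_derive_time (x, t) (- b)).
  exact: (is_derive_eq Hk (mulr1 C)).
have Hcut : is_derive (x, t) w (cut N)
    (- ((- (2 * dotv x b) + C * q (x, t)) * e (x, t) / N)).
  have H1 := is_deriveM (is_deriveM Hq He) (is_derive_cst N^-1 (x, t) w).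
  have := is_deriveB (is_derive_cst (1 : R) (x, t) w) H1.
  by move/is_derive_eq; apply; rewrite /= !fctE ![_ *: _]mulrC/=; ring.
have Hpow := is_derive_comp1 (is_derive1_powR (- (2 * alpha)) (q_gt0 (x, t))) Hq.
have Hsq := is_derive_comp1 (is_derive_sqr_pos (cut N (x, t))) Hcut.
have HW : is_derive (x, t) w (weight N) _ := is_deriveM Hpow Hsq.
have [_ ->] := HW.
rewrite ![_ *: _]mulrC /=.
have e0 : 0 < e (x, t) by exact: expR_gt0.
have powE : q (x, t) `^ (- (2 * alpha) - 1) = q (x, t) `^ (- (2 * alpha)) / q (x, t).
  rewrite powRD ?powR_inv1//; first exact: ltW.
  by rewrite (gt_eqF (q_gt0 _)) implybT.
rewrite powE /weight -/(q (x, t)) -/(e (x, t)) -/(cut N (x, t)).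
have p0 : 0 <= q (x, t) `^ (- (2 * alpha)) by exact: powR_ge0.
set pw := q (x, t) `^ _ in p0 *.
set qq := q (x, t) in xb Hq Hcut *.
have qq0 : 0 < qq by exact: q_gt0.
have s0 : 0 <= sqr_pos (cut N (x, t)) by exact: sqr_ge0.
set sq := sqr_pos _ in s0 *.
have m0 : 0 <= Num.max 0 (cut N (x, t)) by rewrite le_max lexx.
set mm := Num.max _ _ in m0 *.
move: xb; rewrite -/(q (x, t)) -/qq => /ler_normlP[_ xb].
set D := 2 * dotv x b in xb *.
have T1 : 0 <= 2 * mm * ((- D + C * qq) * e (x, t) / N) * pw.
  do ?apply: mulr_ge0 => //; rewrite ?invr_ge0 ?(ltW e0) ?(ltW N0)//.
  by rewrite CB; lra.
have T2 : D / qq <= 4 * B by rewrite ler_pdivrMr.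
have T3 : alpha * (D / qq) <= 4 * B.
  apply: (@le_trans _ _ (alpha * (4 * B))); first by rewrite ler_wpM2l// ltW.
  by rewrite ler_piMl ?mulr_ge0// ltW.
have T4 : 2 * (alpha * (D / qq)) * (pw * sq) <= 2 * (4 * B) * (pw * sq).
  by rewrite ler_wpM2r ?mulr_ge0// ler_wpM2l.
have -> : 2 * mm * - ((- D + C * qq) * e (x, t) / N) * pw +
  - (2 * alpha) * (pw / qq) * - D * sq =
  - (2 * mm * ((- D + C * qq) * e (x, t) / N) * pw) +
   2 * (alpha * (D / qq)) * (pw * sq) by ring.
lra.
Qed.

Lemma weight_mono N N' z : 0 < N -> N <= N' -> weight N z <= weight N' z.
Proof.
move=> N0 NN'; rewrite /weight ler_wpM2l ?powR_ge0//.
have mx (s : R) : 0 <= Num.max 0 s by rewrite le_max lexx.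
rewrite /sqr_pos ler_sqr ?nnegrE ?mx// ge_max mx/= le_max; apply/orP; right.
rewrite lerD2l lerN2; apply: ler_wpM2l.
  by rewrite mulr_ge0 ?expR_ge0// addr_ge0// sqr_ge0.
by rewrite lef_pV2 ?posrE// (lt_le_trans N0).
Qed.

Lemma weight_cvg z : weight n.+1%:R z @[n --> \oo] -->
  ((1 + enorm z.1 ^+ 2) `^ (2 * alpha))^-1.
Proof.
rewrite -[X in _ --> X]mulr1 -powRN; apply: cvgM; first exact: cvg_cst.
have E1 : sqr_pos (1 : R) = 1 by rewrite /sqr_pos max_r// expr1n.
have H : 1 - (1 + enorm z.1 ^+ 2) * expR (C * z.2) / n.+1%:R @[n --> \oo] --> (1 : R).
  rewrite -[X in _ --> X]subr0; apply: cvgB; first exact: cvg_cst.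
  rewrite -[X in _ --> X](mulr0 ((1 + enorm z.1 ^+ 2) * expR (C * z.2))).
  apply: cvgM; first exact: cvg_cst.
  exact: cvg_harmonic.
have cs : {for (1 : R), continuous (@sqr_pos R)}.
  exact: (is_derive_continuous1 (is_derive_sqr_pos 1)).
by have := cvg_comp _ (@sqr_pos R) H cs; rewrite E1.
Qed.

End weight.


(** * Contraction of the weighted errors *)

Section truncation.
Context {R : realType} (d : nat).
Local Notation state := 'rV[R]_d.
Local Notation leb := (@lebesgue_measure R).
Local Notation mu := (@lebesgue_measure_n R d).
Variables (alpha gamma C T : R) (D : state -> R -> state).
Hypothesis T_gt0 : 0 < T.
Hypothesis C_ge0 : 0 <= C.
Hypothesis D_cont :
  {within [set z : state * R | 0 <= z.2 <= T], continuous (fun z => D z.1 z.2)}.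

Definition truncated (n : nat) (z : state * R) : R :=
  enorm (D z.1 z.2) ^+ 2 * weight alpha C n.+1%:R z.

Definition truncated_error (n : nat) : R :=
  (\int[leb]_(t in `[0, T]) (expR (- gamma * t) * clamped_Int T (truncated n) t))%R.

(** [err] for a general [D]: with the increment from k to k.+1 it is convertible to [err] at index
    k.+1. *)
Definition weighted_error : \bar R :=
  (\int[leb]_(t in `[0%R, T]) ((expR (- gamma * t))%:E *
     \int[mu]_z (let x := rV_of_tuple z in
        (enorm (D x t) ^+ 2 / ((1 + enorm x ^+ 2) `^ (2 * alpha)))%R%:E)))%E.

Lemma truncated_continuous n :
  {within [set z : state * R | 0 <= z.2 <= T], continuous (truncated n)}.
Proof.
move=> z; apply: cvgM.
  exact: (continuous_within_comp D_cont (@continuous_sqr_enorm _ _)).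
exact: (continuous_subspaceT (@continuous_weight _ _ alpha C n.+1%:R)).
Qed.

Lemma truncated_ge0 n z : 0 <= truncated n z.
Proof. by rewrite mulr_ge0 ?sqr_ge0 ?weight_ge0. Qed.

Lemma truncated_supp n x t : 0 <= t <= T -> n.+1%:R < enorm x -> truncated n (x, t) = 0.
Proof. by move=> /andP[t0 _] xn; rewrite /truncated weight_supp ?mulr0. Qed.

Let Cc_truncated n t : Cc n.+1%:R (fun x => truncated n (x, clamp T t)).
Proof.
have H := clamp_itv (ltW T_gt0) t.
split => [|x]; last exact: truncated_supp.
apply: (@continuous_comp_within _ _ _ _ (truncated n)
  (fun y : state => (y, clamp T t)) (@truncated_continuous n)) => //.
move=> x; have h1 : {for x, continuous (fun _ : state => clamp T t)}.
  exact: cst_continuous.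
exact: (cvg_pair (@cvg_id _ (nbhs x)) h1).
Qed.

Let truncated_mono x t : {homo (fun n => truncated n (x, t)) : m n / (m <= n)%N >-> m <= n}.
Proof.
move=> m n mn; rewrite /truncated ler_wpM2l ?sqr_ge0//.
by apply: weight_mono; rewrite ?ltr0n// ler_nat.
Qed.

Let truncated_Int_EFin n t : ((clamped_Int T (truncated n) t)%:E =
  \int[mu]_z (truncated n (rV_of_tuple z, clamp T t))%:E)%E.
Proof.
rewrite /clamped_Int /Int /Rintegral fineK//.
exact: (integrable_fin_num measurableT (Cc_integrable (Cc_truncated n t))).
Qed.

Let truncated_measurable n t :
  measurable_fun setT (fun z => (truncated n (rV_of_tuple z, clamp T t))%:E : \bar R).
Proof.
apply/measurable_EFinP.
exact: (measurable_rV_of_tuple (Cc_truncated n t).1).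
Qed.

Let truncated_cvg x t : 0 <= t <= T ->
  (truncated n (x, clamp T t))%:E @[n --> \oo] -->
  (enorm (D x t) ^+ 2 / ((1 + enorm x ^+ 2) `^ (2 * alpha)))%R%:E.
Proof.
move=> tT; rewrite clamp_id//; apply: cvg_EFin; first exact: nearW.
by apply: cvgM; [exact: cvg_cst|exact: (@weight_cvg R d alpha C (x, t))].
Qed.

Lemma clamped_Int_cvg t : 0 <= t <= T ->
  (clamped_Int T (truncated n) t)%:E @[n --> \oo] -->
  (\int[mu]_z (let x := rV_of_tuple z in
        (enorm (D x t) ^+ 2 / ((1 + enorm x ^+ 2) `^ (2 * alpha)))%R%:E))%E.
Proof.
move=> tT.
have -> : (\int[mu]_z (let x := rV_of_tuple z in
    (enorm (D x t) ^+ 2 / ((1 + enorm x ^+ 2) `^ (2 * alpha)))%R%:E))%E = (\int[mu]_z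
    limn (fun n => (truncated n (rV_of_tuple z, clamp T t))%:E))%E.
  apply: eq_integral => z _; apply/esym/cvg_lim => //.
  exact: truncated_cvg.
under eq_fun do rewrite truncated_Int_EFin.
apply: cvg_monotone_convergence => //.
- by move=> n z _; rewrite lee_fin truncated_ge0.
- by move=> z _ m n mn; rewrite lee_fin truncated_mono.
Qed.

Let clamped_Int_mono t : {homo (fun n => clamped_Int T (truncated n) t) :
  m n / (m <= n)%N >-> m <= n}.
Proof.
move=> m n mn; apply: (@le_Int _ _ n.+1%:R).
- split; first exact: (Cc_truncated m t).1.
  move=> x xn; apply: (Cc_truncated m t).2; apply: le_lt_trans xn.
  by rewrite ler_nat.
- exact: Cc_truncated.
- by move=> x; exact: truncated_mono.
Qed.

Let clamped_Int_continuous n : continuous (clamped_Int T (truncated n)).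
Proof.
apply: (@continuous_clamped_Int _ _ T n.+1%:R) => //.
  exact: truncated_continuous.
by move=> x t; exact: truncated_supp.
Qed.

Let wE_continuous n :
  continuous (fun t => expR (- gamma * t) * clamped_Int T (truncated n) t).
Proof.
move=> t; have cw : {for t, continuous (fun t => expR (- gamma * t))}.
  apply: (@continuous_comp _ _ _ (fun t => - gamma * t) expR); last exact: continuous_expR.
  have cc : {for t, continuous (fun _ : R => - gamma)} by exact: cst_continuous.
  exact: (continuousM cc (@cvg_id _ (nbhs t))).
exact: (continuousM cw (@clamped_Int_continuous n t)).
Qed.

Let truncated_error_EFin n : ((truncated_error n)%:E =
  \int[leb]_(t in `[0%R, T]) (expR (- gamma * t) * clamped_Int T (truncated n) t)%R%:E)%E.
Proof.
rewrite /truncated_error /Rintegral fineK//.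
apply: integrable_fin_num => //.
exact: (continuous_integrable_itv 0 T (@wE_continuous n)).
Qed.

(** Monotone convergence a second time, now in [t], after the convergence in x of [clamped_Int_cvg].
    The limit is an extended real and may be infinite. *)
Lemma truncated_error_cvg : (truncated_error n)%:E @[n --> \oo] --> weighted_error.
Proof.
have -> : weighted_error = (\int[leb]_(t in `[0%R, T])
    limn (fun n => (expR (- gamma * t) * clamped_Int T (truncated n) t)%R%:E))%E.
  apply: eq_integral => t; rewrite inE/= in_itv/= => tT; apply/esym/cvg_lim => //.
  under eq_fun do rewrite EFinM.
  by apply: cvgeZl => //; exact: clamped_Int_cvg.
under eq_fun do rewrite truncated_error_EFin.
apply: cvg_monotone_convergence => //.
- by move=> n; exact: (measurable_int leb (continuous_integrable_itv 0 T (@wE_continuous n))).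
- move=> n t _; rewrite lee_fin mulr_ge0 ?expR_ge0//.
  by apply: Int_ge0 => x; exact: truncated_ge0.
- by move=> t _ m n mn; rewrite lee_fin ler_wpM2l ?expR_ge0// clamped_Int_mono.
Qed.

Lemma truncated_error_ge0 n : 0 <= truncated_error n.
Proof.
apply: Rintegral_ge0 => t _; rewrite mulr_ge0 ?expR_ge0//.
by apply: Int_ge0 => x; exact: truncated_ge0.
Qed.

Lemma truncated_error_le n : ((truncated_error n)%:E <= weighted_error)%E.
Proof.
have cvgE := truncated_error_cvg.
rewrite -(cvg_lim _ cvgE)//; apply: lime_ge; first by apply/cvg_ex; exists weighted_error.
near=> m; rewrite lee_fin; apply: le_Rintegral => //.
- exact: (continuous_integrable_itv 0 T (@wE_continuous n)).
- exact: (continuous_integrable_itv 0 T (@wE_continuous m)).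
- move=> t _; rewrite ler_wpM2l ?expR_ge0// clamped_Int_mono//.
  by near: m; exact: nbhs_infty_ge.
Unshelve. all: by end_near. Qed.

End truncation.


Section contraction.
Context {R : realType} (d p : nat).
Local Notation state := 'rV[R]_d.
Local Notation control := 'rV[R]_p.
Variables (Cf Cl l0 M P H alpha gamma T : R).
Variables (u0 : state -> R) (f : state -> control -> state) (l : state -> control -> R).
Variables (lam : nat -> state -> R -> state) (a : nat -> state -> R -> control).
Hypothesis T_gt0 : 0 < T.
Hypothesis M_ge0 : 0 <= M.
Hypothesis P_ge0 : 0 <= P.
Hypothesis alpha01 : 0 < alpha < 1.
Hypothesis gamma_ge : 1 + 8 * P + d%:R * P + 2 * H ^+ 2 + 1 <= gamma.
Hypothesis u0_C2 : C2 u0.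
Hypothesis Hfl : regular_data Cf Cl l0 f l.
Hypothesis Hit : policy_iterates u0 f l T lam a.
Hypothesis lam_bound : forall k, linear_lipschitz_bound M T (lam k).
Hypothesis drift_growth : forall k x t, 0 < t < T ->
  enorm (f x (a k x t)) <= P * (1 + enorm x).
Hypothesis drift_lipschitz : forall k x y t, 0 < t < T ->
  enorm (f x (a k x t) - f y (a k y t)) <= P * enorm (x - y).
Hypothesis control_bound : forall k x t, 0 < t < T ->
  M * enorm (f x (a k.+1 x t) - f x (a k x t)) +
    enorm (source f l x (a k.+1 x t) (lam k.+1 x t) - source f l x (a k x t) (lam k x t))
    <= H * enorm (lam k.+1 x t - lam k x t).

Let increment k x t := lam k.+1 x t - lam k x t.

Lemma iterates_continuous k :
  {within [set z : state * R | 0 <= z.2 <= T], continuous (fun z => lam k z.1 z.2)}.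
Proof.
case: k => [|k]; last exact: (transport_continuous (iterates_value Hit k)).
have cg : continuous (fun z : state * R => grad u0 z.1).
  move=> z; apply: (@continuous_comp _ _ _ fst (grad u0)); first exact: cvg_fst.
  apply: differentiable_continuous; apply: differentiable_row => i.
  exact: C2_differentiable_derive.
apply: (subspace_eq_continuous _ (continuous_subspaceT cg)) => z.
rewrite inE/= => zT; rewrite /from_subspace.
by rewrite (iterates_init Hit z.1 zT).
Qed.

Let increment_continuous k :
  {within [set z : state * R | 0 <= z.2 <= T], continuous (fun z => increment k z.1 z.2)}.
Proof. by move=> z; apply: cvgB; exact: iterates_continuous. Qed.

Let strip := [set z : state * R | 0 < z.2 < T].

Let open_strip : open strip.
Proof.
have -> : strip = snd @^-1` [set` `]0, T[].
  by apply/seteqP; split => z /=; rewrite in_itv.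
by apply: open_comp => [z _|]; [exact: cvg_snd|exact: interval_open].
Qed.

(* Both iterates are differentiated along the characteristics of the newer one;
   for the older one the drift mismatch is paid by its Lipschitz bound [M]. *)
Let increment_transport k x t : 0 < t < T -> exists2 h,
  is_derive (x, t) (- f x (a k.+1 x t), 1 : R) (fun z : state * R => increment k.+1 z.1 z.2) h
  & enorm h <= H * enorm (increment k x t).
Proof.
move=> tT; have [fC2 _ _ _] := Hfl.
have H2 := transport_is_derive fC2 x (iterates_value Hit k.+1) tT.
have H1 := transport_is_derive fC2 x (iterates_value Hit k) tT.
pose F (z : state * R) := lam k.+1 z.1 z.2.
have [dF _] := transport_C1 (iterates_value Hit k) (tT : strip (x, t)).
set b1 := f x (a k.+1 x t) in H2 *; set b0 := f x (a k x t) in H1.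
set s1 := source _ _ _ _ _ in H2; set s0 := source _ _ _ _ _ in H1.
(* [(- b1, 1) = (- b0, 1) + (v, 0)], so the older iterate is differentiated along its own
   characteristic plus a purely spatial correction. *)
pose v := b0 - b1.
have H3 : is_derive (x, t) (- b1, 1 : R) F (s0 + 'D_((v, 0) : state * R) F (x, t)).
  split; first exact: diff_derivable.
  have [_ <-] := H1; rewrite !deriveE// -linearD; congr ('d F (x, t) _).
  by congr pair; rewrite /= ?addr0// /v addKr.
have Dv : enorm ('D_((v, 0) : state * R) F (x, t)) <= M * enorm v.
  apply: (enorm_derive_le (derivableP (diff_derivable dF))) => h h0.
  rewrite /F /= scaler0 add0r.
  have [t0 tT'] := andP tT.
  have tT2 : 0 <= t <= T by rewrite !ltW.
  have [_ /(_ x) HL] := lam_bound k.+1 tT2 (h *: v + x).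
  by rewrite (le_trans HL)// addrK enormZ mulrCA mulrC -mulrA mulrC.
exists (s1 - (s0 + 'D_((v, 0) : state * R) F (x, t))); first exact: is_deriveB.
have -> : s1 - (s0 + 'D_((v, 0) : state * R) F (x, t)) =
  (s1 - s0) - 'D_((v, 0) : state * R) F (x, t) by rewrite opprD addrA.
rewrite (le_trans (ler_enormB _ _))// addrC.
apply: le_trans (control_bound k x tT); rewrite lerD2r (le_trans Dv)//.
by rewrite /v enorm_sym.
Qed.

(** Young's inequality [2 delta . h <= |delta|^2 + |h|^2] and [|h| <= H |delta'|] give the energy
    rates [1 + 8 P] and [H ^+ 2], which do not depend on the truncation level. Each truncated error
    on the right is bounded by the full one before the limit is taken on the left. *)
Lemma error_contraction k :
  (weighted_error alpha gamma T (increment k.+1) <=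
   (2^-1)%:E * weighted_error alpha gamma T (increment k))%E.
Proof.
pose C := 4 * P.
have C0 : 0 <= C by rewrite mulr_ge0.
have Hn n : truncated_error alpha gamma C T (increment k.+1) n <=
    2^-1 * truncated_error alpha gamma C T (increment k) n.
  pose phi := truncated alpha C (increment k.+1) n.
  pose psi := truncated alpha C (increment k) n.
  have phiC1 : C1_on strip phi.
    apply: (C1_onM open_strip); last exact: (C1_on_weight alpha C _ open_strip).
    apply: (C1_on_sqr_enorm open_strip); apply: (C1_onB open_strip).
      exact: (transport_C1 (iterates_value Hit k.+1)).
    exact: (transport_C1 (iterates_value Hit k)).
  have phi_init x : phi (x, 0) = 0.
    rewrite /phi /truncated /increment /= (transport_init (iterates_value Hit k.+1)).
    by rewrite (transport_init (iterates_value Hit k)) subrr enorm0 expr0n mul0r.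
  have phi_transport x t : 0 < t < T ->
      'D_((- f x (a k.+1 x t), 1) : state * R) phi (x, t) <=
      (1 + 8 * P) * phi (x, t) + H ^+ 2 * psi (x, t).
    move=> tT; have [h Hh hle] := increment_transport k x tT.
    set w := (- f x (a k.+1 x t), 1) : state * R.
    have Wle := @weight_transport R d alpha C P n.+1%:R x t (f x (a k.+1 x t))
      alpha01 P_ge0 erefl (ltr0Sn _ _) (drift_growth _ x tT).
    have [dW _] := C1_on_weight alpha C n.+1%:R openT (I : setT (x, t)).
    have HW := derivableP (diff_derivable (v := w) dW).
    have [_ ->] := is_deriveM (is_derive_sqr_enorm Hh) HW.
    rewrite ![_ *: _]mulrC /phi /psi /truncated /=.
    have W0 := weight_ge0 alpha C n.+1%:R (x, t).
    set W := weight alpha C n.+1%:R (x, t) in W0 Wle *.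
    set dlt := increment k.+1 x t; set dlt' := increment k x t in hle *.
    have h1 := ler_wpM2r (sqr_ge0 (enorm dlt)) Wle.
    have h2 : 2 * dotv dlt h <= enorm dlt ^+ 2 + H ^+ 2 * enorm dlt' ^+ 2.
      have g1 := dotv_le dlt h; have g2 := sqr_ge0 (enorm dlt - enorm h).
      have g3 : enorm h ^+ 2 <= H ^+ 2 * enorm dlt' ^+ 2.
        by rewrite -exprMn ler_sqr ?nnegrE ?enorm_ge0// (le_trans (enorm_ge0 h)).
      lra.
    have h3 := ler_wpM2r W0 h2.
    rewrite -/w in h1; lra.
  have E : (gamma - (1 + 8 * P + d%:R * P)) *
      truncated_error alpha gamma C T (increment k.+1) n <=
      H ^+ 2 * truncated_error alpha gamma C T (increment k) n := @transport_energy R d T n.+1%:R P (1 + 8 * P) (H ^+ 2) phi psi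
    (fun x t => f x (a k.+1 x t)) T_gt0
    (@truncated_continuous _ _ alpha C T _ (@increment_continuous k.+1) n)
    (@truncated_continuous _ _ alpha C T _ (@increment_continuous k) n)
    phiC1
    (fun x t => @truncated_supp _ _ alpha C T _ C0 n x t)
    (fun x t => @truncated_supp _ _ alpha C T _ C0 n x t)
    (fun x t _ => truncated_ge0 alpha C _ n (x, t))
    phi_init (@drift_lipschitz k.+1) phi_transport gamma.
  have X0 := truncated_error_ge0 alpha gamma C T (increment k.+1) n.
  have Y0 := truncated_error_ge0 alpha gamma C T (increment k) n.
  move: (truncated_error alpha gamma C T (increment k.+1) n)
    (truncated_error alpha gamma C T (increment k) n) X0 Y0 E => X Y X0 Y0 E.
  have H20 := sqr_ge0 H.
  have g : 0 < 2 * H ^+ 2 + 1 by lra.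
  (* [H^2 / (2 H^2 + 1) <= 1 / 2]; the 1 keeps the divisor positive when [H = 0]. *)
  have E2 : (2 * H ^+ 2 + 1) * X <= H ^+ 2 * Y.
    apply: (le_trans _ E); apply: ler_wpM2r => //.
    by move: (d%:R * P) gamma_ge => dP hg; lra.
  rewrite -(ler_pM2l g); lra.
have cvgX := @truncated_error_cvg _ _ alpha gamma C T _ T_gt0 C0 (@increment_continuous k.+1).
rewrite -(cvg_lim _ cvgX)//; apply: lime_le.
  by apply/cvg_ex; exists (weighted_error alpha gamma T (increment k.+1)).
apply: nearW => n; rewrite (@le_trans _ _ ((2^-1)%:E * (truncated_error alpha gamma C T (increment k) n)%:E)%E)//.
  by rewrite -EFinM lee_fin Hn.
rewrite lee_wpmul2l// ?lee_fin//.
exact: (@truncated_error_le _ _ alpha gamma C T _ T_gt0 C0 (@increment_continuous k)).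
Qed.

End contraction.


Theorem theorem1p4 (R : realType) (d p : nat) (hd : (0 < d)%N) (hp : (0 < p)%N)
    (C0 Cf Cl l0 : R) (hC0 : 0 < C0) (hCf : 0 < Cf) (hCl : 0 < Cl)
    (hl0 : 0 < l0) :
  exists T0 gamma0 : R, 0 < T0 /\ 0 < gamma0 /\
    forall (u0 : 'rV[R]_d -> R) (f : 'rV[R]_d -> 'rV[R]_p -> 'rV[R]_d)
           (l : 'rV[R]_d -> 'rV[R]_p -> R),
      C2 u0 ->
      C2 (fun z : 'rV[R]_d * 'rV[R]_p => f z.1 z.2) ->
      C2 (fun z : 'rV[R]_d * 'rV[R]_p => l z.1 z.2) ->
      assumption_A0 C0 u0 ->
      assumption_A1 Cf Cl l0 f l ->
      assumption_A2 Cf Cl f l ->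
    forall (alpha gamma T : R),
      0 < alpha < 1 -> 0 < gamma -> 0 < T ->
      T <= T0 -> gamma0 <= gamma ->
    forall (lam : nat -> 'rV[R]_d -> R -> 'rV[R]_d)
           (a : nat -> 'rV[R]_d -> R -> 'rV[R]_p),
      policy_iterates u0 f l T lam a ->
      let e := err alpha gamma T lam in
      (forall k : nat, (1 <= k)%N ->
         (e k <= (2 ^- k.-1)%:E * e 1%N)%E) /\
      ((e 1%N < +oo)%E ->
         exists C : R, \forall k \near \oo, (e k <= (C * 2 ^- k)%:E)%E).
Proof.
have M0 : 0 <= 2 * C0 by rewrite mulr_ge0// ltW.
have [T0 T00 HT] := iterates_bound d p hCf hCl hl0 hC0.
have [P P0 HP] := policy_bounds d p hCf hCl hl0 M0.
have [H H0 HH] := policy_control_bound d p hCf hCl hl0 M0.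
have dP0 : 0 <= d%:R * P by rewrite mulr_ge0.
(* In [gamma0], the leading 1 comes from Young's inequality, [8 P] from the growth of the weight,
   [d P] from the [d] Lipschitz coordinates of the drift, and [2 H^2 + 1] is the margin that yields
   the factor 1/2. *)
exists T0, (1 + 8 * P + d%:R * P + 2 * H ^+ 2 + 1); split=> //; split.
  by have := sqr_ge0 H; move: (d%:R * P) dP0 => dP dP0; lra.
move=> u0 f l u0C2 fC2 lC2 HA0 HA1 HA2 alpha gamma T alpha01 gamma0 Tgt0 TT0 gamma_ge.
move=> lam a Hit e.
have Hfl : regular_data Cf Cl l0 f l by split.
have lam_bound k : linear_lipschitz_bound (2 * C0) T (lam k).
  by apply: (HT _ _ _ u0C2 HA0 Hfl _ _ _ _ Hit); rewrite Tgt0.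
have drift k x y t : 0 < t < T -> [/\ enorm (f x (a k x t)) <= P * (1 + enorm x),
      enorm (f x (a k x t) - f y (a k y t)) <= P * enorm (x - y),
      enorm (source f l x (a k x t) (lam k x t)) <= P * (1 + enorm x) &
      enorm (source f l x (a k x t) (lam k x t) - source f l y (a k y t) (lam k y t))
        <= P * enorm (x - y)].
  move=> /andP[t0 tT]; have tT' : 0 <= t <= T by rewrite !ltW.
  have [h1 h2] := lam_bound k t tT' x.
  by apply: HP => //; exact: (iterates_policy Hit).
have contr k : (e k.+2 <= (2^-1)%:E * e k.+1)%E.
  apply: (@error_contraction R d p Cf Cl l0 (2 * C0) P H alpha gamma T u0 f l lam a) => //.
  - by move=> {}k x t tT; have [] := drift k x x t tT.
  - by move=> {}k x y t tT; have [] := drift k x y t tT.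
  - move=> {}k x t /andP[t0 tT]; have tT' : 0 <= t <= T by rewrite !ltW.
    by apply: (HH _ _ Hfl); exact: (iterates_policy Hit).
have decay k : (e k.+1 <= (2 ^- k)%:E * e 1%N)%E.
  elim: k => [|k IH]; first by rewrite expr0 invr1 mul1e.
  apply: (le_trans (contr k)).
  by rewrite exprS invfM EFinM -muleA lee_wpmul2l// lee_fin.
split; first by case.
move=> e1oo.
have e1_ge0 : (0 <= e 1%N)%E.
  apply: integral_ge0 => t _; apply: mule_ge0; first by rewrite lee_fin expR_ge0.
  apply: integral_ge0 => z _; rewrite lee_fin; apply: mulr_ge0; first exact: sqr_ge0.
  by rewrite invr_ge0 powR_ge0.
(* [2^{-(k-1)} = 2 * 2^{-k}] accounts for the factor 2; the bound starts at index 1, and [fine] is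
   exact since [e 1] is finite. *)
exists (2 * fine (e 1%N)); exists 1%N => // -[//|k] _ /=.
apply: (le_trans (decay k)).
rewrite -[X in (_ * X)%E](@fineK _ (e 1%N)) ?ge0_fin_numE// -EFinM lee_fin.
by rewrite exprS invfM mulrACA divff// mul1r mulrC.
Qed.
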